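(* Let $\omega\in\{\omega_0,\omega_1,\omega_2\}$. Then, for every $\boldsymbol{v}\in\dot H^1_{0,\sigma}(\mathbb{R}^2_+)\cap L^\infty(\mathbb{R}^2_+,\omega^{1/2})$, there exists a sequence $\{\boldsymbol{v}_n\}_{n\in\mathbb{N}}\subset C^\infty_{c,\sigma}(\mathbb{R}^2_+)$ satisfying the following two properties: (i) The sequence $\{\boldsymbol{v}_n\}_{n\in\mathbb{N}}$ converges to $\boldsymbol{v}$ in $\dot H^1_{0,\sigma}(\mathbb{R}^2_+)$. (ii) For any $\boldsymbol{u}\in\dot H^1_{0,\sigma}(\mathbb{R}^2_+)$, the sequence $\{\boldsymbol{u}\otimes\boldsymbol{v}_n\}_{n\in\mathbb{N}}$ converges to $\boldsymbol{u}\otimes\boldsymbol{v}$ in $L^2(\mathbb{R}^2_+)$.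
   Context: Let $\mathbb{R}^2_+=\{\boldsymbol{x}=(x_1,x_2)\in\mathbb{R}^2: x_2>0\}$. Let $C^\infty_{c,\sigma}(\mathbb{R}^2_+)$ be the set of compactly supported smooth vector fields $\boldsymbol{\varphi}:\mathbb{R}^2_+\to\mathbb{R}^2$ with $\nabla\cdot\boldsymbol{\varphi}=0$. The homogeneous Sobolev space is $\dot H^1(\mathbb{R}^2_+)=\{u\in L^1_{\mathrm{loc}}(\mathbb{R}^2_+):\nabla u\in L^2(\mathbb{R}^2_+)\}$ with semi-norm $\|\nabla u\|_{L^2(\mathbb{R}^2_+)}$. $\dot H^1_{0,\sigma}(\mathbb{R}^2_+)$ denotes the completion of $C^\infty_{c,\sigma}(\mathbb{R}^2_+)$ in $\dot H^1(\mathbb{R}^2_+)\times\dot H^1(\mathbb{R}^2_+)$; by Hardy's inequality the semi-norm is a norm on it, and its elements are identified with functions (limits $\boldsymbol v$ of sequences $\boldsymbol\varphi_k\in C^\infty_{c,\sigma}(\mathbb{R}^2_+)$ with $\nabla\boldsymbol\varphi_k\to\nabla\boldsymbol v$ in $L^2$ and $\boldsymbol\varphi_k\to\boldsymbol v$ in $L^2_{\mathrm{loc}}$). Its norm is $\|\nabla\boldsymbol{v}\|_{L^2(\mathbb{R}^2_+)}$. Weights: $\omega_0(\boldsymbol{x})=\frac{|x_2|^2|\boldsymbol{x}|}{|x_2|+4|\boldsymbol{x}|}$, $\omega_1(\boldsymbol{x})=|x_2||\boldsymbol{x}|$, $\omega_2(\boldsymbol{x})=|x_2|^2/4$. For a weight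 $\mu$, $L^\infty(\mathbb{R}^2_+,\mu)$ is the space of functions with finite norm $\|f\|_{L^\infty(\mathbb{R}^2_+,\mu)}=\operatorname{ess\,sup}_{\boldsymbol{x}\in\mathbb{R}^2_+}|f(\boldsymbol{x})\mu(\boldsymbol{x})|$. $\boldsymbol{u}\otimes\boldsymbol{v}$ is the matrix field with entries $u_iv_j$. *)

(* Defs.v *)
From HB Require Import structures.
From mathcomp Require Import all_boot all_order all_algebra.
From mathcomp Require Import all_classical all_reals all_analysis.
From mathcomp Require Import ess_sup_inf hoelder.

Set Implicit Arguments.
Unset Strict Implicit.
Unset Printing Implicit Defensive.
Import Order.TTheory GRing.Theory Num.Theory.
Import numFieldNormedType.Exports.

Local Open Scope classical_set_scope.
Local Open Scope ring_scope.

(* The plane is the product [R * R], as this is the type which carries the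
   product Lebesgue measure.  Functions on the half-plane are total functions
   on [R * R] whose values at points with [x.2 <= 0] are irrelevant, except for
   test functions, which are extended by zero.  Vector fields take values in
   ['rV[R]_2], and elements of function spaces are Borel representatives of
   their a.e.-classes. *)

Definition halfplane (R : realType) : set (R * R) := [set x | 0 < x.2].

Definition lebesgue2 (R : realType) :
    {measure set (measurableTypeR R * measurableTypeR R) -> \bar R} :=
  (@lebesgue_measure R \x @lebesgue_measure R)%E.

(* The library norms on [R * R] and on matrices are sup norms. *)
Definition enorm2 (R : realType) (x : R * R) : R :=
  Num.sqrt (x.1 ^+ 2 + x.2 ^+ 2).

Definition frob (R : realType) (m n : nat) (A : 'M[R]_(m, n)) : R :=
  Num.sqrt (\sum_i \sum_j A i j ^+ 2).

Definition unit_dir (R : realType) (i : 'I_2) : R * R :=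
  ((i == 0 :> nat)%:R, (i == 1 :> nat)%:R).

Definition partial (R : realType) (i : 'I_2) (f : R * R -> R) : R * R -> R :=
  fun x => 'D_(unit_dir R i) f x.

Definition smooth_on (R : realType) (D : set (R * R)) (f : R * R -> R) : Prop :=
  forall (s : seq 'I_2) (x : R * R), D x ->
    {for x, continuous (foldr (@partial R) f s)} /\
    forall i, derivable (foldr (@partial R) f s) x (unit_dir R i).

Definition test_fun (R : realType) (f : R * R -> R) : Prop :=
  [/\ smooth_on (@halfplane R) f,
      compact (closure [set x | f x != 0]) &
      closure [set x | f x != 0] `<=` @halfplane R].

Definition component (R : realType) (i : 'I_2) (v : R * R -> 'rV[R]_2) :
    R * R -> R :=
  fun x => v x ord0 i.

Definition test_field_divfree (R : realType) (phi : R * R -> 'rV[R]_2) : Prop :=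
  (forall i, test_fun (component i phi)) /\
  (forall x, halfplane x -> \sum_(i < 2) partial i (component i phi) x = 0).

Definition jacobian (R : realType) (phi : R * R -> 'rV[R]_2) :
    R * R -> 'M[R]_2 :=
  fun x => \matrix_(i, j) partial j (component i phi) x.

Definition L2norm (R : realType) (m n : nat) (D : set (R * R))
    (F : R * R -> 'M[R]_(m, n)) : \bar R :=
  'N[@lebesgue2 R]_(2%:E)[(fun x => (frob (F x))%:E) \_ D]%E.

Definition in_L2 (R : realType) (m n : nat) (D : set (R * R))
    (F : R * R -> 'M[R]_(m, n)) : Prop :=
  (forall i j, measurable_fun (D : set (measurableTypeR R * measurableTypeR R))
                 (fun x => F x i j)) /\
  (L2norm D F < +oo)%E.

Definition L2_cvg (R : realType) (m n : nat) (D : set (R * R))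
    (Fn : nat -> R * R -> 'M[R]_(m, n)) (F : R * R -> 'M[R]_(m, n)) : Prop :=
  [/\ forall k, in_L2 D (Fn k), in_L2 D F &
      L2norm D (fun x => Fn k x - F x) @[k --> \oo] --> 0%E].

Definition L2loc_cvg (R : realType) (m n : nat)
    (Fn : nat -> R * R -> 'M[R]_(m, n)) (F : R * R -> 'M[R]_(m, n)) : Prop :=
  forall K : set (R * R), compact K -> K `<=` @halfplane R -> L2_cvg K Fn F.

Definition in_L1loc (R : realType) (f : R * R -> R) : Prop :=
  forall K : set (R * R), compact K -> K `<=` @halfplane R ->
    (@lebesgue2 R).-integrable K (EFin \o f).

Definition weak_partial (R : realType) (i : 'I_2) (f g : R * R -> R) : Prop :=
  forall psi : R * R -> R, test_fun psi ->
    (\int[@lebesgue2 R]_(x in @halfplane R) (f x * partial i psi x)%:E =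
     - \int[@lebesgue2 R]_(x in @halfplane R) (g x * psi x)%:E)%E.

(* [v] belongs to the homogeneous Sobolev space, with weak gradient [G]. *)
Definition Hdot1_grad (R : realType) (v : R * R -> 'rV[R]_2)
    (G : R * R -> 'M[R]_2) : Prop :=
  [/\ forall i, in_L1loc (component i v), in_L2 (@halfplane R) G &
      forall i j, weak_partial j (component i v) (fun x => G x i j)].

(* The weak gradient is unique a.e., so the choice of [G] is immaterial. *)
Definition Hdot1_cvg (R : realType) (phi : nat -> R * R -> 'rV[R]_2)
    (v : R * R -> 'rV[R]_2) : Prop :=
  exists2 G, Hdot1_grad v G &
    L2_cvg (@halfplane R) (fun k => jacobian (phi k)) G.

Definition Hdot1_0sigma (R : realType) (v : R * R -> 'rV[R]_2) : Prop :=
  exists phi : nat -> R * R -> 'rV[R]_2,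
    [/\ forall k, test_field_divfree (phi k), Hdot1_cvg phi v &
        L2loc_cvg phi v].

Definition in_Linfty_weighted (R : realType) (mu : R * R -> R)
    (v : R * R -> 'rV[R]_2) : Prop :=
  (forall i, measurable_fun
     (@halfplane R : set (measurableTypeR R * measurableTypeR R))
     (component i v)) /\
  (ess_sup (@lebesgue2 R)
     ((fun x => `|frob (v x) * mu x|%:E) \_ (@halfplane R)) < +oo)%E.

Definition omega0 (R : realType) (x : R * R) : R :=
  `|x.2| ^+ 2 * enorm2 x / (`|x.2| + 4 * enorm2 x).

Definition omega1 (R : realType) (x : R * R) : R := `|x.2| * enorm2 x.

Definition omega2 (R : realType) (x : R * R) : R := `|x.2| ^+ 2 / 4.

Definition tensor (R : realType) (u v : R * R -> 'rV[R]_2) :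
    R * R -> 'M[R]_2 :=
  fun x => \matrix_(i, j) (component i u x * component j v x).

(* Main.v *)
(* All three weights dominate x_2^2/5, so |v| <= C/x_2 almost everywhere.  By
   Hardy's inequality, |u/x_2| is bounded in L^2 by the norm of u, hence it
   suffices to find test fields v_n converging to v with |v_n| <= C/x_2 uniformly
   in n: then (ii) reduces, by approximating u, to the case where u is a test
   field, where L^2_loc convergence of v_n is enough.

   Let phi_k be test fields converging to v.  The average F of phi_k over a fine
   grid of translates filling a square of side e is again a solenoidal test
   field; its gradient is close to that of v if e is small, and for k large
   |F| <= C/(x_2 + e) on any prescribed compact set, by Hardy's inequality near
   the boundary and by the bound on v elsewhere.  Hence the stream function Psi of
   F grows at most logarithmically.  Finally F is replaced by the rotated
   gradient of chi Psi, where chi is a cutoff between |x| = exp(lam) and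
   |x| = exp(3 lam) that depends only on log|x|/lam.  Since
   |grad chi| <= C/(lam |x|) and |Psi| <= C lam on the support of chi, the pointwise
   bound survives, whereas by Hardy's inequality for F and Psi the cutoff changes
   the gradient by O(1/lam) in L^2. *)
Require Import Defs.
From HB Require Import structures.
From mathcomp Require Import all_boot all_order all_algebra.
From mathcomp Require Import all_classical all_reals all_analysis.
From mathcomp Require Import ess_sup_inf measurable_realfun ring lra.

Set Implicit Arguments.
Unset Strict Implicit.
Unset Printing Implicit Defensive.
Import Order.TTheory GRing.Theory Num.Theory.
Import numFieldNormedType.Exports.

Local Open Scope classical_set_scope.
Local Open Scope ring_scope.

(** * Functions of class C^n on the plane *)

(** The constant in the pointwise bound may depend on v only, while e, lam and k depend on the
    wanted precision. The shift in C/(x_2 + e) makes the bound integrable up to the boundary at the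
    cost of - ln e, which is absorbed by taking lam after e with exp (-lam) <= e. Gradients are
    compared with that of one fixed test field phi_k0 rather than with the weak gradient: it is
    Lipschitz with compact support, which yields e, and it vanishes far away, so that a cutoff with
    large lam leaves it unchanged. Only then are k and the grid chosen, as phi_k has to be close to
    v on a compact set depending on e and lam.

    Translations go upwards only, so that supports stay in the half-plane; the average at x
    therefore samples the square below and to the left of x. For x_2 <= 2e this square may reach the
    boundary, where local convergence is of no use. There Hardy's inequality bounds the mean square
    of phi_k over the square by a constant, and since x_2 + e <= 3e <= 1 a constant is as good as
    C/(x_2 + e). *)

Definition coord (R : realType) (i : 'I_2) (x : R * R) : R :=
  if i == 0 :> nat then x.1 else x.2.

Definition move_to (R : realType) (i : 'I_2) (x : R * R) (t : R) : R * R :=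
  if i == 0 :> nat then (t, x.2) else (x.1, t).

Lemma ord2_cases (i : 'I_2) : i = ord0 \/ i = ord_max.
Proof. by case: i => -[|[|//]] ?; [left | right]; apply: val_inj. Qed.

Section PartialDerivatives.
Variable R : realType.
Implicit Types (f g : R * R -> R) (x y : R * R) (i j : 'I_2).

Lemma move_to_coord i x : move_to i x (coord i x) = x.
Proof. by rewrite /move_to /coord; case: eqP; case: x. Qed.

(** Along a coordinate direction the difference quotient is literally that of a function of one real
    variable, so that the one-variable chain rule, mean value theorem and fundamental theorem of
    calculus become available for partial derivatives. *)
Lemma partial_quotientE i f x :
  (fun h : R => h^-1 *: ((f \o shift x) (h *: unit_dir R i) - f x)) =
  (fun h : R => h^-1 *: (((fun t => f (move_to i x t)) \o shift (coord i x))
      (h *: (1 : R)) - (fun t => f (move_to i x t)) (coord i x))).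
Proof.
apply/funext => h /=; rewrite move_to_coord /shift /move_to /coord /unit_dir.
congr (h^-1 *: (f _ - _)); case: x => a b.
by case: (ord2_cases i) => -> /=; congr (_, _);
  rewrite /GRing.scale /=; ring.
Qed.

Lemma derivable_slice i f x :
  derivable f x (unit_dir R i) <->
  derivable (fun t => f (move_to i x t)) (coord i x) 1.
Proof. by rewrite /derivable partial_quotientE. Qed.

Lemma partial_slice i f x :
  partial i f x = 'D_1 (fun t => f (move_to i x t)) (coord i x).
Proof. by rewrite /partial /derive partial_quotientE. Qed.

Lemma is_derive_slice i f x (d : R) :
  is_derive x (unit_dir R i) f d <->
  is_derive (coord i x) 1 (fun t => f (move_to i x t)) d.
Proof.
split=> -[h1 h2]; (split; first by apply/derivable_slice).
  by rewrite -partial_slice.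
by have := partial_slice i f x; rewrite h2 => <-.
Qed.

Lemma is_derive_comp2 (S : R -> R) f x i (a b : R) :
  is_derive (f x) 1 S a -> is_derive x (unit_dir R i) f b ->
  is_derive x (unit_dir R i) (S \o f) (a * b).
Proof.
move=> hS /is_derive_slice hf; apply/is_derive_slice.
by apply: (@is_derive1_comp R S (fun t => f (move_to i x t))) => //;
  rewrite move_to_coord.
Qed.

Lemma partialE i f x (d : R) : is_derive x (unit_dir R i) f d -> partial i f x = d.
Proof. by case. Qed.

Lemma is_derive_partial i f x : derivable f x (unit_dir R i) ->
  is_derive x (unit_dir R i) f (partial i f x).
Proof. exact: derivableP. Qed.

Lemma near_eq_of_open (D : set (R * R)) f g x : open D -> D x ->
  (forall y, D y -> f y = g y) -> \near x, f x = g x.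
Proof.
move=> oD Dx fg.
have : nbhs x D by exact: open_nbhs_nbhs.
by apply: filterS => y /fg.
Qed.

Lemma is_derive_coord i j x :
  is_derive x (unit_dir R i) (@coord R j) ((i == j)%:R).
Proof.
apply/is_derive_slice.
case: (ord2_cases i) => ->; case: (ord2_cases j) => -> /=.
- exact: is_derive_id.
- exact: is_derive_cst.
- exact: is_derive_cst.
- exact: is_derive_id.
Qed.

Lemma continuous_coord i : continuous (@coord R i).
Proof.
case: (ord2_cases i) => -> x; [exact: cvg_fst | exact: cvg_snd].
Qed.

Lemma is_derive_sum n (h : 'I_n -> R * R -> R) (dh : 'I_n -> R) x i :
  (forall k, is_derive x (unit_dir R i) (h k) (dh k)) ->
  is_derive x (unit_dir R i) (fun y => \sum_(k < n) h k y) (\sum_(k < n) dh k).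
Proof.
elim: n h dh => [|n IH] h dh hh.
  rewrite big_ord0 (_ : (fun y => _) = cst 0); first exact: is_derive_cst.
  by apply/funext => y; rewrite big_ord0.
rewrite big_ord_recr /= (_ : (fun y => _) =
   (fun y => \sum_(k < n) h (widen_ord (leqnSn n) k) y) + h ord_max).
  by apply: is_deriveD; apply: IH.
by apply/funext => y; rewrite big_ord_recr.
Qed.

(* The class [C^n], by recursion on the innermost derivative, which makes
   closure under products and compositions an induction on [n]. *)
Fixpoint Ck (D : set (R * R)) (n : nat) f : Prop :=
  (forall x, D x -> {for x, continuous f}) /\
  (if n is n'.+1 then
     forall i, (forall x, D x -> derivable f x (unit_dir R i)) /\
               Ck D n' (partial i f)
   else True).

(** In [foldr] the innermost derivative is the last element of the list, whence the use of [rcons]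
    and of induction from the end. *)
Lemma smooth_onP D f : smooth_on D f <-> forall n, Ck D n f.
Proof.
split=> [sf n|Cf s].
  elim: n f sf => [|n IH] f sf /=.
    by split=> // x Dx; have [] := sf [::] x Dx.
  split=> [x Dx|i]; first by have [] := sf [::] x Dx.
  split=> [x Dx|]; first by have [_] := sf [::] x Dx; apply.
  by apply: IH => s x Dx; have := sf (rcons s i) x Dx; rewrite foldr_rcons.
elim/last_ind: s f Cf => [|s i IH] f Cf x Dx /=.
  by split; [have [h _] := Cf 0; exact: h | move=> i; have [_ /(_ i) [h _]] := Cf 1; exact: h].
rewrite foldr_rcons; apply: IH => // n.
by have [_ /(_ i) []] := Cf n.+1.
Qed.

Lemma Ck_cont D n f : Ck D n f -> forall x, D x -> {for x, continuous f}.
Proof. by case: n => [|n] []. Qed.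

Lemma CkW D n f : Ck D n.+1 f -> Ck D n f.
Proof.
elim: n f => [|n IH] f; first by case.
by case=> cf hf; split=> // i; have [df /IH] := hf i.
Qed.

Lemma Ck_derivable D n f i x : Ck D n.+1 f -> D x ->
  is_derive x (unit_dir R i) f (partial i f x).
Proof. by move=> [_ /(_ i) [h _]] /h; exact: is_derive_partial. Qed.

Lemma Ck_sub (D D' : set (R * R)) n f : D' `<=` D -> Ck D n f -> Ck D' n f.
Proof.
move=> sub; elim: n f => [|n IH] f.
  by case=> h _; split=> // x /sub; exact: h.
case=> h1 h2; split=> [x /sub|i]; first exact: h1.
by have [h3 /IH h4] := h2 i; split=> // x /sub; exact: h3.
Qed.

(** On an open set equality near each point passes to the derivatives, hence to all orders. *)
Lemma Ck_ext D n f g : open D -> (forall x, D x -> f x = g x) ->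
  Ck D n f -> Ck D n g.
Proof.
move=> oD; elim: n f g => [|n IH] f g fg.
  case=> cf _; split=> // x Dx.
  rewrite /prop_for /continuous_at -(fg x Dx).
  apply: cvg_trans (cf x Dx); apply: near_eq_cvg.
  exact: (near_eq_of_open oD Dx fg).
case=> cf hf; split.
  move=> x Dx; rewrite /prop_for /continuous_at -(fg x Dx).
  apply: cvg_trans (cf x Dx); apply: near_eq_cvg.
  exact: (near_eq_of_open oD Dx fg).
move=> i; have [df Cf] := hf i; split.
  move=> x Dx; apply: (near_eq_derivable (near_eq_of_open oD Dx fg)).
  exact: df.
apply: IH Cf => x Dx; apply: near_eq_derive.
exact: (near_eq_of_open oD Dx fg).
Qed.

Lemma CkS_intro D n f (df : 'I_2 -> R * R -> R) : open D ->
  (forall i x, D x -> is_derive x (unit_dir R i) f (df i x)) ->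
  (forall x, D x -> {for x, continuous f}) ->
  (forall i, Ck D n (df i)) -> Ck D n.+1 f.
Proof.
move=> oD h cf hC; split=> // i; split=> [x /(h i)[]//|].
by apply: Ck_ext (hC i) => // x /(h i) /partialE.
Qed.

Lemma Ck_cst D n (c : R) : open D -> Ck D n (cst c).
Proof.
move=> oD; elim: n c => [|n IH] c.
  by split=> // x Dx; exact: cst_continuous.
apply: (@CkS_intro _ _ _ (fun=> cst 0)) => //.
  by move=> x Dx; exact: cst_continuous.
Qed.

Lemma Ck_coord D n i : open D -> Ck D n (@coord R i).
Proof.
move=> oD; case: n => [|n].
  by split=> // x _; exact: continuous_coord.
apply: (@CkS_intro _ _ _ (fun j => cst (j == i)%:R)) => //.
- by move=> j x _; exact: is_derive_coord.
- by move=> x _; exact: continuous_coord.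
- by move=> j; exact: Ck_cst.
Qed.

Lemma CkD D n f g : open D -> Ck D n f -> Ck D n g -> Ck D n (f + g).
Proof.
move=> oD; elim: n f g => [|n IH] f g Cf Cg.
  by split=> // x Dx; apply: continuousD; apply: Ck_cont Dx; eassumption.
apply: (@CkS_intro _ _ _ (fun j => partial j f + partial j g)) => //.
- by move=> i x Dx; apply: is_deriveD; apply: Ck_derivable Dx; eassumption.
- by move=> x Dx; apply: continuousD; apply: Ck_cont Dx; eassumption.
- by move=> i; apply: IH; [have [_ /(_ i) []] := Cf | have [_ /(_ i) []] := Cg].
Qed.

Lemma CkM D n f g : open D -> Ck D n f -> Ck D n g -> Ck D n (f * g).
Proof.
move=> oD; elim: n f g => [|n IH] f g Cf Cg.
  by split=> // x Dx; apply: continuousM; apply: Ck_cont Dx; eassumption.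
apply: (@CkS_intro _ _ _ (fun j => f * partial j g + g * partial j f)) => //.
- by move=> i x Dx; apply: is_deriveM; apply: Ck_derivable Dx; eassumption.
- by move=> x Dx; apply: continuousM; apply: Ck_cont Dx; eassumption.
- move=> i; apply: CkD => //; apply: IH; try exact: CkW.
    by have [_ /(_ i) []] := Cg.
  by have [_ /(_ i) []] := Cf.
Qed.

Lemma CkN D n f : open D -> Ck D n f -> Ck D n (- f).
Proof.
move=> oD Cf; rewrite (_ : - f = cst (-1) * f).
  by apply: CkM => //; exact: Ck_cst.
by apply/funext => x; rewrite /= /GRing.mul /= /GRing.opp /= mulN1r.
Qed.

Lemma CkX D n f m : open D -> Ck D n f -> Ck D n (f ^+ m).
Proof.
move=> oD Cf; elim: m => [|m IH]; first exact: Ck_cst.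
by rewrite exprS; exact: CkM.
Qed.

Lemma Ck_inv D n f : open D -> (forall x, D x -> f x != 0) ->
  Ck D n f -> Ck D n (fun x => (f x)^-1).
Proof.
move=> oD f0; elim: n => [|n IH] Cf.
  split=> // x Dx; apply: cvgV; first exact: f0.
  exact: (Ck_cont Cf).
have CI := IH (CkW Cf).
apply: (@CkS_intro _ _ _
  (fun j => - ((fun x => (f x)^-1) * (fun x => (f x)^-1) * partial j f))) => //.
- move=> i x Dx; have [df dfE] := Ck_derivable i Cf Dx.
  split; first by apply: derivableV => //; exact: f0.
  rewrite deriveV //; last exact: f0.
  rewrite dfE; change (- (f x) ^- 2 * partial i f x =
                       - ((f x)^-1 * (f x)^-1 * partial i f x)).
  by have := f0 x Dx => fx0; field.
- by move=> x Dx; apply: cvgV; [exact: f0 | exact: (Ck_cont Cf)].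
- move=> i; apply: CkN => //; apply: CkM => //; first exact: CkM.
  by have [_ /(_ i) []] := Cf.
Qed.

Lemma Ck_ln D n f : open D -> (forall x, D x -> 0 < f x) ->
  Ck D n f -> Ck D n (fun x => ln (f x)).
Proof.
move=> oD f0; case: n => [|n] Cf.
  split=> // x Dx; have cf := Ck_cont Cf Dx.
  apply: (@continuous_comp _ _ _ f (@ln R)); first exact: cf.
  by apply: continuous_ln; exact: f0.
apply: (@CkS_intro _ _ _ (fun j => (fun x => (f x)^-1) * partial j f)) => //.
- move=> i x Dx; apply: (@is_derive_comp2 (@ln R)).
    by apply: is_derive1_ln; exact: f0.
  exact: Ck_derivable Cf Dx.
- move=> x Dx; have cf := Ck_cont Cf Dx.
  apply: (@continuous_comp _ _ _ f (@ln R)); first exact: cf.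
  by apply: continuous_ln; exact: f0.
- move=> i; apply: CkM => //.
    by apply: Ck_inv (CkW Cf) => // x Dx; rewrite gt_eqF// f0.
  by have [_ /(_ i) []] := Cf.
Qed.

End PartialDerivatives.

Lemma is_derive_val (R : numFieldType) (V W : normedModType R) (f : V -> W)
    (x v : V) (d d' : W) :
  d = d' -> is_derive x v f d -> is_derive x v f d'.
Proof. by move=> ->. Qed.

(** * Flat functions and a smooth step on the line *)

Section FlatFunctions.
Variable R : realType.

(** For [n = 0] this is the classical flat function exp (-1/t). The powers of 1/t are included
    because the derivative of a member is a combination of two other members, [dflat]: smoothness
    becomes an induction on the order over the whole family. *)
Definition flat (n : nat) (t : R) : R :=
  if 0 < t then t^-1 ^+ n * expR (- t^-1) else 0.

Definition dflat (n : nat) (t : R) : R := flat n.+2 t - n%:R * flat n.+1 t.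

Lemma flat_ge0 n t : 0 <= flat n t.
Proof.
rewrite /flat; case: ifP => // t0.
by rewrite mulr_ge0 ?expR_ge0// exprn_ge0// invr_ge0 ltW.
Qed.

(** With s = 1/t this is s^n <= n! exp s, a single term of the exponential series. *)
Lemma flat_le n t : flat n t <= n`!%:R.
Proof.
rewrite /flat; case: ifPn => [t0|_]; last exact: ler0n.
rewrite expRN ler_pdivrMr ?expR_gt0//.
case: n => [|n].
  by rewrite expr0 fact0 mul1r -expR0 ler_expR invr_ge0 ltW.
have := @expR_ge1Dxn R t^-1 n (ltW _); rewrite invr_gt0 => /(_ t0) h.
rewrite mulrC -ler_pdivrMr ?ltr0n ?fact_gt0//.
by apply: le_trans h; rewrite lerDr.
Qed.

(** Raising the index by 2 releases a factor t^2; a quadratic bound is what forces the derivative at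
    0 to vanish. *)
Lemma flat_le_sqr n t : flat n t <= (n.+2)`!%:R * t ^+ 2.
Proof.
have [t0|t0] := ltP 0 t; last first.
  rewrite {1}/flat ltNge t0 /=; apply: mulr_ge0; [exact: ler0n | exact: sqr_ge0].
have := flat_le n.+2 t; rewrite -(ler_pM2r (exprn_gt0 2 t0)).
apply: le_trans; rewrite /flat t0 !exprS le_eqVlt; apply/orP; left; apply/eqP.
by field; rewrite gt_eqF.
Qed.

Lemma is_derive0_of_le_sqr (f : R -> R) (C : R) : f 0 = 0 ->
  (forall t, `|f t| <= C * t ^+ 2) -> is_derive (0:R) (1:R) f (0:R).
Proof.
move=> f0 hf.
suff h : (fun h : R => h^-1 *: ((f \o shift (0:R)) (h *: (1:R)) - f 0)) @ 0^' --> (0 : R).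
  by split; [apply/cvg_ex; exists 0 | exact: cvg_lim h].
have C0 : 0 <= C by have := hf 1; rewrite expr1n mulr1; apply: le_trans.
apply/cvgr0Pnorm_lt => e e0.
have C1 : 0 < C + 1 by rewrite ltr_wpDl.
near=> h; have hn0 : h != 0 by near: h; exact: nbhs_dnbhs_neq.
rewrite /= f0 subr0 addr0 /GRing.scale /= mulr1 normrM normfV.
rewrite mulrC ltr_pdivrMr ?normr_gt0//.
apply: le_lt_trans (hf h) _; rewrite -real_normK ?num_real// expr2 mulrA.
rewrite ltr_pM2r ?normr_gt0//.
apply: (@le_lt_trans _ _ ((C + 1) * `|h|)).
  by rewrite ler_wpM2r// lerDl.
rewrite mulrC -ltr_pdivlMr//; near: h.
by apply: dnbhs0_lt; rewrite divr_gt0.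
Unshelve. all: by end_near. Qed.

Lemma is_derive_flat n (t : R) : is_derive t (1:R) (flat n) (dflat n t).
Proof.
have [t0|t0|->] := ltgtP t 0.
- have -> : dflat n t = 0.
    by rewrite /dflat /flat ltNge (ltW t0) /= mulr0 subr0.
  apply: (@near_eq_is_derive _ _ _ (cst 0)).
    near=> s; rewrite /flat ltNge ltW//; near: s; exact: lt_nbhsl.
- pose G (y : R) : R := y ^+ n * expR (- y).
  have dV : is_derive t 1 (fun s : R => s^-1) (- t ^- 2).
    have := @is_deriveV R id t 1 1 (lt0r_neq0 t0) _.
    by move=> /(_ (is_derive_id _ _)); apply: is_derive_val; rewrite /GRing.scale /= mulr1.
  have dG : is_derive (t^-1) 1 G
      (t^-1 ^+ n * (- expR (- t^-1)) + expR (- t^-1) * (n%:R * t^-1 ^+ n.-1)).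
    apply: (@is_deriveM _ _ (fun y : R => y ^+ n) (fun y : R => expR (- y))).
      have := @is_deriveX _ _ (@id R) n t^-1 1 1 (is_derive_id _ _).
      rewrite (_ : id ^+ n = (fun y : R => y ^+ n)); last first.
        by apply/funext => y; elim: n {G} => [//|m IH]; rewrite !exprS -IH.
      by apply: is_derive_val; rewrite /GRing.scale /= mulr1 mulr_natl.
    have hN : is_derive (t^-1) 1 (fun y : R => - y) (-1).
      by apply: is_deriveN; exact: is_derive_id.
    have := @is_derive1_comp R expR (fun y => - y) (t^-1) _ _ (is_derive_expR _) hN.
    by apply: is_derive_val; rewrite mulrN1.
  have := is_derive1_comp dG dV.
  have -> : (t^-1 ^+ n * (- expR (- t^-1)) + expR (- t^-1) * (n%:R * t^-1 ^+ n.-1))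
            * (- t ^- 2) = dflat n t.
    rewrite /dflat /flat t0; case: n {G dG} => [|n].
      by rewrite -exprVn /=; ring.
    by rewrite -exprVn /= !exprS; ring.
  apply: near_eq_is_derive.
  near=> s; rewrite /flat.
  have -> : 0 < s by near: s; exact: lt_nbhsr.
  by [].
- have -> : dflat n 0 = 0 by rewrite /dflat /flat ltxx mulr0 subr0.
  apply: (@is_derive0_of_le_sqr _ (n.+2)`!%:R); first by rewrite /flat ltxx.
  by move=> s; rewrite ger0_norm ?flat_ge0// flat_le_sqr.
Unshelve. all: by end_near. Qed.

Lemma continuous_flat n : continuous (flat n).
Proof.
move=> t; apply: differentiable_continuous; apply/derivable1_diffP.
by have [] := is_derive_flat n t.
Qed.

Lemma Ck_flat (D : set (R * R)) k f n : open D -> Ck D k f ->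
  Ck D k (flat n \o f).
Proof.
move=> oD; elim: k n f => [|k IH] n f Cf.
  split=> // x Dx; have cf := Ck_cont Cf Dx.
  apply: (@continuous_comp _ _ _ f (flat n)); first exact: cf.
  exact: continuous_flat.
apply: (@CkS_intro _ _ _ _ (fun j =>
    (flat n.+2 \o f + - (cst n%:R * (flat n.+1 \o f))) * partial j f)) => //.
- move=> i x Dx; apply: (@is_derive_comp2 _ (flat n)).
    exact: is_derive_flat.
  exact: Ck_derivable Cf Dx.
- move=> x Dx; have cf := Ck_cont Cf Dx.
  apply: (@continuous_comp _ _ _ f (flat n)); first exact: cf.
  exact: continuous_flat.
- move=> i; have C' := CkW Cf.
  apply: CkM => //; last by have [_ /(_ i) []] := Cf.
  apply: CkD => //; first exact: IH.
  apply: CkN => //; apply: CkM => //; first exact: Ck_cst.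
  exact: IH.
Qed.

Lemma flat_monotone t s : t <= s -> flat 0 t <= flat 0 s.
Proof.
move=> ts; rewrite /flat !expr0 !mul1r; case: ifPn => t0; last first.
  by case: ifPn => // _; exact: expR_ge0.
have s0 := lt_le_trans t0 ts.
by rewrite s0 ler_expR lerN2 lef_pV2.
Qed.

(** A smooth step from 1 to 0. The argument of the outer [flat 0] equals [flat 0 2] up to t = 1,
    where the inner term switches on, and it is nonpositive from t = 3 on; the denominator
    normalises the first plateau. *)
Definition trans (t : R) : R := flat 0 (flat 0 2 - flat 0 (t - 1)) / flat 0 (flat 0 2).

Definition dtrans (t : R) : R :=
  - (dflat 0 (flat 0 2 - flat 0 (t - 1)) * dflat 0 (t - 1)) / flat 0 (flat 0 2).

Definition d2trans (t : R) : R :=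
  ((dflat 2 (flat 0 2 - flat 0 (t - 1)) * dflat 0 (t - 1)) * dflat 0 (t - 1) -
   dflat 0 (flat 0 2 - flat 0 (t - 1)) * dflat 2 (t - 1)) / flat 0 (flat 0 2).

Lemma flat_gt0 n t : 0 < t -> 0 < flat n t.
Proof.
by move=> t0; rewrite /flat t0 mulr_gt0 ?expR_gt0// exprn_gt0// invr_gt0.
Qed.

Lemma trans_norm_gt0 : 0 < flat 0 (flat 0 2).
Proof. by apply: flat_gt0; apply: flat_gt0. Qed.

Lemma flat_eq0 n t : t <= 0 -> flat n t = 0.
Proof. by move=> t0; rewrite /flat ltNge t0. Qed.

Lemma dflat_eq0 n t : t <= 0 -> dflat n t = 0.
Proof. by move=> t0; rewrite /dflat !flat_eq0// mulr0 subr0. Qed.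

Lemma trans_le1 t : t <= 1 -> trans t = 1.
Proof.
move=> t1; rewrite /trans (@flat_eq0 0 (t - 1)) ?subr_le0// subr0.
by rewrite divff// gt_eqF// trans_norm_gt0.
Qed.

Lemma trans_arg_le0 t : 3 <= t -> flat 0 2 - flat 0 (t - 1) <= 0.
Proof. by move=> t3; rewrite subr_le0; apply: flat_monotone; lra. Qed.

Lemma trans_ge3 t : 3 <= t -> trans t = 0.
Proof. by move=> t3; rewrite /trans flat_eq0 ?trans_arg_le0// mul0r. Qed.

Lemma dtrans_ge3 t : 3 <= t -> dtrans t = 0.
Proof.
by move=> t3; rewrite /dtrans dflat_eq0 ?trans_arg_le0// mul0r oppr0 mul0r.
Qed.

Lemma dflatE t : dflat 0 t = flat 2 t.
Proof. by rewrite /dflat mul0r subr0. Qed.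

Lemma is_derive_sub1 (t : R) : is_derive t (1:R) (fun s : R => s - 1) 1.
Proof.
have := is_deriveB (is_derive_id t (1:R)) (is_derive_cst (1:R) t 1).
by apply: is_derive_val; rewrite subr0.
Qed.

Lemma is_derive_trans_arg (t : R) :
  is_derive t (1:R) (fun s : R => flat 0 2 - flat 0 (s - 1)) (- dflat 0 (t - 1)).
Proof.
have h := @is_derive1_comp R (flat 0) (fun s => s - 1) t _ _ (is_derive_flat 0 (t - 1)) (is_derive_sub1 t).
have := is_deriveB (is_derive_cst (flat 0 2) t 1) h.
by apply: is_derive_val; rewrite mulr1 sub0r.
Qed.

Lemma is_derive_trans (t : R) : is_derive t (1:R) trans (dtrans t).
Proof.
have h := @is_derive1_comp R (flat 0) (fun s => flat 0 2 - flat 0 (s - 1)) t _ _ (is_derive_flat 0 _) (is_derive_trans_arg t).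
have := is_deriveM h (is_derive_cst ((flat 0 (flat 0 2))^-1) t 1).
by apply: is_derive_val; rewrite scaler0 add0r /dtrans /GRing.scale /=; ring.
Qed.

Lemma is_derive_dtrans (t : R) : is_derive t (1:R) dtrans (d2trans t).
Proof.
have h1 := @is_derive1_comp R (flat 2) (fun s => flat 0 2 - flat 0 (s - 1)) t _ _ (is_derive_flat 2 _) (is_derive_trans_arg t).
have h2 := @is_derive1_comp R (flat 2) (fun s => s - 1) t _ _ (is_derive_flat 2 (t - 1)) (is_derive_sub1 t).
have h3 := is_deriveN (is_deriveM h1 h2).
have := is_deriveM h3 (is_derive_cst ((flat 0 (flat 0 2))^-1) t 1).
rewrite (_ : (- (_ * _) * cst _) = dtrans); last first.
  by apply/funext => s; rewrite /dtrans !dflatE.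
apply: is_derive_val; rewrite scaler0 add0r /d2trans /GRing.scale /= !dflatE.
by ring.
Qed.

Lemma dflat_bounded n : exists C : R, forall t, `|dflat n t| <= C.
Proof.
exists ((n.+2)`!%:R + n%:R * (n.+1)`!%:R) => t.
apply: (le_trans (ler_normB _ _)); apply: lerD.
  by rewrite ger0_norm ?flat_ge0// flat_le.
rewrite normrM ger0_norm ?ler0n// ler_wpM2l ?ler0n//.
by rewrite ger0_norm ?flat_ge0// flat_le.
Qed.

Lemma trans_bounds : exists2 C : R, 1 <= C & forall t,
  [/\ `|trans t| <= C, `|dtrans t| <= C & `|d2trans t| <= C].
Proof.
have [C0 h0] := dflat_bounded 0; have [C2 h2] := dflat_bounded 2.
have C00 : 0 <= C0 by apply: le_trans (h0 0).
have C20 : 0 <= C2 by apply: le_trans (h2 0).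
pose c := (flat 0 (flat 0 2))^-1; have c0 : 0 <= c by rewrite invr_ge0 flat_ge0.
exists (1 + c + C0 * C0 * c + (C2 * C0 * C0 + C0 * C2) * c).
  by rewrite -!addrA lerDl !addr_ge0// mulr_ge0// ?addr_ge0// ?mulr_ge0// ?mulr_ge0.
have p1 : 0 <= C0 * C0 * c by rewrite !mulr_ge0.
have p2 : 0 <= (C2 * C0 * C0 + C0 * C2) * c.
  by rewrite mulr_ge0// addr_ge0// !mulr_ge0.
move=> t; split.
- apply: (@le_trans _ _ c); last by lra.
  rewrite /trans normrM (ger0_norm c0) ger_pMl ?invr_gt0 ?trans_norm_gt0//.
  by rewrite ger0_norm ?flat_ge0//; have := flat_le 0 (flat 0 2 - flat 0 (t - 1)).
- apply: (@le_trans _ _ (C0 * C0 * c)); last by lra.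
  by rewrite /dtrans normrM (ger0_norm c0) ler_wpM2r// normrN normrM ler_pM.
- apply: (@le_trans _ _ ((C2 * C0 * C0 + C0 * C2) * c)); last by lra.
  rewrite /d2trans normrM (ger0_norm c0) ler_wpM2r//.
  apply: (le_trans (ler_normB _ _)); apply: lerD; last by rewrite normrM ler_pM.
  by rewrite !normrM; apply: ler_pM; rewrite ?mulr_ge0//; apply: ler_pM.
Qed.

End FlatFunctions.

(** * Integration on the plane *)

Notation plane R := (measurableTypeR R * measurableTypeR R)%type.

Section PlaneMeasurability.
Variable R : realType.

Definition rat_box (p q r : rat) : set (R * R) :=
  [set x | `|x.1 - ratr p| < ratr r /\ `|x.2 - ratr q| < ratr r].

Lemma measurable_rat_box p q r : measurable (rat_box p q r : set (plane R)).
Proof.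
have -> : rat_box p q r =
    (`]ratr p - ratr r, ratr p + ratr r[%classic `*`
     `]ratr q - ratr r, ratr q + ratr r[%classic).
  apply/seteqP; split=> -[a b]; rewrite /rat_box /= !in_itv /= !ltr_norml.
    by move=> [/andP[h1 h2] /andP[h3 h4]]; split; apply/andP; split; lra.
  by move=> [/andP[h1 h2] /andP[h3 h4]]; split; apply/andP; split; lra.
by apply: measurableX; exact: measurable_itv.
Qed.

(** The plane carries the product sigma-algebra, which is generated by rectangles. An open set is
    the union of the boxes with rational centre and radius that it contains, and these are countably
    many. *)
Lemma open_measurable2 (A : set (R * R)) : open A -> measurable (A : set (plane R)).
Proof.
move=> oA.
have -> : A = \bigcup_p \bigcup_q \bigcup_r
    (if `[< rat_box p q r `<=` A >] then rat_box p q r else set0).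
  apply/seteqP; split=> x; last first.
    by move=> [p _ [q _ [r _]]]; case: asboolP => // h /h.
  move=> Ax; have : nbhs x A by exact: open_nbhs_nbhs.
  rewrite -nbhs_ballE => -[e /= e0 he].
  (* A radius r < e/2 and centres within r of the coordinates of x keep the box inside the ball of
     radius e. *)
  have e2 : 0 < e / 2 by rewrite divr_gt0.
  have [r] := @rat_in_itvoo R 0 (e / 2) e2; rewrite in_itv /= => /andP[r0 re].
  have h (y : R) : exists p : rat, `|y - ratr p| < ratr r.
    have yr : y - ratr r < y + ratr r by lra.
    have [p] := rat_in_itvoo yr; rewrite in_itv /= => /andP[p1 p2].
    by exists p; rewrite ltr_norml; apply/andP; split; lra.
  have [p hp] := h x.1; have [q hq] := h x.2.
  exists p => //; exists q => //; exists r => //; case: asboolP => [_|]; first by split.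
  case; move=> y [y1 y2]; apply: he; split; rewrite /ball /=.
    move: hp y1; rewrite !ltr_norml => /andP[h1 h2] /andP[h3 h4]; apply/andP; split; lra.
  move: hq y2; rewrite !ltr_norml => /andP[h1 h2] /andP[h3 h4]; apply/andP; split; lra.
do 3 (apply: bigcupT_measurable_rat => ?).
by case: ifP => // _; exact: measurable_rat_box.
Qed.

Lemma open_halfplane : open (@halfplane R).
Proof.
rewrite (_ : @halfplane R = (@snd R R) @^-1` [set t | 0 < t]) //.
apply: open_comp => [x _|]; [exact: cvg_snd | exact: open_gt].
Qed.

Lemma measurable_halfplane : measurable (@halfplane R : set (plane R)).
Proof. exact: open_measurable2 open_halfplane. Qed.

Lemma continuous_on_measurable (D : set (R * R)) (f : R * R -> R) : open D ->
  (forall x, D x -> {for x, continuous f}) ->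
  measurable_fun (D : set (plane R)) (f : plane R -> R).
Proof.
move=> oD cf; apply: (measurability _ (RGenOpens.measurableE R)).
move=> _ [_ [a [b ->] <-]]; apply: open_measurable2.
rewrite openE => x [Dx fx]; apply: filterI.
  exact: open_nbhs_nbhs.
by apply: (cf x Dx); apply: open_nbhs_nbhs; split.
Qed.

Lemma Ck_measurable (D : set (R * R)) n (f : R * R -> R) : open D -> Ck D n f ->
  measurable_fun (D : set (plane R)) (f : plane R -> R).
Proof. by move=> oD /Ck_cont; exact: continuous_on_measurable. Qed.

End PlaneMeasurability.

(** * Integrals of nonnegative functions on subsets of the plane *)

Section HalfplaneIntegrals.
Variable R : realType.
Local Open Scope ereal_scope.
Implicit Types (D : set (R * R)) (f g : R * R -> R).

Definition int2 D f : \bar R := \int[@lebesgue2 R]_(x in D) (f x)%:E.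

Definition mfun2 D f := measurable_fun (D : set (plane R)) (f : plane R -> R).

Lemma int2_ge0 D f : (forall x, D x -> 0 <= f x)%R -> 0 <= int2 D f.
Proof. by move=> h; apply: integral_ge0 => x Dx; rewrite lee_fin h. Qed.

Lemma int2_le D f g : measurable (D : set (plane R)) -> mfun2 D f -> mfun2 D g ->
  (forall x, D x -> 0 <= f x <= g x)%R -> int2 D f <= int2 D g.
Proof.
move=> mD mf mg h; apply: ge0_le_integral => //.
- by move=> x Dx; rewrite lee_fin; have /andP[] := h x Dx.
- exact/measurable_EFinP.
- exact/measurable_EFinP.
- by move=> x Dx; rewrite lee_fin; have /andP[] := h x Dx.
Qed.

Lemma int2_ae_le D f g : measurable (D : set (plane R)) -> mfun2 D f -> mfun2 D g ->
  (forall x, D x -> 0 <= f x)%R -> (forall x, D x -> 0 <= g x)%R ->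
  {ae @lebesgue2 R, forall x, D x -> (f x <= g x)%R} -> int2 D f <= int2 D g.
Proof.
move=> mD mf mg f0 g0 h; apply: ae_ge0_le_integral => //.
- exact/measurable_EFinP.
- exact/measurable_EFinP.
Qed.

Lemma int2_eq D f g : (forall x, D x -> f x = g x) -> int2 D f = int2 D g.
Proof. by move=> h; apply: eq_integral => x /set_mem /h ->. Qed.

Lemma int2D D f g : measurable (D : set (plane R)) -> mfun2 D f -> mfun2 D g ->
  (forall x, D x -> 0 <= f x)%R -> (forall x, D x -> 0 <= g x)%R ->
  int2 D (fun x => f x + g x)%R = int2 D f + int2 D g.
Proof.
move=> mD mf mg f0 g0; rewrite /int2 -ge0_integralD //.
- exact/measurable_EFinP.
- exact/measurable_EFinP.
Qed.

Lemma int2Z D f (k : R) : measurable (D : set (plane R)) -> mfun2 D f ->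
  (forall x, D x -> 0 <= f x)%R -> (0 <= k)%R ->
  int2 D (fun x => k * f x)%R = k%:E * int2 D f.
Proof.
move=> mD mf f0 k0; rewrite /int2 -ge0_integralZl_EFin //.
exact/measurable_EFinP.
Qed.

Lemma int2_sub D D' f : measurable (D : set (plane R)) ->
  measurable (D' : set (plane R)) -> mfun2 D' f -> D `<=` D' ->
  (forall x, D' x -> 0 <= f x)%R -> int2 D f <= int2 D' f.
Proof.
move=> mD mD' mf sub f0; apply: ge0_subset_integral => //.
exact/measurable_EFinP.
Qed.

Lemma int2_sum D n (h : 'I_n -> R * R -> R) : measurable (D : set (plane R)) ->
  (forall k, mfun2 D (h k)) -> (forall k x, D x -> 0 <= h k x)%R ->
  int2 D (fun x => \sum_(k < n) h k x)%R = \sum_(k < n) int2 D (h k).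
Proof.
move=> mD mh h0; rewrite /int2.
transitivity (\int[@lebesgue2 R]_(x in D) \sum_(k < n) (h k x)%:E).
  by apply: eq_integral => x _; rewrite sumEFin.
by rewrite ge0_integral_sum // => k; apply/measurable_EFinP; exact: mh.
Qed.

Lemma int2_bigcup_le (F : (set (R * R))^nat) f (c : \bar R) :
  {homo F : n m / (n <= m)%N >-> (n <= m)%O} ->
  (forall i, measurable (F i : set (plane R))) ->
  (forall i, mfun2 (F i) f) -> (forall i x, F i x -> 0 <= f x)%R ->
  (forall i, int2 (F i) f <= c) -> int2 (\bigcup_i F i) f <= c.
Proof.
move=> ndF mF mf f0 h.
have cv : int2 (F i) f @[i --> \oo] --> int2 (\bigcup_i F i) f.
  apply: ge0_nondecreasing_set_cvg_integral => //.
  by move=> i; apply/measurable_EFinP; exact: mf.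
have <- := cvg_lim (@ereal_hausdorff R) cv.
apply: lime_le; last by near=> n; exact: h.
apply: ereal_nondecreasing_is_cvgn => i j ij.
apply: ge0_nondecreasing_set_nondecreasing_integral => //.
by move=> k; apply/measurable_EFinP; exact: mf.
Unshelve. all: by end_near. Qed.

Lemma int2_setI D D' f : measurable (D : set (plane R)) ->
  measurable (D' : set (plane R)) ->
  int2 (D `&` D') f = \int[@lebesgue2 R]_(x in D) ((fun x => (f x)%:E) \_ D') x.
Proof. by move=> mD mD'; rewrite /int2 integral_mkcondr. Qed.

End HalfplaneIntegrals.

Notation int2R D f := (int2 D f%R) (only parsing).

Lemma continuous_pairing (T U V : topologicalType) (f : T -> U) (g : T -> V) (x : T) :
  {for x, continuous f} -> {for x, continuous g} ->
  {for x, continuous (fun t => (f t, g t))}.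
Proof.
by move=> cf cg; apply: (@cvg_pair _ _ _ _ (nbhs (f x)) (nbhs (g x))).
Qed.

(** * Iterated integrals, translations and vertical integration *)

Section Tonelli.
Variable R : realType.
Local Open Scope ereal_scope.
Local Notation mu := (@lebesgue_measure R).

Section Rectangle.
Variables (A B : set (measurableTypeR R)) (f : R * R -> R).
Hypotheses (mA : measurable A) (mB : measurable B).
Hypothesis (mf : mfun2 (A `*` B) f).
Hypothesis (f0 : forall x, (A `*` B) x -> (0 <= f x)%R).

Let F : plane R -> \bar R := (EFin \o f) \_ (A `*` B).

Let mF : measurable_fun setT F.
Proof.
apply/(measurable_restrictT (EFin \o f) (measurableX mA mB)).
apply/measurable_EFinP; exact: mf.
Qed.

Let F0 x : 0 <= F x.
Proof. by rewrite /F patchE; case: ifPn => // xD; rewrite lee_fin; apply: f0; exact: set_mem xD. Qed.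

Let slice1 x : \int[mu]_y F (x, y) =
  ((fun x => \int[mu]_(y in B) (f (x, y))%:E) \_ A) x.
Proof.
rewrite patchE; case: ifPn => xA.
  rewrite [RHS]integral_mkcond; apply: eq_integral => y _.
  by rewrite /F !patchE in_setX xA.
apply: integral0_eq => y _.
by rewrite /F patchE in_setX (negbTE xA).
Qed.

Let slice2 y : \int[mu]_x F (x, y) =
  ((fun y => \int[mu]_(x in A) (f (x, y))%:E) \_ B) y.
Proof.
rewrite patchE; case: ifPn => yB.
  rewrite [RHS]integral_mkcond; apply: eq_integral => x _.
  by rewrite /F !patchE in_setX yB andbT.
apply: integral0_eq => x _.
by rewrite /F patchE in_setX (negbTE yB) andbF.
Qed.

Lemma int2_rect1 :
  int2 (A `*` B) f = \int[mu]_(x in A) \int[mu]_(y in B) (f (x, y))%:E.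
Proof.
rewrite /int2 integral_mkcond [RHS]integral_mkcond.
rewrite [LHS](fubini_tonelli1 _ mF F0).
by apply: eq_integral => x _; rewrite -slice1.
Qed.

Lemma int2_rect2 :
  int2 (A `*` B) f = \int[mu]_(y in B) \int[mu]_(x in A) (f (x, y))%:E.
Proof.
rewrite /int2 integral_mkcond [RHS]integral_mkcond.
rewrite [LHS](fubini_tonelli1 _ mF F0) [LHS](fubini_tonelli _ mF F0).
by apply: eq_integral => y _; rewrite -slice2.
Qed.

Lemma measurable_rect_slice :
  measurable_fun A (fun x => \int[mu]_(y in B) (f (x, y))%:E).
Proof.
apply/(measurable_restrictT _ mA).
rewrite (_ : _ \_ A = fubini_F mu F).
  exact: measurable_fun_fubini_tonelli_F.
by apply/funext => x; rewrite -slice1.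
Qed.

End Rectangle.

Lemma int2_rect_le (A B : set (measurableTypeR R)) (f g : R * R -> R) :
  measurable A -> measurable B -> mfun2 (A `*` B) f -> mfun2 (A `*` B) g ->
  (forall x, (A `*` B) x -> (0 <= f x)%R) ->
  (forall x, (A `*` B) x -> (0 <= g x)%R) ->
  (forall x, A x ->
     \int[mu]_(y in B) (f (x, y))%:E <= \int[mu]_(y in B) (g (x, y))%:E) ->
  int2 (A `*` B) f <= int2 (A `*` B) g.
Proof.
move=> mA mB mf mg f0 g0 h; rewrite !int2_rect1//.
apply: ge0_le_integral => //.
- move=> x Ax; apply: integral_ge0 => y By; rewrite lee_fin.
  by apply: f0; split.
- exact: measurable_rect_slice.
- exact: measurable_rect_slice.
Qed.

Lemma integral_shift (g : R -> R) (h : R) : continuous g -> (forall s, 0 <= g s)%R ->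
  \int[mu]_s (g (s - h)%R)%:E = \int[mu]_s (g s)%:E.
Proof.
move=> cg g0.
have dF s : is_derive s (1%R : R) (fun t : R => (t - h)%R) (1%R : R).
  have := is_deriveB (is_derive_id s (1%R:R)) (is_derive_cst h s (1%R:R)).
  by apply: is_derive_val; rewrite subr0.
have dFE : (fun t : R => (t - h)%R)^`()%classic = cst (1%R : R).
  by apply/funext => s; rewrite derive1E; have [_ ->] := dF s.
rewrite [RHS](@increasing_ge0_integration_by_substitutionT R (fun t => t - h)%R g).
- by apply: eq_integral => s _; rewrite dFE /GRing.mul /= mulr1.
- by move=> s t; rewrite ltrD2r.
- by rewrite dFE; exact: cst_continuous.
- by rewrite dFE; exact: is_cvg_cst.
- by rewrite dFE; exact: is_cvg_cst.
- by move=> s; have [] := dF s.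
- apply/cvgrNyPle => M; near=> s; rewrite lerBlDr; near: s.
  by apply: nbhs_ninfty_le; exact: num_real.
- apply/cvgryPge => M; near=> s; rewrite lerBrDr; near: s.
  by apply: nbhs_pinfty_ge; exact: num_real.
- exact: cg.
- exact: g0.
Unshelve. all: by end_near. Qed.

(** One variable at a time: Tonelli's theorem makes the shifted variable the inner one, where the
    one-dimensional substitution applies. *)
Lemma int2_shift (f : R * R -> R) (h : R * R) : continuous f ->
  (forall x, 0 <= f x)%R ->
  int2 setT (fun x => f (x.1 - h.1, x.2 - h.2)%R) = int2 setT f.
Proof.
move=> cf f0.
have c1 y : continuous (fun x => f (x, y)).
  move=> x; apply: (@continuous_comp _ _ _ (fun x => (x, y)) f); last exact: cf.
  by apply: continuous_pairing; [exact: cvg_id | exact: cvg_cst].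
have c2 x : continuous (fun y => f (x, y)).
  move=> y; apply: (@continuous_comp _ _ _ (fun y => (x, y)) f); last exact: cf.
  by apply: continuous_pairing; [exact: cvg_cst | exact: cvg_id].
have cs (a b : R) : continuous (fun x : R * R => f (x.1 - a, x.2 - b)%R).
  move=> x; apply: (@continuous_comp _ _ _ (fun x : R * R => (x.1 - a, x.2 - b)%R) f);
    last exact: cf.
  by apply: continuous_pairing; (apply: cvgB; last exact: cvg_cst); [exact: cvg_fst | exact: cvg_snd].
have m (a b : R) : mfun2 (setT `*` setT) (fun x : R * R => f (x.1 - a, x.2 - b)%R).
  rewrite setXTT; apply: continuous_on_measurable; first exact: openT.
  by move=> x _; exact: cs.
have p0 (a b : R) (x : R * R) : (setT `*` setT) x -> (0 <= f (x.1 - a, x.2 - b)%R)%R by [].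
have E0 (a : R) : int2 (setT `*` setT) (fun x : R * R => f (x.1 - a, x.2 - h.2)%R) =
  int2 (setT `*` setT) (fun x : R * R => f (x.1 - a, x.2 - 0)%R).
  rewrite (int2_rect1 measurableT measurableT (m a h.2) (p0 a h.2)).
  rewrite (int2_rect1 measurableT measurableT (m a 0%R) (p0 a 0%R)).
  apply: eq_integral => x _ /=.
  rewrite (@integral_shift (fun y => f (x - a, y)%R)) //.
  by apply: eq_integral => y _; rewrite subr0.
have E1 (b : R) : int2 (setT `*` setT) (fun x : R * R => f (x.1 - h.1, x.2 - b)%R) =
  int2 (setT `*` setT) (fun x : R * R => f (x.1 - 0, x.2 - b)%R).
  rewrite (int2_rect2 measurableT measurableT (m h.1 b) (p0 h.1 b)).
  rewrite (int2_rect2 measurableT measurableT (m 0%R b) (p0 0%R b)).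
  apply: eq_integral => x _ /=.
  rewrite (@integral_shift (fun y => f (y, x - b)%R)) //.
  by apply: eq_integral => y _; rewrite subr0.
rewrite -setXTT E0 E1; apply: int2_eq => x _.
by rewrite !subr0; case: x.
Qed.

Lemma within_continuous_itv (f : R -> R) (a b : R) :
  (forall s, (a <= s <= b)%R -> {for s, continuous f}) ->
  {within `[a, b], continuous f}.
Proof.
move=> cf; apply: continuous_in_subspaceT => s /set_mem /=.
by rewrite in_itv => /cf.
Qed.

Lemma integrable_itv (f : R -> R) (a b : R) :
  (forall s, (a <= s <= b)%R -> {for s, continuous f}) ->
  mu.-integrable `[a, b] (EFin \o f).
Proof.
move=> cf; apply: continuous_compact_integrable; first exact: segment_compact.
exact: within_continuous_itv.
Qed.

(** The integral of [dg] is g b - g a, which is nonnegative and may be dropped from the upper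
    bound. *)
Lemma integral_le_of_derive (F G g dg : R -> R) (a b : R) : (a < b)%R ->
  (forall s, (a <= s <= b)%R -> {for s, continuous F}) ->
  (forall s, (a <= s <= b)%R -> {for s, continuous G}) ->
  (forall s, (a <= s <= b)%R -> {for s, continuous dg}) ->
  (forall s, (a <= s <= b)%R -> is_derive s (1%R : R) g (dg s)) ->
  (forall s, (a <= s <= b)%R -> F s <= G s - dg s)%R -> (g a <= g b)%R ->
  \int[mu]_(s in `[a, b]) (F s)%:E <= \int[mu]_(s in `[a, b]) (G s)%:E.
Proof.
move=> ab cF cG cdg hg hle gab.
have iF := integrable_itv cF; have iG := integrable_itv cG.
have idg := integrable_itv cdg.
have mI : measurable (`[a, b]%classic : set (measurableTypeR R)) by exact: measurable_itv.
have cg s : (a <= s <= b)%R -> {for s, continuous g}.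
  move=> /hg [dg' _]; apply: differentiable_continuous.
  exact/derivable1_diffP.
have ftc : \int[mu]_(s in `[a, b]) (dg s)%:E = (g b)%:E - (g a)%:E.
  apply: continuous_FTC2 => //; first exact: within_continuous_itv.
    split.
    - move=> s; rewrite in_itv /= => /andP[h1 h2].
      by have [] := hg s _; rewrite // ?ltW.
    - by apply: cvg_at_right_filter; apply: cg; rewrite lexx ltW.
    - by apply: cvg_at_left_filter; apply: cg; rewrite lexx ltW.
  move=> s; rewrite in_itv /= => /andP[h1 h2].
  by rewrite derive1E; have [] := hg s _; rewrite // ?ltW.
apply: (@le_trans _ _ (\int[mu]_(s in `[a, b]) (F s)%:E + \int[mu]_(s in `[a, b]) (dg s)%:E)).
  by rewrite ftc leeDl// -EFinB lee_fin subr_ge0.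
rewrite -(integralD_EFin mI iF idg); apply: le_integral => //.
  have := integrableD mI iF idg; exact.
move=> s /set_mem /=; rewrite in_itv /= => hs.
by rewrite lee_fin -lerBrDr; exact: hle.
Qed.

(** Truncation at height M leaves vertical segments that are bounded. At their upper end only the
    sign of the boundary term is used below, so that no decay at large heights has to be
    established. *)
Definition strip (M : R) : set (R * R) := setT `*` `]0%R, M]%classic.

Lemma measurable_strip M : measurable (strip M : set (plane R)).
Proof. by apply: measurableX => //; exact: measurable_itv. Qed.

Lemma strip_sub M : strip M `<=` @halfplane R.
Proof. by move=> x [_] /=; rewrite in_itv /= => /andP[]. Qed.

Lemma bigcup_strip : \bigcup_n strip n%:R = @halfplane R.
Proof.
apply/seteqP; split=> x; first by move=> [n _]; exact: strip_sub.
move=> x0; exists (Num.Def.archi_bound x.2) => //; split=> //=.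
by rewrite in_itv /= x0 ltW// archi_boundP// ltW.
Qed.

Lemma mfun2_sub (D D' : set (R * R)) (f : R * R -> R) :
  measurable (D' : set (plane R)) -> D `<=` D' -> mfun2 D' f -> mfun2 D f.
Proof. by move=> mD sub; exact: measurable_funS. Qed.

Lemma int2_halfplane_le (f : R * R -> R) (c : \bar R) : mfun2 (@halfplane R) f ->
  (forall x, halfplane x -> 0 <= f x)%R ->
  (forall M, (0 < M)%R -> int2 (strip M) f <= c) -> int2 (@halfplane R) f <= c.
Proof.
move=> mf f0 h; rewrite -bigcup_strip; apply: int2_bigcup_le.
- move=> n m nm; apply/subsetPset => x [_] /=; rewrite in_itv /= => /andP[h1 h2].
  by split=> //=; rewrite in_itv /= h1 (le_trans h2)// ler_nat.
- by move=> n; exact: measurable_strip.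
- move=> n; apply: mfun2_sub mf => //; [exact: measurable_halfplane | exact: strip_sub].
- by move=> n x /strip_sub /f0.
- move=> n; apply: le_trans (h n.+1%:R _); last by rewrite ltr0n.
  apply: int2_sub; try exact: measurable_strip.
  + apply: mfun2_sub mf => //; [exact: measurable_halfplane | exact: strip_sub].
  + move=> x [_] /=; rewrite in_itv /= => /andP[h1 h2].
    by split=> //=; rewrite in_itv /= h1 (le_trans h2)// ler_nat.
  + by move=> x /strip_sub /f0.
Qed.

Lemma slice_continuous (f : R * R -> R) (x s : R) : {for (x, s), continuous f} ->
  {for s, continuous (fun t => f (x, t))}.
Proof.
move=> cf; apply: (@continuous_comp _ _ _ (fun y => (x, y)) f); last exact: cf.
by apply: continuous_pairing; [exact: cvg_cst | exact: cvg_id].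
Qed.

(* Hardy-type inequalities are pointwise inequalities up to a vertical
   derivative [dg], whose integral is nonnegative. *)
Lemma int2_le_vertical (F G g dg : R * R -> R) (a : R) : (0 < a)%R ->
  (forall x, halfplane x -> {for x, continuous F}) ->
  (forall x, halfplane x -> {for x, continuous G}) ->
  (forall x, halfplane x -> {for x, continuous dg}) ->
  (forall x, halfplane x -> is_derive x (unit_dir R ord_max) g (dg x)) ->
  (forall x, halfplane x -> 0 <= F x <= G x - dg x)%R ->
  (forall x, halfplane x -> 0 <= G x)%R ->
  (forall x, halfplane x -> 0 <= g x)%R ->
  (forall x, halfplane x -> x.2 < a -> F x = 0 /\ g x = 0)%R ->
  int2 (@halfplane R) F <= int2 (@halfplane R) G.
Proof.
move=> a0 cF cG cdg hg hle G0 g0 va.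
have oH := @open_halfplane R; have mH := @measurable_halfplane R.
have F0 x : halfplane x -> (0 <= F x)%R by move=> /hle /andP[].
have mF : mfun2 (@halfplane R) F by exact: continuous_on_measurable.
have mG : mfun2 (@halfplane R) G by exact: continuous_on_measurable.
apply: int2_halfplane_le => // M M0.
apply: (@le_trans _ _ (int2 (strip M) G)); last first.
  by apply: int2_sub => //; [exact: measurable_strip | exact: strip_sub].
have sH x s : (0 < s)%R -> halfplane (x, s) by [].
apply: int2_rect_le => //.
- exact: mfun2_sub (@strip_sub M) mF.
- exact: mfun2_sub (@strip_sub M) mG.
- by move=> x /strip_sub /F0.
- by move=> x /strip_sub /G0.
move=> x _.
(* Since [F] and [g] vanish at heights below [a], the integral of [F] may start at [b]; on [b, M]
   the singular weights are continuous and the lower boundary term is zero. *)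
pose b := (Num.min a M / 2)%R.
have m0 : (0 < Num.min a M)%R by rewrite lt_min a0 M0.
have ma : (Num.min a M <= a)%R by rewrite ge_min lexx.
have mM : (Num.min a M <= M)%R by rewrite ge_min lexx orbT.
have b0 : (0 < b)%R by rewrite divr_gt0.
have ba : (b < a)%R by rewrite /b; lra.
have bM : (b < M)%R by rewrite /b; lra.
have sub : `[b, M]%classic `<=` `]0%R, M]%classic.
  move=> s /=; rewrite !in_itv /= => /andP[h1 h2].
  by rewrite h2 (lt_le_trans b0 h1).
have pos s : (b <= s <= M)%R -> (0 < s)%R by move=> /andP[/(lt_le_trans b0)].
have -> : \int[mu]_(s in `]0%R, M]) (F (x, s))%:E = \int[mu]_(s in `[b, M]) (F (x, s))%:E.
  rewrite integral_mkcond [RHS]integral_mkcond; apply: eq_integral => s _.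
  rewrite !patchE; case: ifPn => s1; case: ifPn => s2 //.
    move/set_mem: s1; rewrite /= in_itv /= => /andP[s0 sM].
    have sa : (s < a)%R.
      apply: lt_trans ba; move: s2; rewrite notin_setE /= in_itv /= sM andbT.
      by move=> /negP; rewrite -ltNge.
    by have [-> _] := va (x, s) s0 sa.
  by move/set_mem: s2 => /sub /mem_set s2; rewrite s2 in s1.
apply: (@le_trans _ _ (\int[mu]_(s in `[b, M]) (G (x, s))%:E)); last first.
  apply: ge0_subset_integral => //; try exact: measurable_itv.
  - apply/measurable_EFinP.
    have : measurable_fun (`]0%R, +oo[%classic : set R) (fun s => G (x, s)); last first.
      apply: measurable_funS.
      + exact: measurable_itv.
      + by move=> s /=; rewrite !in_itv /= => /andP[->].
    + apply: open_continuous_measurable_fun; first exact: interval_open.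
      move=> s /set_mem /=; rewrite in_itv /= andbT => s0.
      by apply: slice_continuous; exact: cG.
  - by move=> s /=; rewrite in_itv /= => /andP[s0 _]; rewrite lee_fin G0.
apply: (@integral_le_of_derive _ _ (fun s => g (x, s)) (fun s => dg (x, s))) => //.
- by move=> s /pos s0; apply: slice_continuous; exact: cF.
- by move=> s /pos s0; apply: slice_continuous; exact: cG.
- by move=> s /pos s0; apply: slice_continuous; exact: cdg.
- by move=> s /pos s0; have /is_derive_slice := hg (x, s) s0.
- by move=> s /pos s0; have /andP[_] := hle (x, s) s0.
- have [_ ->] := va (x, b) b0 ba; apply: g0.
  exact: lt_trans b0 bM.
Qed.

End Tonelli.

(** * Test functions *)

Section TestFunctions.
Variable R : realType.
Implicit Types (f g : R * R -> R) (x y : R * R).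

(** The complement of a compact box lying at height at least a. Supports are described by this open
    set, on which derivatives vanish together with the function. *)
Definition outside (P a : R) : set (R * R) :=
  [set x | x.2 < a \/ P < `|x.1| \/ P < x.2].

Definition supp_in (P a : R) f := forall x, outside P a x -> f x = 0.

Lemma open_outside P a : open (outside P a).
Proof.
have -> : outside P a = [set x | x.2 < a] `|` ([set x | P < `|x.1|] `|` [set x | P < x.2]).
  by [].
apply: openU; last apply: openU.
- rewrite (_ : [set x | _] = (@snd R R) @^-1` [set t | t < a]) //.
  by apply: open_comp => [x _|]; [exact: cvg_snd | exact: open_lt].
- rewrite (_ : [set x | _] = (fun x : R * R => `|x.1|) @^-1` [set t | P < t]) //.
  apply: open_comp => [x _|]; last exact: open_gt.
  by apply: cvg_norm; exact: cvg_fst.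
- rewrite (_ : [set x | _] = (@snd R R) @^-1` [set t | P < t]) //.
  by apply: open_comp => [x _|]; [exact: cvg_snd | exact: open_gt].
Qed.

Lemma outside_sub P a P' a' : P <= P' -> a' <= a -> outside P' a' `<=` outside P a.
Proof.
move=> hP ha x [h|[h|h]]; [left|right;left|right;right].
- exact: lt_le_trans ha.
- exact: le_lt_trans h.
- exact: le_lt_trans h.
Qed.

Definition box (P a : R) : set (R * R) := (`[- P, P]%classic `*` `[a, P]%classic).

Lemma compact_box P a : compact (box P a).
Proof. by apply: compact_setX; exact: segment_compact. Qed.

Lemma not_outside P a x : ~ outside P a x -> box P a x.
Proof.
move=> h; split; rewrite /= in_itv /=.
  by rewrite -ler_norml leNgt; apply/negP => ?; apply: h; right; left.
by rewrite !leNgt; apply/andP; split; apply/negP => ?; apply: h; [left|right;right].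
Qed.

Lemma supp_in_partial P a f i : supp_in P a f -> supp_in P a (partial i f).
Proof.
move=> sf x ox; rewrite /partial.
have -> : 'D_(unit_dir R i) f x = 'D_(unit_dir R i) (cst 0) x.
  apply: near_eq_derive; exact: (near_eq_of_open (@open_outside P a) ox).
exact: derive_cst.
Qed.

Lemma Ck_setU (D D' : set (R * R)) n f : Ck D n f -> Ck D' n f -> Ck (D `|` D') n f.
Proof.
elim: n f => [|n IH] f [c1 h1] [c2 h2].
  by split=> // x [/c1|/c2].
split=> [x [/c1|/c2]//|i]; have [d1 k1] := h1 i; have [d2 k2] := h2 i.
by split; [move=> x [/d1|/d2] | exact: IH].
Qed.

(** The half-plane and [outside P a] are open and cover the plane. Regularity on all of the plane
    lets translates and slices be formed without domain conditions. *)
Lemma Ck_supp (P a : R) n f : 0 < a -> supp_in P a f -> Ck (@halfplane R) n f ->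
  Ck setT n f.
Proof.
move=> a0 sf Cf.
have -> : [set: R * R] = @halfplane R `|` outside P a.
  apply/seteqP; split=> // x _; have [x0|x0] := ltP 0 x.2; [by left|right].
  by left; exact: le_lt_trans x0 a0.
apply: Ck_setU => //; apply: (@Ck_ext _ _ _ (cst 0)).
- exact: open_outside.
- by move=> x /sf ->.
- by apply: Ck_cst; exact: open_outside.
Qed.

Lemma compact_bounded (K : set (R * R)) f : compact K -> continuous f ->
  exists2 B, 0 < B & forall x, K x -> f x <= B.
Proof.
move=> cK cf; have [K0|/set0P K0] := eqVneq K set0.
  by exists 1 => // x; rewrite K0.
have [c _ hc] := compact_EVT_max K0 cK (continuous_subspaceT cf).
exists (`|f c| + 1); first by rewrite ltr_wpDl.
by move=> x /mem_set /hc h; rewrite (le_trans h)// (le_trans (ler_norm _))// lerDl.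
Qed.

Lemma compact_away (K : set (R * R)) : compact K -> K `<=` @halfplane R ->
  exists2 a, 0 < a & forall x, K x -> a <= x.2.
Proof.
move=> cK KH; have [K0|/set0P K0] := eqVneq K set0.
  by exists 1 => // x; rewrite K0.
have cs : continuous (fun x : R * R => - x.2).
  by move=> x; apply: cvgN; exact: cvg_snd.
have [c Kc hc] := compact_EVT_max K0 cK (continuous_subspaceT cs).
exists c.2; first by apply: KH; exact: set_mem.
by move=> x /mem_set /hc; rewrite lerN2.
Qed.

Lemma test_fun_supp f : test_fun f ->
  exists P a, [/\ 0 < P, 0 < a & supp_in P a f].
Proof.
case=> _ cK KH; set K := closure _ in cK KH.
have [a a0 ha] := compact_away cK KH.
have [B1 B10 hB1] := @compact_bounded K (fun x => `|x.1|) cK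
  (fun x => cvg_norm (@cvg_fst _ _ _ _ _)).
have [B2 B20 hB2] := @compact_bounded K snd cK (fun x => @cvg_snd _ _ _ _ _).
exists (B1 + B2), a; split=> //; first exact: addr_gt0.
move=> x ox; apply/eqP; apply/negP => /negP fx.
have Kx : K x by apply: subset_closure.
have := ha x Kx; have := hB1 x Kx; have := hB2 x Kx.
by case: ox => [|[]]; lra.
Qed.

Lemma test_fun_Ck f : test_fun f -> forall n, Ck setT n f.
Proof.
move=> tf n; have [P [a [_ a0 sf]]] := test_fun_supp tf.
by apply: Ck_supp a0 sf _; case: tf => /smooth_onP.
Qed.

Lemma test_fun_intro (P a : R) f : 0 < a -> (forall n, Ck (@halfplane R) n f) ->
  supp_in P a f -> test_fun f.
Proof.
move=> a0 Cf sf.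
have sub : closure [set x | f x != 0] `<=` box P a.
  rewrite closureE => x; apply; split.
    by apply: compact_closed; [exact: norm_hausdorff | exact: compact_box].
  by move=> y /= /eqP fy; apply: not_outside => /sf.
split; first exact/smooth_onP.
- by apply: subclosed_compact sub; [exact: closed_closure | exact: compact_box].
- move=> x /sub [_] /=; rewrite in_itv /= => /andP[ax _].
  exact: lt_le_trans ax.
Qed.

Lemma test_fun_partial i f : test_fun f -> test_fun (partial i f).
Proof.
move=> tf; have [P [a [_ a0 sf]]] := test_fun_supp tf.
apply: (@test_fun_intro P a) => //; last exact: supp_in_partial.
move=> n.
have /Ck_sub h := test_fun_Ck tf n.+1.
by have [_ /(_ i) []] := h (@halfplane R) (fun _ _ => Logic.I).
Qed.

Lemma test_fun_lin (c : R) f g : test_fun f -> test_fun g ->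
  test_fun (fun x => f x + c * g x).
Proof.
move=> tf tg; have [P [a [P0 a0 sf]]] := test_fun_supp tf.
have [Q [b [Q0 b0 sg]]] := test_fun_supp tg.
have m0 : 0 < Num.min a b by rewrite lt_min a0.
apply: (@test_fun_intro (P + Q) _ _ m0).
  move=> n; have oH := @open_halfplane R.
  apply: (@CkD _ _ _ f (cst c * g)) => //.
    by apply: Ck_sub (test_fun_Ck tf n).
  by apply: CkM => //; [exact: Ck_cst | apply: Ck_sub (test_fun_Ck tg n)].
move=> x ox; rewrite sf ?sg ?mulr0 ?addr0//; apply: outside_sub ox.
- by rewrite lerDr ltW.
- by rewrite ge_min lexx orbT.
- by rewrite lerDl ltW.
- by rewrite ge_min lexx.
Qed.

Lemma test_fun0 : test_fun (cst 0 : R * R -> R).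
Proof.
apply: (@test_fun_intro 1 1) => // n.
by apply: Ck_cst; exact: open_halfplane.
Qed.

Definition translate (h : R * R) f : R * R -> R := fun x => f (x.1 - h.1, x.2 - h.2).

Lemma is_derive_translate h f x i d :
  is_derive (x.1 - h.1, x.2 - h.2) (unit_dir R i) f d ->
  is_derive x (unit_dir R i) (translate h f) d.
Proof.
rewrite /translate => /is_derive_slice hd; apply/is_derive_slice.
have [k hk] : exists k : R, (fun t => f ((move_to i x t).1 - h.1, (move_to i x t).2 - h.2)) =
   (fun t => f (move_to i (x.1 - h.1, x.2 - h.2) t)) \o (fun t => t - k) /\
   coord i (x.1 - h.1, x.2 - h.2) = coord i x - k.
  by case: (ord2_cases i) => ->; [exists h.1 | exists h.2].
case: hk => -> ek.
have dF : is_derive (coord i x) (1 : R) (fun t : R => t - k) (1 : R).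
  have := is_deriveB (is_derive_id (coord i x) (1:R)) (is_derive_cst k (coord i x) (1:R)).
  by apply: is_derive_val; rewrite subr0.
have := @is_derive1_comp R (fun t => f (move_to i (x.1 - h.1, x.2 - h.2) t))
  (fun t => t - k) (coord i x) d 1.
by rewrite mulr1; apply => //; rewrite -ek.
Qed.

Lemma continuous_translate h f : continuous f -> continuous (translate h f).
Proof.
move=> cf x; apply: (@continuous_comp _ _ _ (fun x : R * R => (x.1 - h.1, x.2 - h.2)) f);
  last exact: cf.
by apply: continuous_pairing; (apply: cvgB; last exact: cvg_cst); [exact: cvg_fst | exact: cvg_snd].
Qed.

Lemma Ck_translate h n f : Ck setT n f -> Ck setT n (translate h f).
Proof.
have oT := @openT (R * R)%type.
elim: n f => [|n IH] f Cf.
  split=> // x _; apply: continuous_translate => y; exact: (Ck_cont Cf).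
apply: (@CkS_intro _ _ _ _ (fun i => translate h (partial i f))) => //.
- by move=> i x _; apply: is_derive_translate; exact: Ck_derivable Cf _.
- move=> x _; apply: continuous_translate => y; exact: (Ck_cont Cf).
- by move=> i; apply: IH; have [_ /(_ i) []] := Cf.
Qed.

(** An upward translation does not bring the support closer to the boundary, so the same [a] serves
    again. *)
Lemma test_fun_translate h f : 0 <= h.2 -> test_fun f -> test_fun (translate h f).
Proof.
move=> h2 tf; have [P [a [P0 a0 sf]]] := test_fun_supp tf.
apply: (@test_fun_intro (P + `|h.1| + h.2) _ _ a0).
  by move=> n; apply: Ck_sub (Ck_translate h (test_fun_Ck tf n)).
move=> x ox; apply: sf; case: ox => [xa|[xP|xP]]; rewrite /outside /=.
- by left; lra.
- right; left; have := ler_normB (x.1 - h.1) (- h.1).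
  by rewrite opprK subrK normrN; have := ler_normD (x.1 - h.1) h.1; lra.
- by right; right; have := normr_ge0 h.1; lra.
Qed.

Lemma test_fun_continuous f : test_fun f -> continuous f.
Proof. by move=> tf x; exact: (Ck_cont (test_fun_Ck tf 0)). Qed.

Lemma test_fun_derive f i x : test_fun f ->
  is_derive x (unit_dir R i) f (partial i f x).
Proof. by move=> tf; exact: Ck_derivable (test_fun_Ck tf 1) _. Qed.

Lemma test_fun_bounded f : test_fun f ->
  exists2 B, 0 < B & forall x, `|f x| <= B.
Proof.
move=> tf; have [P [a [P0 a0 sf]]] := test_fun_supp tf.
have cn : continuous (fun x => `|f x|).
  by move=> x; apply: cvg_norm; exact: test_fun_continuous.
have [B B0 hB] := compact_bounded (@compact_box P a) cn.
exists B => // x; have [ox|/not_outside] := pselect (outside P a x); last exact: hB.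
by rewrite sf// normr0 ltW.
Qed.

Lemma mvt_lipschitz (u du : R -> R) (B s t : R) :
  (forall r, is_derive r (1:R) u (du r)) -> (forall r, `|du r| <= B) ->
  `|u s - u t| <= B * `|s - t|.
Proof.
move=> hu hB.
wlog st : s t / t <= s.
  move=> H; have [/H//|/ltW ts] := leP t s.
  by rewrite distrC (distrC s); exact: H.
have [|c _ ->] := @MVT_segment R u du t s st (fun r _ => hu r).
  apply: continuous_subspaceT => r; apply: differentiable_continuous.
  by apply/derivable1_diffP; have [] := hu r.
by rewrite normrM ler_wpM2r.
Qed.

Lemma test_fun_lipschitz f : test_fun f ->
  exists2 B, 0 < B & forall x y, `|f x - f y| <= B * (`|x.1 - y.1| + `|x.2 - y.2|).
Proof.
move=> tf.
have [B0 B00 h0] := test_fun_bounded (test_fun_partial ord0 tf).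
have [B1 B10 h1] := test_fun_bounded (test_fun_partial ord_max tf).
exists (B0 + B1); first exact: addr_gt0.
move=> [a b] [c d] /=.
rewrite (_ : f (a, b) - f (c, d) = (f (a, b) - f (c, b)) + (f (c, b) - f (c, d)));
  last by ring.
apply: (le_trans (ler_normD _ _)); rewrite mulrDr; apply: lerD.
  apply: (@le_trans _ _ (B0 * `|a - c|)); last by rewrite ler_wpM2r// lerDl ltW.
  apply: (@mvt_lipschitz (fun t => f (t, b)) (fun t => partial ord0 f (t, b))) => //.
  by move=> r; have /is_derive_slice := test_fun_derive ord0 (r, b) tf.
apply: (@le_trans _ _ (B1 * `|b - d|)); last by rewrite ler_wpM2r// lerDr ltW.
apply: (@mvt_lipschitz (fun t => f (c, t)) (fun t => partial ord_max f (c, t))) => //.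
by move=> r; have /is_derive_slice := test_fun_derive ord_max (c, r) tf.
Qed.

Lemma Ck_heightV n : Ck (@halfplane R) 0 (fun x : R * R => (x.2 ^+ n)^-1).
Proof.
have oH := @open_halfplane R; have C2 := @Ck_coord R (@halfplane R) 0 ord_max oH.
apply: Ck_inv => //; first by move=> x x0; rewrite expf_neq0// gt_eqF.
elim: n => [|n IH]; first exact: Ck_cst.
rewrite (_ : (fun x : R * R => x.2 ^+ n.+1) =
  @coord R ord_max * (fun x : R * R => x.2 ^+ n)); first exact: CkM.
by apply/funext => x; rewrite exprS.
Qed.

Lemma sum_sqr_entry (u : 'I_2 -> 'I_2 -> R) i j :
  u i j ^+ 2 <= \sum_a \sum_b u a b ^+ 2.
Proof.
rewrite (bigD1 i)//= (bigD1 j)//= -addrA lerDl addr_ge0//.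
  by apply: sumr_ge0 => ? _; exact: sqr_ge0.
by do 2 (apply: sumr_ge0 => ? _); exact: sqr_ge0.
Qed.

End TestFunctions.

(** * Riemann sums bounded by integrals *)

Section RiemannSums.
Variable R : realType.
Local Open Scope ereal_scope.
Local Notation mu := (@lebesgue_measure R).

(** Each node is the right end of its interval, as these are the points sampled by translates with
    positive steps. On that interval the node value is at most g + d, which gives an inequality
    without any passage to the limit. *)
Lemma riemann_sum_le (g : R -> R) (b eta d : R) (N : nat) :
  (0 < eta)%R -> (0 <= d)%R -> continuous g -> (forall s, 0 <= g s)%R ->
  (forall s t, `|s - t| <= eta -> g s <= g t + d)%R ->
  (eta * \sum_(i < N) g (b - i%:R * eta))%:E <=
    \int[mu]_(s in `[(b - N%:R * eta)%R, b]) (g s + d)%:E.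
Proof.
move=> eta0 d0 cg g0 osc.
have f0 s : (0 <= g s + d)%R by rewrite addr_ge0.
have mf (D : set R) : measurable_fun D (fun s => (g s + d)%:E).
  apply/measurable_EFinP; apply: measurable_funTS.
  apply: continuous_measurable_fun => s; apply: cvgD; first exact: cg.
  exact: cvg_cst.
elim: N => [|N IH].
  by rewrite big_ord0 mulr0; apply: integral_ge0 => s _; rewrite lee_fin.
set c := (b - N%:R * eta)%R in IH *.
have cE : (b - N.+1%:R * eta = c - eta)%R by rewrite /c -natr1; ring.
rewrite cE big_ord_recr /= mulrDr addrC -/c EFinD.
have cb : (c <= b)%R by rewrite /c gerBl mulr_ge0// ltW.
have -> : `[(c - eta)%R, b]%classic = `[(c - eta)%R, c[%classic `|` `[c, b]%classic.
  apply/seteqP; split=> s /=; rewrite !in_itv /=.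
    by case: (ltP s c) => sc /andP[h1 h2]; [left; rewrite h1 | right].
  case=> /andP[h1 h2].
    by rewrite h1 (le_trans (ltW h2)).
  by rewrite h2 andbT (le_trans _ h1)// gerBl ltW.
rewrite ge0_integral_setU //; try exact: measurable_itv; first last.
- apply/disj_setPS => s /=; rewrite !in_itv /= => -[/andP[_ h1] /andP[h2 _]].
  by have := lt_le_trans h1 h2; rewrite ltxx.
- by move=> s _; rewrite lee_fin.
- exact: mf.
apply: leeD => //.
apply: (@le_trans _ _ (\int[mu]_(s in `[(c - eta)%R, c[) (g c)%:E)).
  rewrite integral_cst//=.
  rewrite lebesgue_measure_itv /= lte_fin ltrBlDr ltrDl eta0 -EFinD -EFinM lee_fin.
  by rewrite opprB addrC subrK mulrC.
apply: ge0_le_integral => //.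
- by move=> s _; rewrite lee_fin.
- exact: mf.
- move=> s /=; rewrite in_itv /= => /andP[h1 h2]; rewrite lee_fin; apply: osc.
  by rewrite ger0_norm ?subr_ge0 ?(ltW h2)//; lra.
Qed.

(** The one-variable bound is applied in each direction, and each application costs one d. *)
Lemma riemann_sum2_le (f : R * R -> R) (p : R * R) (eta d : R) (N : nat) :
  (0 < eta)%R -> (0 <= d)%R -> continuous f -> (forall x, 0 <= f x)%R ->
  (forall x y, `|x.1 - y.1| <= eta -> `|x.2 - y.2| <= eta -> f x <= f y + d)%R ->
  (eta ^+ 2 * \sum_(i < N) \sum_(j < N) f (p.1 - i%:R * eta, p.2 - j%:R * eta))%:E <=
  int2 (`[(p.1 - N%:R * eta)%R, p.1]%classic `*` `[(p.2 - N%:R * eta)%R, p.2]%classic)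
    (fun x => f x + 2 * d)%R.
Proof.
move=> eta0 d0 cf f0 osc.
pose g (x : R) : R := (eta * \sum_(j < N) f (x, p.2 - j%:R * eta))%R.
(* The oscillation of [g], a sum of N values of [f] times eta. *)
pose d' : R := (eta * (N%:R * d))%R.
have d'0 : (0 <= d')%R by rewrite !mulr_ge0// ltW.
have g0 x : (0 <= g x)%R by rewrite mulr_ge0 ?(ltW eta0)// sumr_ge0.
have cg : continuous g.
  move=> x; apply: cvgM; first exact: cvg_cst.
  have : forall M, {for x, continuous (fun x => \sum_(j < M) f (x, p.2 - j%:R * eta))%R}.
    elim=> [|M IH].
      rewrite (_ : (fun x => _) = cst 0%R); first exact: cvg_cst.
      by apply/funext => y; rewrite big_ord0.
    rewrite (_ : (fun x => _) =
       (fun x => \sum_(j < M) f (x, p.2 - j%:R * eta) + f (x, p.2 - M%:R * eta))%R);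
      last by apply/funext => y; rewrite big_ord_recr.
    apply: cvgD; first exact: IH.
    apply: (@continuous_comp _ _ _ (fun x => (x, p.2 - M%:R * eta)%R) f); last exact: cf.
    by apply: continuous_pairing; [exact: cvg_id | exact: cvg_cst].
  exact.
have gosc s t : (`|s - t| <= eta -> g s <= g t + d')%R.
  move=> st; rewrite /g /d' -mulrDr ler_wpM2l ?(ltW eta0)//.
  have -> : (N%:R * d = \sum_(j < N) d)%R by rewrite sumr_const card_ord mulr_natl.
  rewrite -big_split /=; apply: ler_sum => j _; apply: osc => //=.
  by rewrite subrr normr0 ltW.
have := @riemann_sum_le g p.1 eta d' N eta0 d'0 cg g0 gosc.
have -> : (eta * \sum_(i < N) g (p.1 - i%:R * eta) = eta ^+ 2 *
   \sum_(i < N) \sum_(j < N) f (p.1 - i%:R * eta, p.2 - j%:R * eta))%R.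
  by rewrite /g -mulr_sumr expr2 mulrA.
move=> h; apply: (le_trans h).
have cF : continuous (fun x => f x + 2 * d)%R.
  by move=> x; apply: cvgD; [exact: cf | exact: cvg_cst].
have F0 x : (0 <= f x + 2 * d)%R by rewrite addr_ge0// mulr_ge0.
set A := `[_, p.1]%classic.
have mA : measurable (A : set (measurableTypeR R)) by exact: measurable_itv.
set B := `[_, p.2]%classic.
have mB : measurable (B : set (measurableTypeR R)) by exact: measurable_itv.
have mF : mfun2 (A `*` B) (fun x => f x + 2 * d)%R.
  apply: (@mfun2_sub _ _ setT) => //.
  by apply: continuous_on_measurable => [|x _]; [exact: openT | exact: cF].
rewrite int2_rect1 //.
apply: ge0_le_integral => //.
- by move=> s _; rewrite lee_fin addr_ge0.
- apply/measurable_EFinP; apply: measurable_funTS.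
  apply: continuous_measurable_fun => s; apply: cvgD; first exact: cg.
  exact: cvg_cst.
- exact: (measurable_rect_slice mA mB mF (fun x _ => F0 x)).
move=> s _.
have -> : (g s + d' = eta * \sum_(j < N) (f (s, p.2 - j%:R * eta) + d))%R.
  by rewrite big_split /= sumr_const card_ord mulrDr -mulr_natl.
apply: (le_trans (@riemann_sum_le (fun y => f (s, y) + d)%R p.2 eta d N eta0 d0 _ _ _)).
- move=> y; apply: cvgD; last exact: cvg_cst.
  apply: (@continuous_comp _ _ _ (fun y => (s, y)) f); last exact: cf.
  by apply: continuous_pairing; [exact: cvg_cst | exact: cvg_id].
- by move=> y; rewrite addr_ge0.
- move=> y z yz; rewrite lerD2r; apply: osc => //=.
  by rewrite subrr normr0 ltW.
rewrite le_eqVlt; apply/orP; left; apply/eqP; apply: eq_integral => y _.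
by congr (_%:E); ring.
Qed.

End RiemannSums.

(** * Hardy's inequality and square integrals of test functions *)

Section TestFunctionIntegrals.
Variable R : realType.
Local Open Scope ereal_scope.
Implicit Types (f g : R * R -> R).
Local Notation H := (@halfplane R).

Lemma continuous_mfun2 f : continuous f -> mfun2 H f.
Proof.
by move=> cf; apply: continuous_on_measurable => [|x _]; [exact: open_halfplane|exact: cf].
Qed.

Lemma test_fun_mfun2 f : test_fun f -> mfun2 H f.
Proof. by move=> /test_fun_continuous; exact: continuous_mfun2. Qed.

Lemma mfun2_sqr D f : mfun2 D f -> mfun2 D (fun x => f x ^+ 2)%R.
Proof. by move=> mf; apply: measurable_funX. Qed.

Lemma int2_supp_le (P c : R) f : (0 < P)%R -> (0 <= c)%R -> mfun2 H f ->
  (forall x, H x -> 0 <= f x <= c)%R -> (forall x, outside P 0 x -> f x = 0%R) ->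
  int2 H f <= (c * (2 * P * P))%:E.
Proof.
move=> P0 c0 mf hf sf.
have mB : measurable (box P 0 : set (plane R)).
  by apply: measurableX; exact: measurable_itv.
apply: (@le_trans _ _ (int2 (box P 0) (cst c))).
  rewrite /int2 integral_mkcond [leRHS]integral_mkcond; apply: ge0_le_integral => //.
  - move=> x _; rewrite patchE; case: ifPn => // /set_mem /hf /andP[h _].
    by rewrite lee_fin.
  - apply/(measurable_restrictT (fun x => (f x)%:E) (@measurable_halfplane R)).
    by apply/measurable_EFinP; exact: mf.
  - by apply/(measurable_restrictT (fun x => c%:E) mB).
  move=> x _; rewrite !patchE; case: ifPn => xH; last by case: ifPn => // _; rewrite lee_fin.
  have [ox|/not_outside/mem_set ->] := pselect (outside P 0 x).
    by rewrite sf//; case: ifPn => // _; rewrite lee_fin.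
  by rewrite lee_fin; have /set_mem /hf /andP[] := xH.
rewrite /int2 (eq_integral (cst c%:E)) // integral_cst // [X in _ * X]product_measure1E; try exact: measurable_itv.
have PP : (- P < P)%R by lra.
have hl a b : (a < b)%R -> @lebesgue_measure R `[a, b]%classic = (b - a)%:E.
  by move=> ab; rewrite lebesgue_measure_itv /= lte_fin ab.
by rewrite /= !hl // -!EFinM lee_fin subr0; lra.
Qed.

Lemma int2_halfplaneT f : mfun2 setT f -> (forall x, ~ H x -> f x = 0%R) ->
  int2 H f = int2 setT f.
Proof.
move=> mf h; rewrite /int2 integral_mkcond; apply: eq_integral => x _.
by rewrite patchE; case: ifPn => //; rewrite notin_setE => /h ->.
Qed.

Lemma test_fun_off f x : test_fun f -> ~ H x -> f x = 0%R.
Proof.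
move=> tf xH; have [P [a [P0 a0 sf]]] := test_fun_supp tf.
by apply: sf; left; rewrite ltNge; apply/negP => ax; apply: xH; exact: lt_le_trans ax.
Qed.

(** The test function and its upward translate both vanish off the half-plane, so both integrals
    extend to the plane, where translation invariance holds. *)
Lemma int2_translate h f : (0 <= h.2)%R -> test_fun f ->
  int2 H (fun x => translate h f x ^+ 2)%R = int2 H (fun x => f x ^+ 2)%R.
Proof.
move=> h2 tf; have c2 g : test_fun g -> continuous (fun x => g x ^+ 2)%R.
  move=> tg x; rewrite (_ : (fun x => g x ^+ 2)%R = (fun x => g x * g x)%R); last first.
    by apply/funext => y; rewrite expr2.
  by apply: cvgM; exact: test_fun_continuous.
have m2 g : test_fun g -> mfun2 setT (fun x => g x ^+ 2)%R.
  move=> /c2 cg; apply: continuous_on_measurable => [|x _]; [exact: openT|exact: cg].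
have th := test_fun_translate h2 tf.
rewrite !int2_halfplaneT; try exact: m2.
- by rewrite -(int2_shift h (c2 f tf)) // => x; exact: sqr_ge0.
- by move=> x xH; rewrite test_fun_off ?expr0n.
- by move=> x xH; rewrite test_fun_off ?expr0n.
Qed.

(** The sum of the squared deviations from the mean is nonnegative. *)
Lemma sqr_mean_le (N : nat) (a : 'I_N -> R) : (0 < N)%N ->
  ((N%:R^-1 * \sum_(k < N) a k) ^+ 2 <= N%:R^-1 * \sum_(k < N) a k ^+ 2)%R.
Proof.
move=> N0; have n0 : (0 < N%:R :> R)%R by rewrite ltr0n.
set m := (N%:R^-1 * _)%R.
have sm : (\sum_(k < N) a k = N%:R * m)%R by rewrite /m mulrA divff ?mul1r// gt_eqF.
have : (0 <= \sum_(k < N) (a k - m) ^+ 2)%R by apply: sumr_ge0 => k _; exact: sqr_ge0.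
have -> : (\sum_(k < N) (a k - m) ^+ 2 =
          \sum_(k < N) a k ^+ 2 - 2 * m * \sum_(k < N) a k + N%:R * m ^+ 2)%R.
  have -> : (N%:R * m ^+ 2 = \sum_(k < N) m ^+ 2)%R by rewrite sumr_const card_ord mulr_natl.
  rewrite mulr_sumr -sumrB -big_split /=; apply: eq_bigr => k _; ring.
rewrite sm => h; rewrite mulrC ler_pdivlMr//; lra.
Qed.

Lemma int2_mean_le (N : nat) (g : 'I_N -> R * R -> R) (c : R) : (0 < N)%N ->
  (forall k, mfun2 H (g k)) -> (forall k, int2 H (fun x => g k x ^+ 2)%R <= c%:E) ->
  int2 H (fun x => (N%:R^-1 * \sum_(k < N) g k x) ^+ 2)%R <= c%:E.
Proof.
move=> N0 mg hg; have n0 : (0 < N%:R :> R)%R by rewrite ltr0n.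
have mH := @measurable_halfplane R.
have ms k : mfun2 H (fun x => g k x ^+ 2)%R by exact: mfun2_sqr.
have msum (u : 'I_N -> R * R -> R) : (forall k, mfun2 H (u k)) ->
    mfun2 H (fun x => \sum_(k < N) u k x)%R.
  by move=> mu; apply: measurable_sum => k; exact: mu.
apply: (@le_trans _ _ (int2 H (fun x => N%:R^-1 * \sum_(k < N) g k x ^+ 2)%R)).
  apply: int2_le => //.
  - by apply: mfun2_sqr; apply: measurable_funM => //; exact: msum.
  - by apply: measurable_funM => //; exact: msum.
  - by move=> x _; rewrite sqr_ge0 /=; exact: sqr_mean_le.
have s0 x : (0 <= \sum_(k < N) g k x ^+ 2)%R.
  by apply: sumr_ge0 => k _; exact: sqr_ge0.
have i0 : (0 <= N%:R^-1 :> R)%R by rewrite invr_ge0 ltW.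
rewrite (int2Z mH (msum _ ms) (fun x _ => s0 x) i0).
rewrite (int2_sum mH ms (fun k x _ => sqr_ge0 _)).
apply: (@le_trans _ _ (N%:R^-1%:E * (\sum_(k < N) c%:E))).
  by apply: lee_wpmul2l; [rewrite lee_fin | apply: lee_sum].
rewrite sumEFin sumr_const card_ord -EFinM lee_fin -[(c *+ N)%R]mulr_natl mulrA mulVf ?mul1r//.
by rewrite gt_eqF.
Qed.

(** Write d_2 for the vertical derivative. With g = 2 f^2 / x_2, the defect 4 (d_2 f)^2 - d_2 g -
    f^2 / x_2^2 is the square of 2 d_2 f - f / x_2. *)
Lemma hardy_inequality f : test_fun f ->
  int2 H (fun x => f x ^+ 2 / x.2 ^+ 2)%R <=
  4%:E * int2 H (fun x => partial ord_max f x ^+ 2)%R.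
Proof.
move=> tf; have [P [a [P0 a0 sf]]] := test_fun_supp tf.
have mH := @measurable_halfplane R.
have tp := test_fun_partial ord_max tf.
rewrite -int2Z //; [|by apply: mfun2_sqr; exact: test_fun_mfun2|by move=> x _; exact: sqr_ge0].
pose g (x : R * R) : R := (2 * (f x ^+ 2 / x.2))%R.
pose dg (x : R * R) : R :=
  (2 * (2 * f x * partial ord_max f x / x.2 - f x ^+ 2 / x.2 ^+ 2))%R.
have cf x : {for x, continuous f} by exact: test_fun_continuous.
have cp x : {for x, continuous (partial ord_max f)} by exact: test_fun_continuous.
have c2 x : H x -> {for x, continuous (fun x : R * R => x.2^-1)%R}.
  by move=> x0; apply: cvgV; [rewrite gt_eqF | exact: cvg_snd].
have cX (u : R * R -> R) n x : {for x, continuous u} -> {for x, continuous (fun x => u x ^+ n)%R}.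
  move=> cu; elim: n => [|n IH]; first exact: cvg_cst.
  rewrite (_ : (fun x => u x ^+ n.+1)%R = (fun x => u x * u x ^+ n)%R).
    by apply: cvgM.
  by apply/funext => y; rewrite exprS.
have cXV n x : H x -> {for x, continuous (fun x : R * R => (x.2 ^+ n)^-1)%R}.
  move=> x0; rewrite (_ : (fun x => _) = (fun x : R * R => (x.2^-1) ^+ n)%R).
    by apply: cX; exact: c2.
  by apply/funext => y; rewrite exprVn.
apply: (@int2_le_vertical R _ _ g dg a a0).
- by move=> x x0; apply: cvgM; [exact: cX | exact: cXV].
- by move=> x x0; apply: cvgM; [exact: cvg_cst | exact: cX].
- move=> x x0; apply: cvgM; first exact: cvg_cst.
  apply: cvgB; last by apply: cvgM; [exact: cX | exact: cXV].
  apply: cvgM; last exact: c2.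
  apply: cvgM; last exact: cp.
  by apply: cvgM; [exact: cvg_cst | exact: cf].
- move=> x x0; have xn : (x.2 != 0)%R by rewrite gt_eqF.
  have [ds dsE] := test_fun_derive ord_max x tf.
  have dx := @is_derive_coord R ord_max ord_max x.
  have dV : is_derive x (unit_dir R ord_max) (fun x : R * R => x.2^-1)%R (- x.2 ^- 2)%R.
    have hV : is_derive x.2 (1%R : R) (fun t : R => t^-1)%R (- x.2 ^- 2)%R.
      have := @is_deriveV R id x.2 1%R 1%R xn (is_derive_id _ _).
      by apply: is_derive_val; rewrite /GRing.scale /= mulr1.
    have := @is_derive_comp2 R (fun t => t^-1)%R snd x ord_max _ 1%R hV dx.
    by apply: is_derive_val; rewrite mulr1.
  have h := is_deriveM (is_deriveM (test_fun_derive ord_max x tf) (test_fun_derive ord_max x tf)) dV.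
  have := is_deriveM (is_derive_cst (2%R : R) x (unit_dir R ord_max)) h.
  rewrite (_ : cst 2 * _ = g)%R; last first.
    by apply/funext => y; rewrite /g expr2.
  apply: is_derive_val; rewrite scaler0 addr0 /dg.
  rewrite -[(f * f)%R x]/(f x * f x)%R -[cst _ x]/(2%R : R) /GRing.scale /=.
  by field.
- move=> x x0; have xn : (x.2 != 0)%R by rewrite gt_eqF.
  rewrite divr_ge0 ?sqr_ge0//= -subr_ge0.
  have -> : (4 * partial ord_max f x ^+ 2 - dg x - f x ^+ 2 / x.2 ^+ 2 =
             (2 * partial ord_max f x - f x / x.2) ^+ 2)%R by rewrite /dg; field.
  exact: sqr_ge0.
- by move=> x _; rewrite mulr_ge0// sqr_ge0.
- by move=> x x0; rewrite mulr_ge0// divr_ge0 ?sqr_ge0// ltW.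
- move=> x x0 xa; rewrite /g sf; last by left.
  by rewrite expr0n !mul0r mulr0.
Qed.

(** A test function is Lipschitz, and for translations by at most 1 the difference lives in a box
    enlarged by 1. *)
Lemma translation_modulus f (d : R) : test_fun f -> (0 < d)%R ->
  exists2 e, (0 < e)%R & forall h, (`|h.1| <= e)%R -> (0 <= h.2 <= e)%R ->
    int2 H (fun x => (translate h f x - f x) ^+ 2)%R <= d%:E.
Proof.
move=> tf d0; have [P [a [P0 a0 sf]]] := test_fun_supp tf.
have [B B0 hB] := test_fun_lipschitz tf.
pose Q := (P + 1)%R; have Q0 : (0 < Q)%R by rewrite addr_gt0.
pose K := ((2 * B) ^+ 2 * (2 * Q * Q))%R.
have K0 : (0 < K)%R by rewrite !mulr_gt0// exprn_gt0// mulr_gt0.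
(* The integral will be at most K e^2, hence at most K e because e <= 1. *)
pose e := Num.min 1%R (Num.min 1%R (d / K))%R.
have e0 : (0 < e)%R by rewrite !lt_min ltr01 divr_gt0.
have e1 : (e <= 1)%R by rewrite ge_min lexx.
have ed : (e <= d / K)%R by rewrite !ge_min lexx !orbT.
exists e => // h h1 /andP[h2 h2e].
apply: le_trans (@int2_supp_le Q ((2 * B * e) ^+ 2) _ Q0 (sqr_ge0 _) _ _ _) _.
- apply: mfun2_sqr; apply: measurable_funB; apply: test_fun_mfun2 => //.
  exact: test_fun_translate.
- move=> x _; rewrite sqr_ge0 /= -real_normK ?num_real// lerXn2r ?nnegrE ?normr_ge0//.
    by rewrite !mulr_ge0// ltW.
  apply: (le_trans (hB _ _)) => /=.
  have -> : (x.1 - h.1 - x.1 = - h.1)%R by ring.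
  have -> : (x.2 - h.2 - x.2 = - h.2)%R by ring.
  rewrite !normrN (ger0_norm h2) -mulrA mulrCA ler_wpM2l ?(ltW B0)//; lra.
- move=> x ox; have -> : f x = 0%R.
    apply: sf; apply: outside_sub ox; first by rewrite /Q lerDl.
    exact: ltW.
  rewrite /translate sf ?subrr ?expr0n//.
  case: ox => [xa|[xP|xP]]; rewrite /outside /=.
  + by left; lra.
  + right; left; have := ler_normD (x.1 - h.1)%R h.1; rewrite subrK.
    by move: xP; rewrite /Q; lra.
  + by right; right; move: xP; rewrite /Q; lra.
rewrite lee_fin; apply: (@le_trans _ _ (K * e)%R).
  have -> : ((2 * B * e) ^+ 2 * (2 * Q * Q) = K * (e * e))%R by rewrite /K; ring.
  by rewrite ler_wpM2l ?(ltW K0)// ler_piMr// ltW.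
by rewrite mulrC -ler_pdivlMr.
Qed.

End TestFunctionIntegrals.

(** * Stream functions *)

Lemma near_snd_lt (R : realType) (x : R * R) (a : R) : x.2 < a ->
  \forall y \near x, y.2 < a.
Proof.
move=> xa; have : nbhs x ((@snd R R) @^-1` [set t | t < a]).
  apply: open_nbhs_nbhs; split=> //.
  by apply: open_comp => [y _|]; [exact: cvg_snd | exact: open_lt].
by [].
Qed.

Section StreamFunction.
Variable R : realType.
Local Notation mu := (@lebesgue_measure R).
Variables f1 f2 : R * R -> R.
Hypotheses (tf1 : test_fun f1) (tf2 : test_fun f2).
Hypothesis div0 : forall x, halfplane x -> partial ord0 f1 x + partial ord_max f2 x = 0.

(** Integration starts on the boundary, near which the field vanishes, and this fixes the additive
    constant. For a solenoidal field (f1, f2) the gradient is (- f2, f1). *)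
Definition stream (x : R * R) : R := \int[mu]_(s in `[0, x.2]) f1 (x.1, s).

Let slice1 (f : R * R -> R) (y : R) : continuous f -> continuous (fun x => f (x, y)).
Proof.
move=> cf x; apply: (@continuous_comp _ _ _ (fun x => (x, y)) f); last exact: cf.
by apply: continuous_pairing; [exact: cvg_id | exact: cvg_cst].
Qed.

Let slice2 (f : R * R -> R) (x : R) : continuous f -> continuous (fun y => f (x, y)).
Proof.
move=> cf y; apply: (@continuous_comp _ _ _ (fun y => (x, y)) f); last exact: cf.
by apply: continuous_pairing; [exact: cvg_cst | exact: cvg_id].
Qed.

Let integrable_slice (f : R * R -> R) (x a b : R) : test_fun f ->
  mu.-integrable `[a, b] (EFin \o (fun s => f (x, s))).
Proof.
move=> /test_fun_continuous cf; apply: integrable_itv => s _.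
exact: slice2.
Qed.

Lemma stream_supp P a : 0 < a -> supp_in P a f1 -> forall x, x.2 < a -> stream x = 0.
Proof.
move=> a0 sf x xa; rewrite /stream /Rintegral integral0_eq// => s /=.
by rewrite in_itv /= => /andP[_ sx]; rewrite sf//; left => /=; exact: le_lt_trans xa.
Qed.

Lemma is_derive_stream2 x : is_derive x (unit_dir R ord_max) stream (f1 x).
Proof.
have [P [a [P0 a0 sf]]] := test_fun_supp tf1.
have [x0|x0] := ltP 0 x.2; last first.
  have xa : x.2 < a by exact: le_lt_trans a0.
  rewrite sf; last by left.
  apply: (@near_eq_is_derive _ _ _ (cst 0)).
  near=> y; rewrite (stream_supp a0 sf)//; near: y.
  exact: near_snd_lt.
apply/is_derive_slice => /=.
have xu : x.2 < x.2 + 1 by rewrite ltrDl.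
have [||| h1 h2] := @continuous_FTC1 R (fun s => f1 (x.1, s)) (BLeft 0) x.2 (x.2 + 1) xu.
- exact: integrable_slice.
- by rewrite lte_fin.
- by apply: slice2; exact: test_fun_continuous.
split; first exact: h1.
by rewrite -derive1E h2; case: (x).
Unshelve. all: by end_near. Qed.

(** Differentiation under the integral sign produces the horizontal derivative of f1, which is minus
    the vertical derivative of f2; this integrates back to - f2, as f2 vanishes at height 0. *)
Lemma is_derive_stream1 x : is_derive x (unit_dir R ord0) stream (- f2 x).
Proof.
have [P [a [P0 a0 sf]]] := test_fun_supp tf1.
have [P' [a' [P'0 a'0 sf2]]] := test_fun_supp tf2.
have [x0|x0] := ltP 0 x.2; last first.
  have xa : x.2 < a by exact: le_lt_trans a0.
  rewrite (_ : f2 x = 0) ?oppr0; last by apply: sf2; left; exact: le_lt_trans a'0.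
  apply: (@near_eq_is_derive _ _ _ (cst 0)).
  near=> y; rewrite (stream_supp a0 sf)//; near: y.
  exact: near_snd_lt.
have tp := test_fun_partial ord0 tf1.
have [B B0 hB] := test_fun_bounded tp.
apply/is_derive_slice => /=.
have Ia : `]x.1 - 1, x.1 + 1[%classic x.1.
  by rewrite /= in_itv /= ltrBlDr ltrDl ltr01.
have d1 (t s : R) : is_derive t (1:R) (fun t => f1 (t, s)) (partial ord0 f1 (t, s)).
  by have /is_derive_slice := test_fun_derive ord0 (t, s) tf1.
have pE t s : partial1of2 (fun t s => f1 (t, s)) t s = partial ord0 f1 (t, s).
  by rewrite /partial1of2 derive1E; have [_ ->] := d1 t s.
have mI : measurable (`[0, x.2]%classic : set (measurableTypeR R)) by exact: measurable_itv.
have i1 (t : R) : `]x.1 - 1, x.1 + 1[%classic t ->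
    mu.-integrable `[0, x.2] (EFin \o (fun s => f1 (t, s))).
  by move=> _; exact: integrable_slice.
have i2 (t s : R) : `]x.1 - 1, x.1 + 1[%classic t -> `[0, x.2]%classic s ->
    derivable (fun t => f1 (t, s)) t 1.
  by move=> _ _; have [] := d1 t s.
have iG : mu.-integrable `[0, x.2] (EFin \o cst B).
  by apply: integrable_itv => s _; exact: cst_continuous.
have hG (t s : R) : `]x.1 - 1, x.1 + 1[%classic t -> `[0, x.2]%classic s ->
    `|partial1of2 (fun t s => f1 (t, s)) t s| <= cst B s.
  by move=> _ _; rewrite pE.
have G0 (s : R) : 0 <= cst B s by rewrite ltW.
have h1 := derivable_under_integral mI Ia i1 i2 G0 iG hG.
have h2 := differentiation_under_integral mI Ia i1 i2 G0 iG hG.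
split; first exact: h1.
rewrite -derive1E h2.
have -> : \int[mu]_(y in `[0, x.2]) (partial1of2 (fun t s => f1 (t, s)))^~ y x.1 =
   \int[mu]_(s in `[0, x.2]) (- partial ord_max f2 (x.1, s)).
  apply: eq_Rintegral => s /set_mem /=; rewrite in_itv /= => /andP[s0 sx].
  rewrite pE; have [sH|] := ltP 0 s.
    by apply/eqP; rewrite -subr_eq0 opprK; apply/eqP; exact: (div0 (x := (x.1, s))).
  (* The divergence condition is available on the open half-plane only; at height 0 both derivatives
     vanish by the support conditions. *)
  move=> s0'; have -> : s = 0 by apply/eqP; rewrite eq_le s0 s0'.
  rewrite (@supp_in_partial R P a f1 ord0 sf); last by left.
  by rewrite (@supp_in_partial R P' a' f2 ord_max sf2) ?oppr0//; left.
have d2 (s : R) : is_derive s (1:R) (fun s => - f2 (x.1, s)) (- partial ord_max f2 (x.1, s)).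
  by apply: is_deriveN; have /is_derive_slice := test_fun_derive ord_max (x.1, s) tf2.
have cf2 : continuous (fun s => - f2 (x.1, s)).
  by move=> s; apply: cvgN; apply: slice2; exact: test_fun_continuous.
have cp2 : continuous (fun s => - partial ord_max f2 (x.1, s)).
  move=> s; apply: cvgN; apply: slice2; apply: test_fun_continuous.
  exact: test_fun_partial.
rewrite /Rintegral (@continuous_FTC2 R _ (fun s => - f2 (x.1, s)) _ _ x0).
- have xE : (x.1, x.2) = x by case: (x).
  have z : f2 (x.1, 0) = 0 by apply: sf2; left.
  by rewrite /= xE z oppr0 subr0.
- by apply: within_continuous_itv => s _; exact: cp2.
- split.
  + by move=> s _; have [] := d2 s.
  + by apply: cvg_at_right_filter; exact: cf2.
  + by apply: cvg_at_left_filter; exact: cf2.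
- by move=> s _; rewrite derive1E; have [_ ->] := d2 s.
Unshelve. all: by end_near. Qed.

(** Existence of the partial derivatives alone would not give joint continuity; their boundedness
    gives a Lipschitz estimate. *)
Lemma continuous_stream : continuous stream.
Proof.
have [B1 B10 hB1] := test_fun_bounded tf1.
have [B2 B20 hB2] := test_fun_bounded tf2.
have lip (x y : R * R) : `|stream x - stream y| <= (B1 + B2) * (`|x.1 - y.1| + `|x.2 - y.2|).
  case: x y => a b [c d] /=.
  rewrite (_ : stream (a, b) - stream (c, d) =
    (stream (a, b) - stream (c, b)) + (stream (c, b) - stream (c, d))); last by ring.
  apply: (le_trans (ler_normD _ _)); rewrite mulrDr; apply: lerD.
    apply: (@le_trans _ _ (B2 * `|a - c|)); last by rewrite ler_wpM2r// lerDr ltW.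
    apply: (@mvt_lipschitz R (fun t => stream (t, b)) (fun t => - f2 (t, b))).
      by move=> r; have /is_derive_slice := is_derive_stream1 (r, b).
    by move=> r; rewrite normrN.
  apply: (@le_trans _ _ (B1 * `|b - d|)); last by rewrite ler_wpM2r// lerDl ltW.
  apply: (@mvt_lipschitz R (fun t => stream (c, t)) (fun t => f1 (c, t))) => //.
  by move=> r; have /is_derive_slice := is_derive_stream2 (c, r).
move=> x; apply/cvgrPdist_le => e e0.
have B : 0 < B1 + B2 by exact: addr_gt0.
have d0 : 0 < e / (B1 + B2) / 2 by rewrite !divr_gt0.
near=> y; apply: (le_trans (lip _ _)).
rewrite mulrC -ler_pdivlMr//.
rewrite (_ : e / (B1 + B2) = e / (B1 + B2) / 2 + e / (B1 + B2) / 2); last by lra.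
apply: lerD; near: y.
  have : (fst y) @[y --> x] --> x.1 by exact: cvg_fst.
  by move/cvgrPdist_le => /(_ _ d0).
have : (snd y) @[y --> x] --> x.2 by exact: cvg_snd.
by move/cvgrPdist_le => /(_ _ d0).
Unshelve. all: by end_near. Qed.

Lemma Ck_stream n : Ck setT n stream.
Proof.
have oT := @openT (R * R)%type.
case: n => [|n]; first by split=> // x _; exact: continuous_stream.
apply: (@CkS_intro _ _ _ _ (fun i => if i == ord0 then - f2 else f1)) => //.
- move=> i x _; case: (ord2_cases i) => -> /=.
    exact: is_derive_stream1.
  exact: is_derive_stream2.
- by move=> x _; exact: continuous_stream.
- move=> i; case: ifP => _; last exact: test_fun_Ck.
  by apply: CkN => //; exact: test_fun_Ck.
Qed.

(** On a vertical line C ln (s + e) is a primitive of the majorant. By the mean value theorem it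
    grows at least as fast as the stream function and as its opposite. *)
Lemma stream_le (x : R * R) (C e : R) : 0 < x.2 -> 0 < e -> 0 <= C ->
  (forall s, 0 < s <= x.2 -> `|f1 (x.1, s)| <= C / (s + e)) ->
  `|stream x| <= C * (ln (x.2 + e) - ln e).
Proof.
move=> x0 e0 C0 hC.
have [P [a [P0 a0 sf]]] := test_fun_supp tf1.
have s0 : stream (x.1, 0) = 0 by rewrite (stream_supp a0 sf).
have hC' s : 0 <= s <= x.2 -> `|f1 (x.1, s)| <= C / (s + e).
  move=> /andP[]; rewrite le_eqVlt => /orP[/eqP <- _|s1 s2].
    by rewrite sf ?normr0 ?add0r ?divr_ge0 ?(ltW e0)//; left.
  by apply: hC; rewrite s1.
have dl (s : R) : 0 <= s -> is_derive s (1:R) (fun s => C * ln (s + e)) (C / (s + e)).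
  move=> s0'; have se : 0 < s + e by rewrite ltr_wpDl.
  have ds : is_derive s (1:R) (fun s : R => s + e) 1.
    have := is_deriveD (is_derive_id s (1:R)) (is_derive_cst e s (1:R)).
    by apply: is_derive_val; rewrite addr0.
  have h := @is_derive1_comp R (@ln R) (fun s => s + e) s _ _ (is_derive1_ln se) ds.
  have := is_deriveM (is_derive_cst (C : R) s (1:R)) h.
  by apply: is_derive_val; rewrite scaler0 addr0 /GRing.scale /= mulr1.
have dS (s : R) : is_derive s (1:R) (fun s => stream (x.1, s)) (f1 (x.1, s)).
  by have /is_derive_slice := is_derive_stream2 (x.1, s).
(* The values c = 1 and c = -1 give the two halves of the absolute value. *)
have key (c : R) : `|c| = 1 -> c * stream x <= C * (ln (x.2 + e) - ln e).
  move=> c1.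
  have du (s : R) : 0 <= s -> is_derive s (1:R) (fun s => C * ln (s + e) - c * stream (x.1, s))
      (C / (s + e) - c * f1 (x.1, s)).
    move=> s0'; have h := is_deriveM (is_derive_cst (c : R) s (1:R)) (dS s).
    have := is_deriveB (dl s s0') h.
    by apply: is_derive_val; rewrite scaler0 addr0 /GRing.scale.
  have [||r] := @MVT_segment R (fun s => C * ln (s + e) - c * stream (x.1, s))
      (fun s => C / (s + e) - c * f1 (x.1, s)) 0 x.2 (ltW x0).
  - by move=> s; rewrite in_itv /= => /andP[/ltW s1 _]; exact: du.
  - apply: within_continuous_itv => s /andP[s1 _].
    apply: differentiable_continuous; apply/derivable1_diffP.
    by have [] := du s s1.
  rewrite in_itv /= => hr; rewrite s0 mulr0 subr0 add0r => E.
  have : 0 <= (C / (r + e) - c * f1 (x.1, r)) * (x.2 - 0).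
    rewrite mulr_ge0 ?subr0 ?(ltW x0)// subr_ge0; apply: le_trans (hC' r hr).
    by apply: (le_trans (ler_norm _)); rewrite normrM c1 mul1r.
  rewrite -E; have -> : (x.1, x.2) = x by case: (x).
  lra.
rewrite ler_norml; apply/andP; split.
  by have := key (-1); rewrite normrN1 mulN1r => /(_ erefl); lra.
by have := key 1; rewrite normr1 mul1r; exact.
Qed.

End StreamFunction.

(** * The logarithmic cutoff *)

Section LogarithmicCutoff.
Variable R : realType.
Implicit Types (x : R * R) (i j k : 'I_2).
Local Notation H := (@halfplane R).

Definition rho x : R := x.1 ^+ 2 + x.2 ^+ 2.

(** This is ln |x| / lam, written through |x|^2 so that no square root has to be differentiated. *)
Definition logarg (lam : R) x : R := ln (rho x) / (2 * lam).

Definition chi (lam : R) x : R := trans (logarg lam x).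

Definition dlog j x : R := coord j x / rho x.

Definition dchi (lam : R) j x : R := dtrans (logarg lam x) * (dlog j x / lam).

Definition d2chi (lam : R) k j x : R :=
  d2trans (logarg lam x) * (dlog k x / lam) * (dlog j x / lam) +
  dtrans (logarg lam x) * (((k == j)%:R / rho x - 2 * dlog k x * dlog j x) / lam).

Lemma rho_gt0 x : H x -> 0 < rho x.
Proof. by move=> x0; rewrite ltr_wpDl ?sqr_ge0// exprn_gt0. Qed.

Lemma is_derive_rho i x : is_derive x (unit_dir R i) rho (2 * coord i x).
Proof.
have h0 := is_derive_coord i ord0 x; have h1 := is_derive_coord i ord_max x.
have := is_deriveD (is_deriveM h0 h0) (is_deriveM h1 h1).
rewrite (_ : _ + _ = rho); last first.
  by apply/funext => y; rewrite /rho !expr2.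
apply: is_derive_val; rewrite /GRing.scale /=.
by case: (ord2_cases i) => -> /=; rewrite /coord /=; lra.
Qed.

Lemma Ck_rho D n : open D -> Ck D n rho.
Proof.
move=> oD; have h0 := @Ck_coord R D n ord0 oD; have h1 := @Ck_coord R D n ord_max oD.
apply: (@Ck_ext _ _ _ (coord ord0 * coord ord0 + coord ord_max * coord ord_max)) => //.
by apply: CkD => //; apply: CkM.
Qed.

Lemma is_derive_logarg lam i x : 0 < lam -> H x ->
  is_derive x (unit_dir R i) (logarg lam) (dlog i x / lam).
Proof.
move=> l0 xH; have r0 := rho_gt0 xH.
have h := is_derive_comp2 (is_derive1_ln r0) (is_derive_rho i x).
have := is_deriveM h (is_derive_cst ((2 * lam)^-1 : R) x (unit_dir R i)).
apply: is_derive_val; rewrite scaler0 add0r /GRing.scale /= /dlog.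
by field; rewrite !gt_eqF.
Qed.

Lemma is_derive_dlog k j x : H x -> is_derive x (unit_dir R k) (dlog j)
  ((k == j)%:R / rho x - 2 * dlog k x * dlog j x).
Proof.
move=> xH; have r0 := rho_gt0 xH; have rn : rho x != 0 by rewrite gt_eqF.
have dV : is_derive (rho x) (1 : R) (fun t : R => t^-1) (- (rho x) ^- 2).
  have := @is_deriveV R id (rho x) 1 1 rn (is_derive_id _ _).
  by apply: is_derive_val; rewrite /GRing.scale /= mulr1.
have h := is_derive_comp2 dV (is_derive_rho k x).
have := is_deriveM (is_derive_coord k j x) h.
apply: is_derive_val; rewrite /GRing.scale /= /dlog.
by field.
Qed.

Lemma is_derive_chi lam i x : 0 < lam -> H x ->
  is_derive x (unit_dir R i) (chi lam) (dchi lam i x).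
Proof.
move=> l0 xH.
exact: (is_derive_comp2 (is_derive_trans _) (is_derive_logarg i l0 xH)).
Qed.

Lemma is_derive_dchi lam k j x : 0 < lam -> H x ->
  is_derive x (unit_dir R k) (dchi lam j) (d2chi lam k j x).
Proof.
move=> l0 xH.
have h1 := is_derive_comp2 (is_derive_dtrans _) (is_derive_logarg k l0 xH).
have h2 := is_deriveM (is_derive_dlog k j xH) (is_derive_cst (lam^-1 : R) x (unit_dir R k)).
have := is_deriveM h1 h2.
apply: is_derive_val; rewrite scaler0 add0r /GRing.scale /= /d2chi.
by rewrite -[(dlog j * cst lam^-1) x]/(dlog j x * lam^-1); ring.
Qed.

(** This symmetry is what cancels the second derivatives of chi in the divergence of [cut]. *)
Lemma d2chi_sym lam k j x : d2chi lam k j x = d2chi lam j k x.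
Proof. by rewrite /d2chi eq_sym; ring. Qed.

Lemma Ck_chi lam n : 0 < lam -> Ck H n (chi lam).
Proof.
move=> l0; have oH := @open_halfplane R.
have CL : Ck H n (logarg lam).
  apply: (@CkM _ _ _ (fun x => ln (rho x)) (cst ((2 * lam)^-1))) => //.
    by apply: Ck_ln => //; [exact: rho_gt0 | exact: Ck_rho].
  exact: Ck_cst.
have C1 : Ck H n (logarg lam + - cst 1) by apply: CkD => //; apply: CkN => //; exact: Ck_cst.
have C2 := Ck_flat 0 oH C1.
have C3 : Ck H n (cst (flat 0 (2 : R)) + - (flat 0 \o (logarg lam + - cst 1))).
  by apply: CkD => //; [exact: Ck_cst | exact: CkN].
apply: (@CkM _ _ _ (flat 0 \o (cst (flat 0 (2 : R)) + - (flat 0 \o (logarg lam + - cst 1))))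
  (cst (flat 0 (flat 0 2))^-1)) => //; last exact: Ck_cst.
exact: Ck_flat.
Qed.

Lemma Ck_dchi lam n j : 0 < lam -> Ck H n (dchi lam j).
Proof.
move=> l0; have [_ /(_ j) [_ h]] := Ck_chi n.+1 l0.
apply: Ck_ext h; first exact: open_halfplane.
by move=> x xH; apply: partialE; exact: is_derive_chi.
Qed.

Lemma chi_eq1 lam x : 0 < lam -> H x -> rho x <= expR (2 * lam) -> chi lam x = 1.
Proof.
move=> l0 xH hr; rewrite /chi trans_le1// /logarg ler_pdivrMr ?mulr_gt0// mul1r.
by rewrite -[leRHS]expRK ler_ln ?posrE ?expR_gt0 ?rho_gt0.
Qed.

Lemma logarg_ge3 lam x : 0 < lam -> H x -> expR (6 * lam) <= rho x -> 3 <= logarg lam x.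
Proof.
move=> l0 xH hr; rewrite /logarg ler_pdivlMr ?mulr_gt0//.
rewrite (_ : 3 * (2 * lam) = 6 * lam); last by ring.
by rewrite -[leLHS]expRK ler_ln ?posrE ?expR_gt0 ?rho_gt0.
Qed.

Lemma chi_eq0 lam x : 0 < lam -> H x -> expR (6 * lam) <= rho x ->
  chi lam x = 0 /\ (forall j, dchi lam j x = 0).
Proof.
move=> l0 xH hr; have h := logarg_ge3 l0 xH hr.
by split; [rewrite /chi trans_ge3 | move=> j; rewrite /dchi dtrans_ge3// mul0r].
Qed.

Lemma dlog_le j x : H x -> `|dlog j x| <= x.2^-1.
Proof.
move=> xH; have r0 := rho_gt0 xH.
rewrite /dlog normrM normfV (gtr0_norm r0) ler_pdivrMr// mulrC ler_pdivlMr//.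
rewrite /rho; case: (ord2_cases j) => ->; rewrite /coord /=.
  rewrite -(real_normK (num_real x.1)).
  have : 0 <= (`|x.1| - x.2) ^+ 2 by exact: sqr_ge0.
  have : 0 <= `|x.1| ^+ 2 + x.2 ^+ 2 by rewrite addr_ge0// sqr_ge0.
  by lra.
by rewrite gtr0_norm// -expr2 lerDr sqr_ge0.
Qed.

Lemma rhoV_le x : H x -> (rho x)^-1 <= x.2^-1 * x.2^-1.
Proof.
move=> xH; have r0 := rho_gt0 xH.
rewrite -invfM lef_pV2 ?posrE ?mulr_gt0// -expr2.
by rewrite /rho lerDr sqr_ge0.
Qed.

(** The derivatives of ln |x| of order one and two are of size 1/|x| and 1/|x|^2; they are weakened
    to powers of 1/x_2, the weights that Hardy's inequality absorbs. In the last bound, one unit of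
    the factor 4 is the term in 1/lam^2, at most 1/lam, and three come from the Hessian of ln |x|.
    It matters that C is independent of lam. *)
Lemma chi_bounds : exists2 C : R, 1 <= C & forall lam x, 1 <= lam -> H x ->
  [/\ `|chi lam x| <= C, forall j, `|dchi lam j x| <= C / lam / x.2 &
      forall k j, `|d2chi lam k j x| <= 4 * C / lam / x.2 ^+ 2].
Proof.
have [C C1 hC] := @trans_bounds R; exists C => // lam x l1 xH.
have l0 : 0 < lam by lra. have C0 : 0 <= C by lra.
have [h0 h1 h2] := hC (logarg lam x).
have y0 : 0 < x.2^-1 by rewrite invr_gt0.
have m0 : 0 < lam^-1 by rewrite invr_gt0.
have m1 : lam^-1 <= 1 by rewrite invf_le1.
have hq j : `|dlog j x / lam| <= lam^-1 * x.2^-1.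
  by rewrite normrM (gtr0_norm m0) mulrC ler_wpM2l ?(ltW m0)// dlog_le.
split=> // [j|k j].
  rewrite /dchi normrM -[leRHS]mulrA; exact: ler_pM.
rewrite /d2chi; apply: (le_trans (ler_normD _ _)).
have -> : 4 * C / lam / x.2 ^+ 2 = C * (lam^-1 * x.2^-1) * x.2^-1 +
   C * ((x.2^-1 * x.2^-1 + 2 * x.2^-1 * x.2^-1) * lam^-1).
  by rewrite -exprVn; ring.
apply: lerD.
  rewrite normrM; apply: ler_pM => //; first by rewrite normrM; exact: ler_pM.
  apply: (le_trans (hq j)); rewrite ger_pMl//.
rewrite normrM; apply: ler_pM => //; rewrite normrM (gtr0_norm m0) ler_wpM2r ?(ltW m0)//.
apply: (le_trans (ler_normB _ _)); apply: lerD.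
  rewrite normrM normfV (gtr0_norm (rho_gt0 xH)).
  apply: (@le_trans _ _ (1 * (rho x)^-1)); last by rewrite mul1r rhoV_le.
  apply: ler_wpM2r; first by rewrite invr_ge0 ltW// rho_gt0.
  by case: (k == j); rewrite ?normr1 ?normr0.
rewrite normrM; apply: ler_pM => //; last exact: dlog_le.
by rewrite normrM (ger0_norm (ler0n _ 2)) ler_wpM2l ?ler0n// dlog_le.
Qed.

End LogarithmicCutoff.

(** * Averages of translates *)

Section Averaging.
Variable R : realType.
Implicit Types (f g : R * R -> R) (x : R * R) (N : nat) (h : nat -> R * R) (c : R).
Local Notation H := (@halfplane R).

Definition mean (N : nat) (h : nat -> R * R) f x : R :=
  N%:R^-1 * \sum_(k < N) translate (h k) f x.

Lemma test_fun_ext f g : (forall x, f x = g x) -> test_fun f -> test_fun g.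
Proof. by move=> /funext ->. Qed.

Lemma test_fun_scale (c : R) f : test_fun f -> test_fun (fun x => c * f x).
Proof.
move=> tf; apply: test_fun_ext (test_fun_lin c (@test_fun0 R) tf) => x /=.
by rewrite add0r.
Qed.

Lemma test_fun_sum n (u : 'I_n -> R * R -> R) : (forall k, test_fun (u k)) ->
  test_fun (fun x => \sum_(k < n) u k x).
Proof.
elim: n u => [|n IH] u tu.
  by apply: test_fun_ext (@test_fun0 R) => x; rewrite big_ord0.
apply: test_fun_ext (test_fun_lin 1 (IH _ (fun k => tu (widen_ord (leqnSn n) k))) (tu ord_max)).
by move=> x; rewrite big_ord_recr mul1r.
Qed.

Lemma test_fun_sub f g : test_fun f -> test_fun g -> test_fun (fun x => f x - g x).
Proof.
move=> tf tg; apply: test_fun_ext (test_fun_lin (-1) tf tg) => x.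
by rewrite mulN1r.
Qed.

Lemma test_fun_mean N h f : (forall k, 0 <= (h k).2) -> test_fun f ->
  test_fun (mean N h f).
Proof.
move=> h0 tf; apply: test_fun_scale; apply: test_fun_sum => k.
exact: test_fun_translate.
Qed.

Lemma partial_mean N h f i : (forall k, 0 <= (h k).2) -> test_fun f ->
  partial i (mean N h f) = mean N h (partial i f).
Proof.
move=> h0 tf; apply/funext => x; apply: partialE.
have d k : is_derive x (unit_dir R i) (translate (h k) f) (translate (h k) (partial i f) x).
  by apply: is_derive_translate; exact: test_fun_derive.
have := is_deriveM (is_derive_cst (N%:R^-1 : R) x (unit_dir R i))
  (is_derive_sum (fun k : 'I_N => d k)).
by apply: is_derive_val; rewrite scaler0 addr0.
Qed.

Lemma meanB N h f g x : mean N h (fun y => f y - g y) x = mean N h f x - mean N h g x.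
Proof. by rewrite /mean -mulrBr -sumrB. Qed.

Lemma int2_mean N h f (c : R) : (0 < N)%N -> (forall k, 0 <= (h k).2) -> test_fun f ->
  (int2R H (fun x => f x ^+ 2) <= c%:E)%E ->
  (int2R H (fun x => mean N h f x ^+ 2) <= c%:E)%E.
Proof.
move=> N0 h0 tf hc; apply: int2_mean_le => // k.
  by apply: test_fun_mfun2; exact: test_fun_translate.
by rewrite int2_translate.
Qed.

Lemma int2_meanB N h f (c : R) : (0 < N)%N -> (forall k, 0 <= (h k).2) -> test_fun f ->
  (forall k : 'I_N, int2R H (fun x => (translate (h k) f x - f x) ^+ 2) <= c%:E)%E ->
  (int2R H (fun x => (mean N h f x - f x) ^+ 2) <= c%:E)%E.
Proof.
move=> N0 h0 tf hc.
rewrite (@int2_eq _ _ _ (fun x => (N%:R^-1 * \sum_(k < N) (translate (h k) f x - f x)) ^+ 2)).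
  apply: (@int2_mean_le _ _ (fun (k : 'I_N) x => translate (h k) f x - f x)) => // k.
  by apply: test_fun_mfun2; apply: test_fun_sub => //; exact: test_fun_translate.
move=> x _; congr (_ ^+ 2); rewrite sumrB sumr_const card_ord mulrBr -/(mean N h f x).
by rewrite -[f x *+ N]mulr_natl mulrA mulVf ?mul1r// pnatr_eq0 -lt0n.
Qed.

Lemma mean_sqr_le N h f x : (0 < N)%N ->
  mean N h f x ^+ 2 <= mean N h (fun y => f y ^+ 2) x.
Proof. by move=> N0; exact: sqr_mean_le. Qed.

Lemma mean_le N h f g x : (forall y, f y <= g y) -> mean N h f x <= mean N h g x.
Proof.
move=> fg; rewrite ler_wpM2l ?invr_ge0//; apply: ler_sum => k _; exact: fg.
Qed.

Definition hstep (eta : R) (k : nat) : R * R := (k%:R * eta, 0).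
Definition vstep (eta : R) (k : nat) : R * R := (0, k%:R * eta).

(* A finite average of translates replaces mollification: it maps test functions
   to test functions and commutes with derivatives for trivial reasons, and for
   large [N] it is close to the average over the square [cell (N * eta) x]. *)
Definition grid_mean (N : nat) (eta : R) f := mean N (hstep eta) (mean N (vstep eta) f).

Lemma hstep_ge0 (eta : R) k : 0 <= (hstep eta k).2. Proof. by []. Qed.
Lemma vstep_ge0 (eta : R) k : 0 <= eta -> 0 <= (vstep eta k).2.
Proof. by move=> e0; rewrite mulr_ge0. Qed.

Lemma test_fun_grid_mean N eta f : 0 <= eta -> test_fun f -> test_fun (grid_mean N eta f).
Proof.
move=> e0 tf; apply: test_fun_mean => [k|]; first exact: hstep_ge0.
by apply: test_fun_mean => // k; exact: vstep_ge0.
Qed.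

Lemma partial_grid_mean N eta f i : 0 <= eta -> test_fun f ->
  partial i (grid_mean N eta f) = grid_mean N eta (partial i f).
Proof.
move=> e0 tf; rewrite /grid_mean partial_mean.
- by rewrite partial_mean// => k; exact: vstep_ge0.
- by move=> k; exact: hstep_ge0.
- by apply: test_fun_mean => // k; exact: vstep_ge0.
Qed.

Lemma sqr_add3_le (a b c : R) : (a + b + c) ^+ 2 <= 3 * (a ^+ 2 + b ^+ 2 + c ^+ 2).
Proof.
have := sqr_ge0 (a - b); have := sqr_ge0 (b - c); have := sqr_ge0 (a - c); lra.
Qed.

(** The difference is the grid mean of f - g, plus the horizontal mean of the vertical averaging
    error of g, plus the horizontal averaging error of g. Means do not increase the integral of the
    square, and squaring a sum of three terms costs a factor 3. Translations are controlled for g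
    only, since g is fixed before f is chosen. *)
Lemma grid_mean_approx N (eta : R) f g (c : R) : (0 < N)%N -> 0 <= eta ->
  test_fun f -> test_fun g ->
  (int2R H (fun x => (f x - g x) ^+ 2) <= c%:E)%E ->
  (forall h : R * R, `|h.1| <= N%:R * eta -> 0 <= h.2 <= N%:R * eta ->
     (int2R H (fun x => (translate h g x - g x) ^+ 2) <= c%:E)%E) ->
  (int2R H (fun x => (grid_mean N eta f x - g x) ^+ 2) <= (9 * c)%:E)%E.
Proof.
move=> N0 e0 tf tg hfg hg.
have v0 k : 0 <= (vstep eta k).2 by exact: vstep_ge0.
have h0 k : 0 <= (hstep eta k).2 by exact: hstep_ge0.
have kN (k : 'I_N) : 0 <= k%:R * eta <= N%:R * eta.
  by rewrite mulr_ge0//= ler_wpM2r// ler_nat ltnW.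
have Ne0 : 0 <= N%:R * eta by rewrite mulr_ge0.
pose a x := mean N (hstep eta) (mean N (vstep eta) (fun y => f y - g y)) x.
pose b x := mean N (hstep eta) (fun y => mean N (vstep eta) g y - g y) x.
pose d x := mean N (hstep eta) g x - g x.
have tfg := test_fun_sub tf tg.
have tvg : test_fun (fun y => mean N (vstep eta) g y - g y).
  by apply: test_fun_sub => //; exact: test_fun_mean.
have ta : test_fun a by apply: test_fun_mean => //; exact: test_fun_mean.
have tb : test_fun b by exact: test_fun_mean.
have td : test_fun d by apply: test_fun_sub => //; exact: test_fun_mean.
have ia : (int2R H (fun x => a x ^+ 2) <= c%:E)%E.
  by apply: int2_mean => //; [exact: test_fun_mean | exact: int2_mean].
have ib : (int2R H (fun x => b x ^+ 2) <= c%:E)%E.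
  apply: int2_mean => //; apply: int2_meanB => // k.
  by apply: hg => /=; [rewrite normr0 | exact: kN].
have id : (int2R H (fun x => d x ^+ 2) <= c%:E)%E.
  apply: int2_meanB => // k.
  have /andP[k0 k1] := kN k.
  by apply: hg => /=; [rewrite ger0_norm | rewrite lexx].
have mH := @measurable_halfplane R.
have ms u : test_fun u -> mfun2 H (fun x => u x ^+ 2).
  by move=> tu; apply: mfun2_sqr; exact: test_fun_mfun2.
have s0 (u : R * R -> R) : forall x, H x -> 0 <= u x ^+ 2 by move=> x _; exact: sqr_ge0.
have mab : mfun2 H (fun x => a x ^+ 2 + b x ^+ 2) by apply: measurable_funD; exact: ms.
have mabd : mfun2 H (fun x => a x ^+ 2 + b x ^+ 2 + d x ^+ 2).
  by apply: measurable_funD => //; exact: ms.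
have ab0 x : H x -> 0 <= a x ^+ 2 + b x ^+ 2 by move=> _; rewrite addr_ge0// sqr_ge0.
apply: (@le_trans _ _ (int2R H (fun x => 3 * (a x ^+ 2 + b x ^+ 2 + d x ^+ 2)))).
  apply: int2_le => //.
  - apply: ms; apply: test_fun_sub => //; exact: test_fun_grid_mean.
  - by apply: measurable_funM.
  move=> x _; rewrite sqr_ge0 /=; apply: le_trans (sqr_add3_le _ _ _).
  rewrite le_eqVlt; apply/orP; left; apply/eqP; congr (_ ^+ 2).
  rewrite /a /b /d /grid_mean meanB.
  have -> : mean N (hstep eta) (mean N (vstep eta) (fun y => f y - g y)) x =
    mean N (hstep eta) (mean N (vstep eta) f) x - mean N (hstep eta) (mean N (vstep eta) g) x.
    by rewrite -meanB; congr (mean _ _ _ _); apply/funext => y; rewrite meanB.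
  by ring.
rewrite int2Z //; last by move=> x xH; rewrite addr_ge0// ?ab0// sqr_ge0.
rewrite int2D //; [|exact: ms|exact: s0]; rewrite int2D //; try exact: ms; try exact: s0.
rewrite (_ : 9 * c = 3 * (c + c + c)); last by ring.
rewrite EFinM; apply: lee_wpmul2l => //; rewrite !EFinD.
by apply: leeD => //; exact: leeD.
Qed.

Definition cell (e : R) x : set (R * R) := `[x.1 - e, x.1]%classic `*` `[x.2 - e, x.2]%classic.

Lemma measurable_cell e x : measurable (cell e x : set (plane R)).
Proof. by apply: measurableX; exact: measurable_itv. Qed.

Lemma int2_cell_cst (e : R) x (c : R) : 0 < e -> int2R (cell e x) (cst c) = (c * e ^+ 2)%:E.
Proof.
move=> e0; rewrite /int2 (eq_integral (cst c%:E)) // integral_cst //; last exact: measurable_cell.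
rewrite [X in (_ * X)%E]product_measure1E; try exact: measurable_itv.
have hl (a : R) : @lebesgue_measure R `[a - e, a]%classic = e%:E.
  by rewrite lebesgue_measure_itv /= lte_fin ltrBlDr ltrDl e0 -EFinD opprB addrC subrK.
by rewrite /= !hl -!EFinM expr2.
Qed.

(** Convexity of the square, used in both directions, leaves a Riemann sum of f^2 over the cell. The
    threshold is uniform in x because f is bounded and Lipschitz. *)
Lemma grid_mean_sqr_le f (e d : R) : test_fun f -> 0 < e -> 0 < d ->
  exists N0 : nat, forall N x, (N0 < N)%N ->
    ((grid_mean N (e / N%:R) f x ^+ 2)%:E <=
     (e ^- 2)%:E * int2R (cell e x) (fun y => f y ^+ 2)%R + d%:E)%E.
Proof.
move=> tf e0 d0.
have [B B0 hB] := test_fun_bounded tf.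
have [L L0 hL] := test_fun_lipschitz tf.
(* Over one mesh, f^2 varies by at most 2 B times 2 L eta, which is K eta / 2 and has to be at most
   d / 2. *)
pose K := 8 * B * L; have K0 : 0 < K by rewrite !mulr_gt0.
exists (Num.Def.archi_bound (e * K / d)) => N x hN.
have N0 : (0 < N)%N by exact: leq_ltn_trans hN.
have n0 : 0 < N%:R :> R by rewrite ltr0n.
set eta := e / N%:R; have eta0 : 0 < eta by rewrite divr_gt0.
have etaK : K * eta <= d.
  have : e * K / d < N%:R.
    apply: (lt_trans (archi_boundP _)); last by rewrite ltr_nat.
    by rewrite divr_ge0 ?mulr_ge0 ?ltW.
  rewrite ltr_pdivrMr// => h; rewrite /eta mulrA ler_pdivrMr// mulrC mulrC.
  by rewrite (mulrC K) [d * _]mulrC ltW.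
have cf2 : continuous (fun y => f y ^+ 2).
  move=> y; rewrite (_ : (fun y => f y ^+ 2) = (fun y => f y * f y)); last first.
    by apply/funext => z; rewrite expr2.
  by apply: cvgM; exact: test_fun_continuous.
have osc y z : `|y.1 - z.1| <= eta -> `|y.2 - z.2| <= eta -> f y ^+ 2 <= f z ^+ 2 + d / 2.
  move=> h1 h2; rewrite -lerBlDl.
  have -> : f y ^+ 2 - f z ^+ 2 = (f y - f z) * (f y + f z) by ring.
  apply: (le_trans (ler_norm _)); rewrite normrM.
  apply: (@le_trans _ _ ((L * (eta + eta)) * (B + B))).
    apply: ler_pM => //.
      apply: (le_trans (hL _ _)); rewrite ler_wpM2l ?(ltW L0)//; exact: lerD.
    by apply: (le_trans (ler_normD _ _)); exact: lerD.
  by move: etaK; rewrite /K; lra.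
have := @riemann_sum2_le R (fun y => f y ^+ 2) x eta (d / 2) N eta0 _ cf2 (fun y => sqr_ge0 _) osc.
have -> : N%:R * eta = e by rewrite /eta; field; rewrite gt_eqF.
have d20 : 0 <= d / 2 by rewrite divr_ge0// ltW.
move=> /(_ d20) h.
have mc := measurable_cell e x.
have mf : mfun2 (cell e x) (fun y => f y ^+ 2).
  apply: (@mfun2_sub _ _ setT) => //; apply: continuous_on_measurable => [|y _].
    exact: openT.
  exact: cf2.
have E : int2R (cell e x) (fun y => f y ^+ 2 + 2 * (d / 2)) =
  (int2R (cell e x) (fun y => f y ^+ 2)%R + (d * e ^+ 2)%:E)%E.
  have mcst : mfun2 (cell e x) (cst (2 * (d / 2))) by exact: measurable_cst.
  have d0' : forall y, cell e x y -> 0 <= cst (2 * (d / 2)) y by move=> y _; rewrite mulr_ge0.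
  rewrite (int2D mc mf mcst (fun y _ => sqr_ge0 _) d0').
  by rewrite (int2_cell_cst x _ e0) (_ : 2 * (d / 2) = d)//; field.
rewrite -/(cell e x) E in h.
apply: (@le_trans _ _ ((e ^- 2)%:E * (int2R (cell e x) (fun y => f y ^+ 2)%R + (d * e ^+ 2)%:E))%E).
  apply: (@le_trans _ _ ((e ^- 2)%:E * (eta ^+ 2 * \sum_(i < N) \sum_(j < N)
     f (x.1 - i%:R * eta, x.2 - j%:R * eta) ^+ 2)%:E)%E); last first.
    by apply: lee_wpmul2l => //; rewrite lee_fin invr_ge0 sqr_ge0.
  rewrite -EFinM lee_fin.
  apply: (le_trans (mean_sqr_le _ _ _ N0)).
  apply: (le_trans (mean_le _ _ _ (fun y => mean_sqr_le (vstep eta) f y N0))).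
  rewrite /mean mulr_sumr le_eqVlt; apply/orP; left; apply/eqP.
  rewrite !mulr_sumr; apply: eq_bigr => i _.
  rewrite /translate /= !mulr_sumr; apply: eq_bigr => j _.
  rewrite !subr0 !mulrA; congr (_ * _).
  by rewrite /eta; field; rewrite !gt_eqF.
rewrite ge0_muleDr; last 2 first.
- by apply: int2_ge0 => y _; exact: sqr_ge0.
- by rewrite lee_fin mulr_ge0 ?sqr_ge0// ltW.
rewrite leeD2l// -EFinM lee_fin mulrCA mulVf ?mulr1//.
by rewrite expf_neq0// gt_eqF.
Qed.

(** The cell lies at height at most 2e, so there f^2 is at most (2e)^2 times the Hardy integrand,
    and Hardy's constant 4 completes the factor 16. The part of the cell below the boundary does not
    contribute. *)
Lemma int2_cell_boundary f (e : R) x (c : R) : test_fun f -> 0 < e -> x.2 <= 2 * e ->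
  (int2R H (fun y => partial ord_max f y ^+ 2) <= c%:E)%E ->
  (int2R (cell e x) (fun y => f y ^+ 2)%R <= (16 * e ^+ 2 * c)%:E)%E.
Proof.
move=> tf e0 xe hc.
have mH := @measurable_halfplane R; have mc := measurable_cell e x.
have mI : measurable (cell e x `&` H : set (plane R)) by exact: measurableI.
have mf : mfun2 setT (fun y => f y ^+ 2).
  apply: mfun2_sqr; apply: continuous_on_measurable => [|y _]; first exact: openT.
  exact: test_fun_continuous.
have mV : mfun2 H (fun y => f y ^+ 2 / y.2 ^+ 2).
  apply: continuous_on_measurable; first exact: open_halfplane.
  move=> y y0; apply: (Ck_cont (n := 0)) y0; apply: (@CkM _ _ _ (f ^+ 2) (fun y => (y.2 ^+ 2)^-1)).
  - exact: open_halfplane.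
  - by apply: CkX; [exact: open_halfplane | apply: Ck_sub (test_fun_Ck tf 0)].
  - exact: Ck_heightV.
have V0 y : H y -> 0 <= f y ^+ 2 / y.2 ^+ 2 by move=> _; rewrite divr_ge0// sqr_ge0.
have -> : int2R (cell e x) (fun y => f y ^+ 2) = int2R (cell e x `&` H) (fun y => f y ^+ 2).
  rewrite int2_setI // /int2; apply: eq_integral => y _; rewrite patchE.
  by case: ifPn => //; rewrite notin_setE => yH; rewrite test_fun_off// expr0n.
have e2 : 0 <= (2 * e) ^+ 2 by exact: sqr_ge0.
apply: (@le_trans _ _ (int2R (cell e x `&` H) (fun y => (2 * e) ^+ 2 * (f y ^+ 2 / y.2 ^+ 2)))).
  apply: int2_le => //.
  - exact: mfun2_sub mf.
  - by apply: measurable_funM => //; exact: mfun2_sub mV.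
  move=> y [[_]]; rewrite /= in_itv /= => /andP[_ y2] y0; rewrite sqr_ge0 /=.
  rewrite mulrCA ler_peMr ?sqr_ge0// ler_pdivlMr ?exprn_gt0// mul1r.
  rewrite lerXn2r ?nnegrE ?(ltW y0) ?mulr_ge0 ?(ltW e0)//.
  exact: le_trans xe.
apply: (@le_trans _ _ (int2R H (fun y => (2 * e) ^+ 2 * (f y ^+ 2 / y.2 ^+ 2)))).
  apply: int2_sub => //; first by apply: measurable_funM.
  by move=> y yH; rewrite mulr_ge0// V0.
rewrite int2Z //.
rewrite (_ : 16 * e ^+ 2 * c = (2 * e) ^+ 2 * (4 * c)); last by ring.
rewrite [leRHS]EFinM; apply: lee_wpmul2l; first by rewrite lee_fin.
apply: (le_trans (hardy_inequality tf)); rewrite EFinM.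
by apply: lee_wpmul2l.
Qed.

(** The cell lies at height at least x_2 - e >= x_2 / 2, whence v^2 <= 4 C0 / x_2^2 almost
    everywhere on it; the remaining factors 2 come from f^2 <= 2 v^2 + 2 (f - v)^2. *)
Lemma int2_cell_interior f v (e : R) x (C0 c : R) (K : set (R * R)) : test_fun f -> mfun2 H v ->
  0 < e -> 2 * e < x.2 -> measurable (K : set (plane R)) -> K `<=` H -> cell e x `<=` K ->
  {ae @lebesgue2 R, forall y, H y -> v y ^+ 2 <= C0 / y.2 ^+ 2} -> 0 <= C0 ->
  (int2R K (fun y => (f y - v y) ^+ 2) <= c%:E)%E ->
  (int2R (cell e x) (fun y => f y ^+ 2)%R <= (8 * C0 / x.2 ^+ 2 * e ^+ 2 + 2 * c)%:E)%E.
Proof.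
move=> tf mv e0 xe mK KH cK hv C00 hc.
have mH := @measurable_halfplane R; have mc := measurable_cell e x.
have x0 : 0 < x.2 by apply: le_lt_trans xe; rewrite mulr_ge0// ltW.
have cH : cell e x `<=` H by move=> y /cK /KH.
have mf := test_fun_mfun2 tf.
have mvc : mfun2 (cell e x) v by exact: mfun2_sub mv.
have mfc : mfun2 (cell e x) f by exact: mfun2_sub mf.
have md : mfun2 (cell e x) (fun y => (f y - v y) ^+ 2).
  by apply: mfun2_sqr; exact: measurable_funB.
have mdK : mfun2 K (fun y => (f y - v y) ^+ 2).
  by apply: mfun2_sqr; apply: measurable_funB; [exact: mfun2_sub mf | exact: mfun2_sub mv].
have mvs : mfun2 (cell e x) (fun y => v y ^+ 2) by exact: mfun2_sqr.
have m1 : mfun2 (cell e x) (fun y => 2 * v y ^+ 2) by exact: measurable_funM.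
have m2 : mfun2 (cell e x) (fun y => 2 * (f y - v y) ^+ 2) by exact: measurable_funM.
have sq (u : R * R -> R) : forall y, cell e x y -> 0 <= u y ^+ 2 by move=> y _; exact: sqr_ge0.
have sq2 (u : R * R -> R) : forall y, cell e x y -> 0 <= 2 * u y ^+ 2.
  by move=> y _; rewrite mulr_ge0// sqr_ge0.
apply: (@le_trans _ _ (int2R (cell e x) (fun y => 2 * v y ^+ 2 + 2 * (f y - v y) ^+ 2))).
  apply: int2_le => //; first exact: mfun2_sqr.
    exact: measurable_funD.
  move=> y _; rewrite sqr_ge0 /=; have := sqr_ge0 (f y - 2 * v y); lra.
rewrite int2D//; [|exact: sq2|exact: (sq2 (fun y => f y - v y))].
rewrite EFinD; apply: leeD; last first.
  rewrite int2Z//; last exact: (sq (fun y => f y - v y)).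
  rewrite EFinM; apply: lee_wpmul2l => //; apply: le_trans hc.
  by apply: int2_sub => // y _; exact: sqr_ge0.
have -> : 8 * C0 / x.2 ^+ 2 * e ^+ 2 = (2 * (4 * C0 / x.2 ^+ 2)) * e ^+ 2 by ring.
rewrite -(int2_cell_cst x _ e0).
have k0 : 0 <= 2 * (4 * C0 / x.2 ^+ 2).
  by rewrite !mulr_ge0// invr_ge0 sqr_ge0.
apply: (int2_ae_le mc m1 _ (sq2 v)) => //.
  exact: measurable_cst.
have aeF : Filter (almost_everywhere (@lebesgue2 R)) by exact: ae_filter_ringOfSetsType.
apply: filterS hv => y hy [yc1 yc2].
have /hy vy : H y by apply: cH; split.
rewrite ler_wpM2l//; apply: (le_trans vy).
have y2 : x.2 / 2 <= y.2.
  by move: yc2; rewrite /= in_itv /= => /andP[h _]; apply: le_trans h; lra.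
have y0 : 0 < y.2 by apply: lt_le_trans y2; rewrite divr_gt0.
rewrite mulrAC [leRHS]mulrC ler_wpM2l//.
rewrite -[4]invrK -invfM lef_pV2 ?posrE ?exprn_gt0 ?mulr_gt0 ?invr_gt0 ?exprn_gt0//.
rewrite (_ : 4^-1 * x.2 ^+ 2 = (x.2 / 2) ^+ 2); last by field.
have x20 : 0 < x.2 / 2 by rewrite divr_gt0.
by rewrite lerXn2r ?nnegrE// ltW.
Qed.

End Averaging.

(** * Cutting off a solenoidal field at infinity *)

Section CutoffField.
Variable R : realType.
Local Notation H := (@halfplane R).
Local Notation o := (ord0 : 'I_2).
Local Notation l := (ord_max : 'I_2).

(** With S the stream function and g = S^2 / x_2^3, the defect f1^2 / x_2^2 - d_2 g - S^2 / x_2^4 is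
    the sum of the squares of f1 / x_2 - S / x_2^2 and of S / x_2^2. Followed by Hardy's inequality
    for f1, this bounds S by the gradient of the field. *)
Lemma hardy_stream (f1 f2 : R * R -> R) : test_fun f1 -> test_fun f2 ->
  (forall x, halfplane x -> partial o f1 x + partial l f2 x = 0) ->
  (int2R H (fun x => stream f1 x ^+ 2 / x.2 ^+ 4) <=
   int2R H (fun x => f1 x ^+ 2 / x.2 ^+ 2))%E.
Proof.
move=> tf1 tf2 div0; have oH := @open_halfplane R.
have [P [a [P0 a0 sf]]] := test_fun_supp tf1.
pose S := stream f1.
have CS : Ck H 0 S by apply: Ck_sub (Ck_stream tf1 tf2 div0 0).
have C1 : Ck H 0 f1 by apply: Ck_sub (test_fun_Ck tf1 0).
have CV := @Ck_heightV R.
pose g x := S x ^+ 2 * (x.2 ^+ 3)^-1.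
pose dg x := 2 * S x * f1 x / x.2 ^+ 3 - 3 * (S x ^+ 2 / x.2 ^+ 4).
apply: (@int2_le_vertical R _ _ g dg a a0).
- by apply: Ck_cont; apply: (@CkM _ _ _ (S ^+ 2)) => //; exact: CkX.
- by apply: Ck_cont; apply: (@CkM _ _ _ (f1 ^+ 2)) => //; exact: CkX.
- apply: (@Ck_cont _ _ 0); apply: (@CkD _ _ _ (cst 2 * S * f1 * (fun x => (x.2 ^+ 3)^-1))
    (- (cst 3 * (S ^+ 2 * (fun x => (x.2 ^+ 4)^-1))))) => //.
    by apply: CkM => //; apply: CkM => //; apply: CkM => //; exact: Ck_cst.
  apply: CkN => //; apply: CkM => //; first exact: Ck_cst.
  by apply: CkM => //; exact: CkX.
- move=> x x0; have xn : x.2 != 0 by rewrite gt_eqF.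
  have dS := is_derive_stream2 tf1 x.
  have dx := @is_derive_coord R l l x.
  have hV : is_derive x.2 (1 : R) (fun t : R => t^-1) (- x.2 ^- 2).
    have := @is_deriveV R id x.2 1 1 xn (is_derive_id _ _).
    by apply: is_derive_val; rewrite /GRing.scale /= mulr1.
  have dV : is_derive x (unit_dir R l) (fun x : R * R => x.2^-1) (- x.2 ^- 2).
    have := @is_derive_comp2 R (fun t => t^-1) snd x l _ 1 hV dx.
    by apply: is_derive_val; rewrite mulr1.
  have := is_deriveM (is_deriveM dS dS) (is_deriveM dV (is_deriveM dV dV)).
  rewrite (_ : _ * _ = g); last first.
    by apply/funext => y; rewrite /g -exprVn expr2 [_ ^+ 3]exprS expr2.
  apply: is_derive_val; rewrite /dg /S /GRing.scale /=.
  rewrite -[(stream f1 * stream f1) x]/(stream f1 x * stream f1 x).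
  rewrite -[((fun x : R * R => x.2^-1) * (fun x : R * R => x.2^-1)) x]/(x.2^-1 * x.2^-1).
  rewrite -[((fun x : R * R => x.2^-1) * ((fun x : R * R => x.2^-1) * (fun x : R * R => x.2^-1))) x]/(x.2^-1 * (x.2^-1 * x.2^-1)).
  by field.
- move=> x x0; have xn : x.2 != 0 by rewrite gt_eqF.
  rewrite divr_ge0 ?sqr_ge0 ?exprn_ge0 ?(ltW x0)//= -subr_ge0.
  have -> : f1 x ^+ 2 / x.2 ^+ 2 - dg x - stream f1 x ^+ 2 / x.2 ^+ 4 =
             (f1 x / x.2 - S x / x.2 ^+ 2) ^+ 2 + (S x / x.2 ^+ 2) ^+ 2.
    by rewrite /dg /S; field.
  by rewrite addr_ge0// sqr_ge0.
- by move=> x _; rewrite divr_ge0 ?sqr_ge0.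
- by move=> x x0; rewrite mulr_ge0 ?sqr_ge0// invr_ge0 exprn_ge0// ltW.
- move=> x x0 xa; rewrite /g /S (stream_supp a0 sf)//.
  by rewrite expr0n !mul0r.
Qed.

Definition field_of (F : 'I_2 -> R * R -> R) (x : R * R) : 'rV[R]_2 := \row_i F i x.

Lemma component_field_of F i : component i (field_of F) = F i.
Proof. by apply/funext => x; rewrite /component mxE. Qed.

Definition div_free (F : 'I_2 -> R * R -> R) :=
  (forall i, test_fun (F i)) /\
  (forall x, H x -> partial o (F o) x + partial l (F l) x = 0).

Lemma sum2E (u : 'I_2 -> R) : \sum_i u i = u o + u l.
Proof. by rewrite big_ord_recl big_ord1; congr (_ + u _); exact: val_inj. Qed.

Lemma field_of_divfree F : div_free F -> test_field_divfree (field_of F).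
Proof.
case=> tF dF; split=> [i|x xH]; first by rewrite component_field_of.
by rewrite sum2E !component_field_of; exact: dF.
Qed.

Lemma divfree_components phi : test_field_divfree phi -> div_free (fun i => @component R i phi).
Proof.
by case=> tF dF; split=> // x xH; rewrite -[RHS](dF x xH) sum2E.
Qed.

Definition other (i : 'I_2) : 'I_2 := if i == o then l else o.
Definition osign (i : 'I_2) : R := if i == o then 1 else -1.

(* The rotated gradient of [chi * stream (F ord0)]. *)
Definition cut (lam : R) (F : 'I_2 -> R * R -> R) (i : 'I_2) (x : R * R) : R :=
  chi lam x * F i x + osign i * (stream (F o) x * dchi lam (other i) x).

Definition dstream (F : 'I_2 -> R * R -> R) (j : 'I_2) (x : R * R) : R :=
  if j == o then - F l x else F o x.

Definition energy (F : 'I_2 -> R * R -> R) (x : R * R) : R :=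
  \sum_i \sum_j partial j (F i) x ^+ 2.

Definition denergy (F G : 'I_2 -> R * R -> R) (x : R * R) : R :=
  \sum_i \sum_j (partial j (F i) x - partial j (G i) x) ^+ 2.

Section Fixed.
Variables (lam : R) (F : 'I_2 -> R * R -> R).
Hypotheses (lam1 : 1 <= lam) (dF : div_free F).

Let lam0 : 0 < lam. Proof. by apply: lt_le_trans lam1. Qed.
Let tF i : test_fun (F i). Proof. by case: dF. Qed.
Let dF0 x : H x -> partial o (F o) x + partial l (F l) x = 0.
Proof. by case: dF => _; exact. Qed.

Lemma is_derive_stream j x : is_derive x (unit_dir R j) (stream (F o)) (dstream F j x).
Proof.
case: (ord2_cases j) => -> /=; rewrite /dstream /=.
  exact: (is_derive_stream1 (tF o) (tF l) dF0).
exact: is_derive_stream2.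
Qed.

Lemma is_derive_cut i j x : H x -> is_derive x (unit_dir R j) (cut lam F i)
  (chi lam x * partial j (F i) x + dchi lam j x * F i x +
   osign i * (dstream F j x * dchi lam (other i) x +
              stream (F o) x * d2chi lam j (other i) x)).
Proof.
move=> xH.
have h1 := is_deriveM (is_derive_chi j lam0 xH) (test_fun_derive j x (tF i)).
have h2 := is_deriveM (is_derive_stream j x) (is_derive_dchi j (other i) lam0 xH).
have h3 := is_deriveM (is_derive_cst (osign i : R) x (unit_dir R j)) h2.
have := is_deriveD h1 h3.
by apply: is_derive_val; rewrite scaler0 addr0 /GRing.scale /=; ring.
Qed.

(** Links the box of half-width exp (3 lam), in which supports and pointwise bounds are expressed,
    to the Euclidean radius at which chi vanishes. *)
Lemma large_rho x : H x -> expR (3 * lam) < `|x.1| \/ expR (3 * lam) < x.2 ->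
  expR (6 * lam) <= rho x.
Proof.
move=> x0; have -> : expR (6 * lam) = expR (3 * lam) ^+ 2.
  by rewrite expr2 -expRD; congr expR; ring.
have e0 := expR_ge0 (3 * lam); rewrite /rho.
case=> h.
  apply: (@le_trans _ _ (`|x.1| ^+ 2)); last by rewrite real_normK ?num_real// lerDl sqr_ge0.
  by rewrite lerXn2r ?nnegrE// ltW.
apply: (@le_trans _ _ (x.2 ^+ 2)); last by rewrite lerDr sqr_ge0.
by rewrite lerXn2r ?nnegrE// ltW.
Qed.

(** The support is bounded because chi vanishes far away, and it avoids the boundary because [F] and
    its stream function both vanish at small heights. In the divergence, what the symmetry of the
    Hessian of chi leaves over is chi times the divergence of [F]. *)
Lemma cut_divfree : div_free (fun i x => if 0 < x.2 then cut lam F i x else 0).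
Proof.
have oH := @open_halfplane R.
have hE i x : H x -> cut lam F i x = (if 0 < x.2 then cut lam F i x else 0).
  by move=> ->.
have [P0 [a0 [P0p a0p s0]]] := test_fun_supp (tF o).
have [P1 [a1 [P1p a1p s1]]] := test_fun_supp (tF l).
have a0' : 0 < Num.min a0 a1 by rewrite lt_min a0p.
have tests i : test_fun (fun x => if 0 < x.2 then cut lam F i x else 0).
  apply: (@test_fun_intro _ (expR (3 * lam)) _ _ a0').
    move=> n; apply: (Ck_ext oH (hE i)).
    apply: (@CkD _ _ _ (chi lam * F i)
      (cst (osign i) * (stream (F o) * dchi lam (other i)))) => //.
      by apply: CkM => //; [exact: Ck_chi | apply: Ck_sub (test_fun_Ck (tF i) n)].
    apply: CkM => //; first exact: Ck_cst.
    apply: CkM => //; last exact: Ck_dchi.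
    by apply: Ck_sub (Ck_stream (tF o) (tF l) dF0 n).
  move=> x ox; case: ifPn => // x0; rewrite /cut.
  case: ox => [xa|ox].
    move: xa; rewrite lt_min => /andP[xa0 xa1].
    rewrite (stream_supp a0p s0)// mul0r mulr0 addr0.
    by case: (ord2_cases i) => ->; [rewrite s0 ?mulr0//; left | rewrite s1 ?mulr0//; left].
  have [-> ->] := chi_eq0 lam0 x0 (large_rho x0 ox).
  by rewrite mul0r !mulr0 addr0.
split=> // x xH.
have pE i j : partial j (fun x => if 0 < x.2 then cut lam F i x else 0) x = partial j (cut lam F i) x.
  apply: near_eq_derive; apply: (near_eq_of_open oH xH) => y yH.
  by rewrite -hE.
rewrite !pE (partialE (is_derive_cut o o xH)) (partialE (is_derive_cut l l xH)).
rewrite /dstream /osign /other /= (d2chi_sym lam l o).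
by have := dF0 xH; set p := partial o _ x; set r := partial l _ x => e;
  have -> : p = - r by [lra]; ring.
Qed.

Section Bounds.
Variable C : R.
Hypothesis C1 : 1 <= C.
Hypothesis hC : forall lam x, 1 <= lam -> H x ->
  [/\ `|chi lam x| <= C, forall j, `|dchi lam j x| <= C / lam / x.2 &
      forall k j, `|d2chi lam k j x| <= 4 * C / lam / x.2 ^+ 2].

Lemma normr_osign i : `|osign i| = 1.
Proof. by rewrite /osign; case: ifP => _; rewrite ?normrN1 ?normr1. Qed.

(** The factor lam in the bound of the stream function cancels the 1/lam in the gradient of chi. Of
    the constant 6, one unit is chi F and five come from the stream function. *)
Lemma cut_le (M e : R) x i : H x -> 0 <= M -> 0 < e -> e <= 1 -> expR (- lam) <= e ->
  (forall y, H y -> `|y.1| <= expR (3 * lam) -> y.2 <= expR (3 * lam) ->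
     forall i, `|F i y| <= M / (y.2 + e)) ->
  `|cut lam F i x| <= 6 * C * M / x.2.
Proof.
move=> xH M0 e0 e1 le hF.
have x0 : 0 < x.2 by [].
have C0 : 0 <= C by apply: le_trans C1.
have [ox|/not_orP[/negP x1 /negP x2]] :=
    pselect (expR (3 * lam) < `|x.1| \/ expR (3 * lam) < x.2).
  rewrite /cut; have [-> ->] := chi_eq0 lam0 xH (large_rho xH ox).
  by rewrite mul0r !mulr0 addr0 normr0 divr_ge0 ?mulr_ge0// ltW.
rewrite -!leNgt in x1 x2.
have [hc hd _] := hC lam1 xH.
have hS : `|stream (F o) x| <= 5 * M * lam.
  apply: (le_trans (@stream_le _ _ (tF o) x M e x0 e0 M0 _)).
    move=> s /andP[s0 s1]; apply: (hF (x.1, s)) => //=.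
    exact: le_trans x2.
  rewrite -mulrA mulrCA ler_wpM2l//.
  (* Together with - ln e <= lam this gives 4 lam + 1, at most 5 lam since 1 <= lam. *)
  have h1 : ln (x.2 + e) <= 3 * lam + 1.
    rewrite -[leRHS]expRK ler_ln ?posrE ?expR_gt0 ?addr_gt0//.
    rewrite expRD; have E1 : 2 <= expR 1 :> R by have := expR_ge1Dx (1 : R); lra.
    have E3 : 1 <= expR (3 * lam).
      by apply: le_trans (expR_ge1Dx (3 * lam)); rewrite lerDl mulr_ge0// ltW.
    apply: (@le_trans _ _ (expR (3 * lam) * 2)); first lra.
    by rewrite ler_wpM2l ?expR_ge0.
  have h2 : - lam <= ln e by rewrite -[leLHS]expRK ler_ln ?posrE ?expR_gt0.
  by have l1 := lam1; lra.
have hFx : `|F i x| <= M / x.2.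
  apply: (le_trans (hF x xH x1 x2 i)); rewrite ler_wpM2l// lef_pV2 ?posrE ?addr_gt0//.
  by rewrite lerDl ltW.
rewrite /cut; apply: (le_trans (ler_normD _ _)).
have -> : 6 * C * M / x.2 = C * (M / x.2) + (5 * M * lam) * (C / lam / x.2).
  by field; rewrite !gt_eqF.
apply: lerD; first by rewrite normrM ler_pM.
by rewrite normrM normr_osign mul1r normrM ler_pM.
Qed.

Lemma sqr_le4 (T a b c d : R) : `|T| <= a + b + c + d ->
  T ^+ 2 <= 4 * (a ^+ 2 + b ^+ 2 + c ^+ 2 + d ^+ 2).
Proof.
move=> h; rewrite -real_normK ?num_real//.
apply: (@le_trans _ _ ((a + b + c + d) ^+ 2)).
  by rewrite lerXn2r ?nnegrE//; apply: le_trans h.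
have := sqr_ge0 (a - b); have := sqr_ge0 (a - c); have := sqr_ge0 (a - d).
have := sqr_ge0 (b - c); have := sqr_ge0 (b - d); have := sqr_ge0 (c - d); lra.
Qed.

(** Apart from chi times the difference of the gradients, the product rule leaves three terms with
    derivatives of chi. Each has a factor 1/lam and a weight for which a Hardy inequality is
    available. *)
Lemma cut_partial_le (G : 'I_2 -> R * R -> R) i j x : H x ->
  (expR (2 * lam) < rho x -> partial j (G i) x = 0) ->
  (partial j (cut lam F i) x - partial j (G i) x) ^+ 2 <=
  4 * C ^+ 2 * (partial j (F i) x - partial j (G i) x) ^+ 2 +
  (C / lam) ^+ 2 * (8 * (F o x ^+ 2 / x.2 ^+ 2) + 8 * (F l x ^+ 2 / x.2 ^+ 2) +
                    64 * (stream (F o) x ^+ 2 / x.2 ^+ 4)).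
Proof.
move=> xH hG; have x0 : 0 < x.2 by [].
have [hc hd hdd] := hC lam1 xH.
have C0 : 0 <= C by apply: le_trans C1.
pose b := C / lam / x.2.
have b0 : 0 <= b by rewrite !divr_ge0// ltW.
(* Where chi may differ from 1 the derivative of [G] is zero, so it can be multiplied by chi at no
   cost. *)
have hG' : partial j (G i) x = chi lam x * partial j (G i) x.
  have [h|h] := leP (rho x) (expR (2 * lam)); first by rewrite chi_eq1// mul1r.
  by rewrite hG// mulr0.
rewrite (partialE (is_derive_cut i j xH)).
pose A := partial j (F i) x - partial j (G i) x.
pose T := chi lam x * A + dchi lam j x * F i x +
   osign i * (dstream F j x * dchi lam (other i) x + stream (F o) x * d2chi lam j (other i) x).
rewrite (_ : _ - _ = T); last first.
  by rewrite /T /A mulrBr -hG'; ring.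
have hT : `|T| <= C * `|A| + b * `|F i x| + b * `|dstream F j x| +
    (4 * b / x.2) * `|stream (F o) x|.
  rewrite /T -!addrA; apply: (le_trans (ler_normD _ _)); apply: lerD.
    by rewrite normrM ler_wpM2r.
  apply: (le_trans (ler_normD _ _)); apply: lerD.
    by rewrite normrM ler_wpM2r// hd.
  rewrite normrM normr_osign mul1r; apply: (le_trans (ler_normD _ _)); apply: lerD.
    by rewrite normrM mulrC ler_wpM2r// hd.
  rewrite normrM mulrC ler_wpM2r//; apply: (le_trans (hdd _ _)).
  by rewrite /b expr2 invfM le_eqVlt; apply/orP; left; apply/eqP; ring.
apply: (le_trans (sqr_le4 hT)).
have sqM (u w : R) : (u * `|w|) ^+ 2 = u ^+ 2 * w ^+ 2.
  by rewrite exprMn real_normK ?num_real.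
rewrite !sqM.
have f2 k : F k x ^+ 2 <= F o x ^+ 2 + F l x ^+ 2.
  by case: (ord2_cases k) => ->; rewrite ?lerDl ?lerDr sqr_ge0.
have s2 : dstream F j x ^+ 2 <= F o x ^+ 2 + F l x ^+ 2.
  by rewrite /dstream; case: ifP => _; rewrite ?sqrrN f2.
have b2 : 0 <= b ^+ 2 by exact: sqr_ge0.
apply: (@le_trans _ _ (4 * C ^+ 2 * A ^+ 2 + b ^+ 2 *
    (8 * (F o x ^+ 2 + F l x ^+ 2) + 64 * (stream (F o) x ^+ 2 / x.2 ^+ 2)))).
  have h1 := ler_wpM2l b2 (f2 i); have h2 := ler_wpM2l b2 s2.
  have -> : (4 * b / x.2) ^+ 2 * stream (F o) x ^+ 2 =
    16 * (b ^+ 2 * (stream (F o) x ^+ 2 / x.2 ^+ 2)) by field; rewrite gt_eqF.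
  move: h1 h2; set X := b ^+ 2 * F i x ^+ 2; set Y := b ^+ 2 * dstream F j x ^+ 2.
  set Z := stream (F o) x ^+ 2 / x.2 ^+ 2; set W := F o x ^+ 2 + F l x ^+ 2; lra.
rewrite le_eqVlt; apply/orP; left; apply/eqP; rewrite /b /A.
by field; rewrite !gt_eqF.
Qed.

(** Over the four entries the weighted integrals get the coefficients 32, 32 and 256. Each integral
    is at most 4 g by Hardy's inequalities, and 4 times 320 is 1280. *)
Lemma int2_cut_denergy (G : 'I_2 -> R * R -> R) (a g : R) :
  (forall i, test_fun (G i)) ->
  (forall i j x, H x -> expR (2 * lam) < rho x -> partial j (G i) x = 0) ->
  (int2R H (denergy F G) <= a%:E)%E -> (int2R H (energy F) <= g%:E)%E ->
  (int2R H (denergy (cut lam F) G) <= (4 * C ^+ 2 * a + 1280 * (C / lam) ^+ 2 * g)%:E)%E.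
Proof.
move=> tG hG ha hg.
have oH := @open_halfplane R; have mH := @measurable_halfplane R.
have cV (n : nat) (u : R * R -> R) : Ck H 0 u -> Ck H 0 (fun x => u x ^+ 2 / x.2 ^+ n).
  move=> Cu; apply: (@CkM _ _ _ (u ^+ 2) (fun x => (x.2 ^+ n)^-1)) => //; first exact: CkX.
  exact: Ck_heightV.
pose U0 x := F o x ^+ 2 / x.2 ^+ 2; pose U1 x := F l x ^+ 2 / x.2 ^+ 2.
pose V x := stream (F o) x ^+ 2 / x.2 ^+ 4.
have mU0 : mfun2 H U0 by apply: (@Ck_measurable _ _ 0) => //; apply: cV; apply: Ck_sub (test_fun_Ck (tF o) 0).
have mU1 : mfun2 H U1 by apply: (@Ck_measurable _ _ 0) => //; apply: cV; apply: Ck_sub (test_fun_Ck (tF l) 0).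
have mV : mfun2 H V.
  apply: (@Ck_measurable _ _ 0) => //; apply: cV.
  by apply: Ck_sub (Ck_stream (tF o) (tF l) dF0 0).
have nn n (u : R * R -> R) x : H x -> 0 <= u x ^+ 2 / x.2 ^+ n.
  by move=> x0; rewrite divr_ge0 ?sqr_ge0 ?exprn_ge0// ltW.
have pmf i j : mfun2 H (partial j (F i)) by apply: test_fun_mfun2; exact: test_fun_partial.
have pmG i j : mfun2 H (partial j (G i)) by apply: test_fun_mfun2; exact: test_fun_partial.
have mE : mfun2 H (energy F).
  apply: measurable_sum => i; apply: measurable_sum => j; exact: mfun2_sqr.
have mA : mfun2 H (denergy F G).
  apply: measurable_sum => i; apply: measurable_sum => j; apply: mfun2_sqr.
  by apply: measurable_funB; [exact: pmf | exact: pmG].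
have E0 x : 0 <= energy F x by do 2 (apply: sumr_ge0 => ? _); exact: sqr_ge0.
have A0 x : 0 <= denergy F G x by do 2 (apply: sumr_ge0 => ? _); exact: sqr_ge0.
have pE i : (int2R H (fun x => partial l (F i) x ^+ 2) <= g%:E)%E.
  apply: le_trans hg; apply: int2_le => //; first exact: mfun2_sqr.
  by move=> x _; rewrite sqr_ge0 /=; exact: (sum_sqr_entry (fun i j => partial j (F i) x)).
have hU i : (int2R H (fun x => F i x ^+ 2 / x.2 ^+ 2) <= (4 * g)%:E)%E.
  by apply: (le_trans (hardy_inequality (tF i))); rewrite EFinM; apply: lee_wpmul2l.
have hV : (int2R H V <= (4 * g)%:E)%E.
  exact: le_trans (hardy_stream (tF o) (tF l) dF0) (hU o).
pose k := (C / lam) ^+ 2; have k0 : 0 <= k by exact: sqr_ge0.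
have C20 : 0 <= 4 * C ^+ 2 by rewrite mulr_ge0// sqr_ge0.
have m2 : mfun2 H (fun x => 32 * k * U0 x) by exact: measurable_funM.
have m3 : mfun2 H (fun x => 32 * k * U1 x) by exact: measurable_funM.
have m4 : mfun2 H (fun x => 256 * k * V x) by exact: measurable_funM.
have m1 : mfun2 H (fun x => 4 * C ^+ 2 * denergy F G x) by exact: measurable_funM.
have k32 : 0 <= 32 * k by exact: mulr_ge0 (ler0n _ _) k0.
have k256 : 0 <= 256 * k by exact: mulr_ge0 (ler0n _ _) k0.
have p1 x : H x -> 0 <= 4 * C ^+ 2 * denergy F G x by move=> _; rewrite mulr_ge0.
have p2 x : H x -> 0 <= 32 * k * U0 x by move=> xH; rewrite mulr_ge0// /U0 nn.
have p3 x : H x -> 0 <= 32 * k * U1 x by move=> xH; rewrite mulr_ge0// /U1 nn.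
have p4 x : H x -> 0 <= 256 * k * V x by move=> xH; rewrite mulr_ge0// /V nn.
have m12 : mfun2 H (fun x => 4 * C ^+ 2 * denergy F G x + 32 * k * U0 x) by exact: measurable_funD.
have m123 : mfun2 H (fun x => 4 * C ^+ 2 * denergy F G x + 32 * k * U0 x + 32 * k * U1 x) by exact: measurable_funD.
have p12 x : H x -> 0 <= 4 * C ^+ 2 * denergy F G x + 32 * k * U0 x.
  by move=> xH; rewrite addr_ge0 ?p1 ?p2.
have p123 x : H x -> 0 <= 4 * C ^+ 2 * denergy F G x + 32 * k * U0 x + 32 * k * U1 x.
  by move=> xH; rewrite addr_ge0 ?p12 ?p3.
apply: (@le_trans _ _ (int2R H (fun x => 4 * C ^+ 2 * denergy F G x + 32 * k * U0 x +
    32 * k * U1 x + 256 * k * V x))).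
  apply: int2_le => //.
  - apply: measurable_sum => i; apply: measurable_sum => j; apply: mfun2_sqr.
    apply: measurable_funB; last exact: pmG.
    have [tC _] := cut_divfree.
    have : mfun2 H (partial j (fun x => if 0 < x.2 then cut lam F i x else 0)).
      by apply: test_fun_mfun2; exact: test_fun_partial.
    apply: eq_measurable_fun => x /set_mem xH; apply: near_eq_derive.
    by apply: (near_eq_of_open oH xH) => y /= ->.
  - exact: measurable_funD.
  move=> x xH; apply/andP; split.
    by do 2 (apply: sumr_ge0 => ? _); exact: sqr_ge0.
  rewrite /denergy !sum2E.
  have h i j := cut_partial_le xH (hG i j x xH).
  apply: (le_trans (lerD (lerD (h o o) (h o l)) (lerD (h l o) (h l l)))).
  rewrite -/(U0 x) -/(U1 x) -/(V x) -/k le_eqVlt; apply/orP; left; apply/eqP; ring.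
rewrite (int2D mH m123 m4 p123 p4) (int2D mH m12 m3 p12 p3) (int2D mH m1 m2 p1 p2).
rewrite (int2Z mH mA (fun x _ => A0 x) C20) (int2Z mH mU0 (nn 2 _) k32).
rewrite (int2Z mH mU1 (nn 2 _) k32) (int2Z mH mV (nn 4 _) k256).
have -> : 4 * C ^+ 2 * a + 1280 * k * g = 4 * C ^+ 2 * a + 32 * k * (4 * g) +
  32 * k * (4 * g) + 256 * k * (4 * g) by ring.
rewrite !EFinD; apply: leeD; first apply: leeD; first apply: leeD.
- by rewrite [leRHS]EFinM; apply: lee_wpmul2l.
- by rewrite [leRHS]EFinM; apply: lee_wpmul2l => //; exact: hU.
- by rewrite [leRHS]EFinM; apply: lee_wpmul2l => //; exact: hU.
- by rewrite [leRHS]EFinM; apply: lee_wpmul2l.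
Qed.

End Bounds.
End Fixed.
End CutoffField.

(** * Norms and weights *)

Section L2Norms.
Variable R : realType.
Local Notation H := (@halfplane R).
Local Open Scope ereal_scope.

Definition fsq (m n : nat) (A : 'M[R]_(m, n)) : R := (\sum_i \sum_j A i j ^+ 2)%R.

Lemma fsq_ge0 m n (A : 'M[R]_(m, n)) : (0 <= fsq A)%R.
Proof. by do 2 (apply: sumr_ge0 => ? _); exact: sqr_ge0. Qed.

Lemma frob_sqr m n (A : 'M[R]_(m, n)) : (frob A ^+ 2 = fsq A)%R.
Proof. by rewrite sqr_sqrtr// fsq_ge0. Qed.

(** Norms are translated into integrals of squares, for which [int2] is additive; the triangle
    inequality is then paid with factors 2. *)
Lemma L2norm_sqr m n D (F : R * R -> 'M[R]_(m, n)) :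
  int2 D (fun x => fsq (F x)) = (L2norm D F) `^ 2.
Proof.
rewrite /L2norm (_ : 2%:E = (2%R : R)%:E) // poweR_Lnorm ?pnatr_eq0//.
rewrite /int2 [LHS]integral_mkcond; apply: eq_integral => x _.
rewrite !patchE; case: ifPn => _; last by rewrite abse0 poweR0r// pnatr_eq0.
by rewrite /= powR_mulrn ?normr_ge0// real_normK ?num_real// frob_sqr.
Qed.

Lemma L2norm_ge0 m n D (F : R * R -> 'M[R]_(m, n)) : 0 <= L2norm D F.
Proof. exact: Lnorm_ge0. Qed.

Lemma L2norm_leP m n D (F : R * R -> 'M[R]_(m, n)) (e : R) : (0 <= e)%R ->
  (L2norm D F <= e%:E) = (int2 D (fun x => fsq (F x)) <= (e ^+ 2)%:E).
Proof.
move=> e0; rewrite L2norm_sqr; have := L2norm_ge0 D F.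
case: (L2norm D F) => [r| |] //.
  rewrite lee_fin => r0; rewrite poweR_EFin powR_mulrn// !lee_fin.
  by rewrite ler_sqr ?nnegrE.
by move=> _; rewrite poweRyr ?pnatr_eq0// !leye_eq.
Qed.

Lemma L2norm_lty m n D (F : R * R -> 'M[R]_(m, n)) :
  (L2norm D F < +oo) = (int2 D (fun x => fsq (F x)) < +oo).
Proof.
rewrite L2norm_sqr; have := L2norm_ge0 D F.
case: (L2norm D F) => [r| |] //; first by rewrite poweR_EFin !ltry.
by rewrite poweRyr ?pnatr_eq0.
Qed.

Lemma ge0_cvg0P (u : nat -> \bar R) : (forall k, 0 <= u k) ->
  (u k @[k --> \oo] --> 0) <->
  (forall e : R, (0 < e)%R -> exists N, forall k, (N <= k)%N -> u k <= e%:E).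
Proof.
move=> u0; split.
  move=> cu e e0.
  have [[N1 _ h1] /cvgrPdist_le /(_ e e0) [N2 _ h2]] := (fine_cvgP _ _).1 cu.
  exists (maxn N1 N2) => k; rewrite geq_max => /andP[/h1 /= uf /h2 /=].
  by rewrite sub0r normrN ger0_norm ?fine_ge0// -lee_fin fineK.
move=> h; apply/fine_cvgP; split.
  have [N hN] := h 1%R ltr01; exists N => // k /hN /= uk.
  by rewrite fin_numElt (lt_le_trans _ (u0 k)) ?ltNy0// (le_lt_trans uk) ?ltry.
apply/cvgrPdist_le => e e0; have [N hN] := h e e0.
exists N => // k /hN /= uk; rewrite sub0r normrN.
have uf : u k \is a fin_num by rewrite fin_numElt (lt_le_trans _ (u0 k)) ?ltNy0// (le_lt_trans uk) ?ltry.
by rewrite ger0_norm ?fine_ge0// -lee_fin fineK.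
Qed.

Lemma L2norm_cvg0P m n D (F : nat -> R * R -> 'M[R]_(m, n)) :
  (L2norm D (F k) @[k --> \oo] --> 0) <->
  (forall e : R, (0 < e)%R -> exists N, forall k, (N <= k)%N ->
     int2 D (fun x => fsq (F k x)) <= e%:E).
Proof.
rewrite ge0_cvg0P; last by move=> k; exact: L2norm_ge0.
split=> h e e0.
  have se : (0 < Num.sqrt e)%R by rewrite sqrtr_gt0.
  have [N hN] := h _ se; exists N => k /hN.
  by rewrite L2norm_leP ?(ltW se)// sqr_sqrtr// ltW.
have [N hN] := h (e ^+ 2)%R (exprn_gt0 _ e0); exists N => k /hN.
by rewrite L2norm_leP// ltW.
Qed.

Lemma fsq_rV (v : 'rV[R]_2) : fsq v = (v ord0 ord0 ^+ 2 + v ord0 ord_max ^+ 2)%R.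
Proof. by rewrite /fsq big_ord1 sum2E. Qed.

Lemma fsq_M2 (A : 'M[R]_2) : fsq A =
  (A ord0 ord0 ^+ 2 + A ord0 ord_max ^+ 2 + (A ord_max ord0 ^+ 2 + A ord_max ord_max ^+ 2))%R.
Proof. by rewrite /fsq !sum2E. Qed.

Lemma mfun2_fsq m n D (F : R * R -> 'M[R]_(m, n)) :
  (forall i j, mfun2 D (fun x => F x i j)) -> mfun2 D (fun x => fsq (F x)).
Proof.
move=> mF; apply: measurable_sum => i; apply: measurable_sum => j.
exact: mfun2_sqr.
Qed.

(** The constant 5 is dictated by [omega0], where x_2 + 4 |x| <= 5 |x|; the other two weights would
    allow 1 and 4. *)
Lemma weight_ge (omega : R * R -> R) (x : R * R) :
  omega = @omega0 R \/ omega = @omega1 R \/ omega = @omega2 R ->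
  H x -> (x.2 ^+ 2 / 5 <= omega x)%R.
Proof.
move=> ho xH; have x0 : (0 < x.2)%R by [].
have xe : (x.2 <= enorm2 x)%R.
  have h : (x.2 ^+ 2 <= x.1 ^+ 2 + x.2 ^+ 2)%R by rewrite lerDr sqr_ge0.
  by have := ler_wsqrtr h; rewrite sqrtr_sqr gtr0_norm.
have x2 : (0 < x.2 ^+ 2)%R by rewrite exprn_gt0.
have n0 : (0 < enorm2 x)%R by exact: lt_le_trans xe.
case: ho => [->|[->|->]]; rewrite /omega0 /omega1 /omega2 (gtr0_norm x0).
- rewrite ler_pdivlMr ?addr_gt0 ?mulr_gt0// mulrAC ler_pdivrMr//.
  have h : (x.2 + 4 * enorm2 x <= enorm2 x * 5)%R by lra.
  by have := ler_wpM2l (ltW x2) h; rewrite mulrA.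
- apply: (@le_trans _ _ (x.2 * x.2)%R); last by rewrite ler_wpM2l// ltW.
  by rewrite -expr2; lra.
- lra.
Qed.

Lemma weighted_bound (omega : R * R -> R) (v : R * R -> 'rV[R]_2) :
  omega = @omega0 R \/ omega = @omega1 R \/ omega = @omega2 R ->
  in_Linfty_weighted (fun x => Num.sqrt (omega x)) v ->
  exists2 C0 : R, (0 <= C0)%R &
   {ae @lebesgue2 R, forall x, H x -> (fsq (v x) <= C0 / x.2 ^+ 2)%R}.
Proof.
move=> ho [_ hes].
have [c c0 hc] : exists2 c : R, (0 <= c)%R &
    ess_sup (@lebesgue2 R) ((fun x => `|frob (v x) * Num.sqrt (omega x)|%:E) \_ H) <= c%:E.
  (* An essential supremum is an extended real and could be -oo, in which case 0 serves as the
     bound. *)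
  move: hes; case: (ess_sup _ _) => [r _|//|_].
    by exists `|r|%R => //; rewrite lee_fin ler_norm.
  by exists 0%R => //; rewrite leNye.
exists (5 * c ^+ 2)%R; first by rewrite mulr_ge0// sqr_ge0.
have aeF : Filter (almost_everywhere (@lebesgue2 R)) by exact: ae_filter_ringOfSetsType.
move/ess_supP : hc; apply: filterS => x hx xH; move: hx.
rewrite patchE mem_set// lee_fin => hx.
have x0 : (0 < x.2)%R by [].
have w0 := weight_ge ho xH.
have x2 : (0 < x.2 ^+ 2)%R by rewrite exprn_gt0.
have hw : (fsq (v x) * omega x <= c ^+ 2)%R.
  have o0 : (0 <= omega x)%R by apply: le_trans w0; rewrite divr_ge0// ltW.
  rewrite -frob_sqr -[omega x in leLHS]sqr_sqrtr// -exprMn -real_normK ?num_real//.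
  by rewrite lerXn2r ?nnegrE.
have h := ler_wpM2l (fsq_ge0 (v x)) w0.
by rewrite ler_pdivlMr//; lra.
Qed.

End L2Norms.

(* [derive.jacobian] shadows the notion of [Defs]. *)
Local Notation jacobian := Defs.jacobian.

(** * Approximation with a uniform pointwise bound *)

Section Construction.
Variable R : realType.
Local Notation H := (@halfplane R).
Local Notation o := (ord0 : 'I_2).
Local Notation l := (ord_max : 'I_2).

Lemma int2_fsq_triangle m n D (F1 F2 F3 : R * R -> 'M[R]_(m, n)) (a b : R) :
  measurable (D : set (plane R)) ->
  (forall i j, mfun2 D (fun x => F1 x i j)) -> (forall i j, mfun2 D (fun x => F2 x i j)) ->
  (forall i j, mfun2 D (fun x => F3 x i j)) ->
  (int2R D (fun x => fsq (F1 x - F3 x)) <= a%:E)%E ->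
  (int2R D (fun x => fsq (F2 x - F3 x)) <= b%:E)%E ->
  (int2R D (fun x => fsq (F1 x - F2 x)) <= (2 * a + 2 * b)%:E)%E.
Proof.
move=> mD m1 m2 m3 ha hb.
have ms (P Q : R * R -> 'M[R]_(m, n)) : (forall i j, mfun2 D (fun x => P x i j)) ->
    (forall i j, mfun2 D (fun x => Q x i j)) -> mfun2 D (fun x => fsq (P x - Q x)).
  move=> mP mQ; apply: mfun2_fsq => i j.
  rewrite (_ : (fun x => (P x - Q x) i j) = (fun x => P x i j - Q x i j)).
    by apply: measurable_funB; [exact: mP | exact: mQ].
  by apply/funext => x; rewrite !mxE.
have p1 : mfun2 D (fun x => 2 * fsq (F1 x - F3 x)) by apply: measurable_funM => //; exact: ms.
have p2 : mfun2 D (fun x => 2 * fsq (F2 x - F3 x)) by apply: measurable_funM => //; exact: ms.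
apply: (@le_trans _ _ (int2R D (fun x => 2 * fsq (F1 x - F3 x) + 2 * fsq (F2 x - F3 x)))).
  apply: int2_le => //; [exact: ms | exact: measurable_funD |].
  move=> x _; rewrite fsq_ge0 /= /fsq !mulr_sumr -big_split /=; apply: ler_sum => i _.
  rewrite !mulr_sumr -big_split /=; apply: ler_sum => j _; rewrite !mxE.
  have := sqr_ge0 (F1 x i j - F3 x i j + (F2 x i j - F3 x i j)); lra.
have q1 x : D x -> 0 <= 2 * fsq (F1 x - F3 x) by move=> _; rewrite mulr_ge0 ?fsq_ge0.
have q2 x : D x -> 0 <= 2 * fsq (F2 x - F3 x) by move=> _; rewrite mulr_ge0 ?fsq_ge0.
rewrite (int2D mD p1 p2 q1 q2) EFinD.
apply: leeD; rewrite int2Z //; try exact: ms; try by move=> x _; exact: fsq_ge0.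
  by rewrite [leRHS]EFinM; apply: lee_wpmul2l.
by rewrite [leRHS]EFinM; apply: lee_wpmul2l.
Qed.

Lemma energyE (F : 'I_2 -> R * R -> R) x : energy F x = fsq (jacobian (field_of F) x).
Proof.
by apply: eq_bigr => i _; apply: eq_bigr => j _; rewrite mxE component_field_of.
Qed.

Lemma denergyE (F G : 'I_2 -> R * R -> R) x :
  denergy F G x = fsq (jacobian (field_of F) x - jacobian (field_of G) x).
Proof.
by apply: eq_bigr => i _; apply: eq_bigr => j _; rewrite !mxE !component_field_of.
Qed.

Lemma field_of_component (w : R * R -> 'rV[R]_2) : field_of (fun i => component i w) = w.
Proof.
apply/funext => x; apply/matrixP => i j; rewrite mxE /component.
by rewrite (ord1 i).
Qed.

Lemma mfun2_jacobian (F : 'I_2 -> R * R -> R) : (forall i, test_fun (F i)) ->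
  forall i j, mfun2 H (fun x => jacobian (field_of F) x i j).
Proof.
move=> tF i j; rewrite (_ : (fun x => _) = partial j (F i)).
  by apply: test_fun_mfun2; exact: test_fun_partial.
by apply/funext => x; rewrite mxE component_field_of.
Qed.

(** The restriction e <= 1/3 ensures y_2 + e <= 1 in the layer y_2 <= 2e, where the grid mean is
    only known to be bounded by a constant. *)
Lemma common_modulus (F : 'I_2 -> R * R -> R) (d : R) : (forall i, test_fun (F i)) -> 0 < d ->
  exists e, [/\ 0 < e, e <= 3^-1 & forall i j (h : R * R), `|h.1| <= e -> 0 <= h.2 <= e ->
    (int2R H (fun x => (translate h (partial j (F i)) x - partial j (F i) x) ^+ 2) <= d%:E)%E].
Proof.
move=> tF d0.
have T i j := translation_modulus (test_fun_partial j (tF i)) d0.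
have [e1 e10 h1] := T o o; have [e2 e20 h2] := T o l.
have [e3 e30 h3] := T l o; have [e4 e40 h4] := T l l.
pose e := Num.min 3^-1 (Num.min (Num.min e1 e2) (Num.min e3 e4)).
have le3 : e <= 3^-1 by rewrite ge_min lexx.
have le1 : e <= e1 by rewrite !ge_min lexx !orbT.
have le2 : e <= e2 by rewrite !ge_min lexx !orbT.
have le4 : e <= e4 by rewrite !ge_min lexx !orbT.
have le5 : e <= e3 by rewrite !ge_min lexx !orbT.
exists e; split=> //; first by rewrite !lt_min invr_gt0 ltr0n e10 e20 e30 e40.
move=> i j h a1 /andP[a2 a3].
case: (ord2_cases i) => ->; case: (ord2_cases j) => ->;
  [apply: h1|apply: h2|apply: h3|apply: h4];
  by [exact: le_trans a1 _ | rewrite a2 /=; exact: le_trans a3 _].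
Qed.

Lemma partial_vanish_far (f : R * R -> R) : test_fun f ->
  exists2 Q, 0 <= Q & forall j x, H x -> Q < rho x -> partial j f x = 0.
Proof.
move=> tf; have [P [a [P0 a0 sf]]] := test_fun_supp tf.
exists (2 * P ^+ 2); first by rewrite mulr_ge0 ?sqr_ge0.
move=> j x xH hr; apply: (@supp_in_partial R P a f j sf); right.
have [h1|h1] := ltP P `|x.1|; first by left.
have [h2|h2] := ltP P x.2; first by right.
move: hr; rewrite /rho ltNge => /negP; case.
have -> : 2 * P ^+ 2 = P ^+ 2 + P ^+ 2 by ring.
apply: lerD; last by rewrite lerXn2r ?nnegrE// ltW.
by rewrite -real_normK ?num_real// lerXn2r ?nnegrE ?normr_ge0// ltW.
Qed.

Variables (v : R * R -> 'rV[R]_2) (phi : nat -> R * R -> 'rV[R]_2) (G : R * R -> 'M[R]_2).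
Variables (C0 g0 : R).
Hypothesis tphi : forall k, test_field_divfree (phi k).
Hypothesis mG : forall i j, mfun2 H (fun x => G x i j).
Hypothesis hG : (int2R H (fun x => fsq (G x)) <= g0%:E)%E.
Hypothesis hgrad : forall e, 0 < e -> exists N, forall k, (N <= k)%N ->
  (int2R H (fun x => fsq (jacobian (phi k) x - G x)) <= e%:E)%E.
Hypothesis hloc : forall K, compact K -> K `<=` H -> forall e, 0 < e ->
  exists N, forall k, (N <= k)%N ->
  (int2R K (fun x => fsq (phi k x - v x)) <= e%:E)%E.
Hypothesis mv : forall i, mfun2 H (component i v).
Hypothesis C00 : 0 <= C0.
Hypothesis hv : {ae @lebesgue2 R, forall x, H x -> fsq (v x) <= C0 / x.2 ^+ 2}.

Let Ph k i := component i (phi k).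

Let dPh k : div_free (Ph k). Proof. exact: divfree_components. Qed.

Let tPh k i : test_fun (Ph k i). Proof. by have [] := dPh k. Qed.

Let jacE k : jacobian (field_of (Ph k)) = jacobian (phi k).
Proof. by rewrite field_of_component. Qed.

Let mH : measurable (H : set (plane R)). Proof. exact: measurable_halfplane. Qed.

Let mJ k i j : mfun2 H (fun x => jacobian (phi k) x i j).
Proof. by rewrite -jacE; exact: mfun2_jacobian. Qed.

Let hvi i : {ae @lebesgue2 R, forall x, H x -> component i v x ^+ 2 <= C0 / x.2 ^+ 2}.
Proof.
have aeF : Filter (almost_everywhere (@lebesgue2 R)) by exact: ae_filter_ringOfSetsType.
apply: filterS hv => x hx /hx; apply: le_trans; rewrite fsq_rV /component.
by case: (ord2_cases i) => ->; rewrite ?lerDl ?lerDr sqr_ge0.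
Qed.

(** The bound has to be uniform in k: E enters the final pointwise constant, whereas k is chosen
    after everything else. *)
Lemma energy_bound : exists E K0, 0 <= E /\ forall k, (K0 <= k)%N ->
  (int2R H (energy (Ph k)) <= E%:E)%E.
Proof.
have [K0 hK] := hgrad ltr01.
have g00 : 0 <= g0.
  by rewrite -lee_fin; apply: le_trans hG; apply: int2_ge0 => x _; exact: fsq_ge0.
exists (2 * 1 + 2 * g0), K0; split; first by rewrite addr_ge0// mulr_ge0.
move=> k /hK h.
rewrite (@int2_eq _ _ _ (fun x => fsq (jacobian (phi k) x - (fun=> 0) x))); last first.
  by move=> x _; rewrite energyE jacE subr0.
apply: (int2_fsq_triangle mH (@mJ k) _ mG h) => [i j|].
  by rewrite (_ : (fun x => _) = cst 0); [exact: measurable_cst | apply/funext => x; rewrite mxE].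
rewrite (@int2_eq _ _ _ (fun x => fsq (G x)))// => x _.
by rewrite sub0r /fsq; apply: eq_bigr => i _; apply: eq_bigr => j _; rewrite mxE sqrrN.
Qed.

(** The sizes of [d] and [eta] make the Riemann sum error and the distance to v over a cell
    contribute 1/(2 r^2) each; their sum 1/r^2 is at most 1/y_2^2 as long as y_2 <= r. *)
Lemma mean_field_bound k (E e r d eta : R) (N : nat) i y : 0 < e -> e <= 3^-1 -> 1 <= r ->
  0 < d -> d <= 1 ->
  (int2R H (energy (Ph k)) <= E%:E)%E -> 0 <= E ->
  d <= (2 * r ^+ 2)^-1 -> eta = e ^+ 2 * (4 * r ^+ 2)^-1 ->
  (int2R (box (r + 1) e) (fun x => fsq (phi k x - v x)) <= eta%:E)%E ->
  ((grid_mean N (e / N%:R) (Ph k i) y ^+ 2)%:E <=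
     (e ^- 2)%:E * int2R (cell e y) (fun z => Ph k i z ^+ 2) + d%:E)%E ->
  H y -> `|y.1| <= r -> y.2 <= r ->
  `|grid_mean N (e / N%:R) (Ph k i) y| <= (24 * C0 + 16 * E + 5) / (y.2 + e).
Proof.
move=> e0 e3 r1 d0 d1 hE E0 hd etaE hK hT yH y1 y2.
have C0nn := C00.
set T := grid_mean _ _ _ _ in hT *.
have y0 : 0 < y.2 by [].
have r0 : 0 < r by apply: lt_le_trans r1.
have e20 : 0 < e ^+ 2 by rewrite exprn_gt0.
have ye : 0 < y.2 + e by rewrite addr_gt0.
set M := 24 * C0 + 16 * E + 4.
have M0 : 0 <= M by rewrite !addr_ge0// mulr_ge0.
(* The bound M <= (M + 1)^2 spares a square root in the constant, which explains the 5 in place of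
   4. *)
suff hTM : T ^+ 2 <= M / (y.2 + e) ^+ 2.
  have -> : 24 * C0 + 16 * E + 5 = M + 1 by rewrite /M; ring.
  have M1 : 0 <= M + 1 by rewrite addr_ge0.
  rewrite -ler_sqr ?nnegrE ?divr_ge0 ?(ltW ye)// real_normK ?num_real//.
  apply: (le_trans hTM); rewrite expr_div_n ler_wpM2r ?invr_ge0 ?sqr_ge0//.
  have := sqr_ge0 M; lra.
have hcell c : (int2R (cell e y) (fun z => Ph k i z ^+ 2) <= (c * e ^+ 2)%:E)%E ->
    T ^+ 2 <= c + d.
  move=> hc; rewrite -lee_fin; apply: (le_trans hT); rewrite EFinD leeD2r//.
  apply: (@le_trans _ _ ((e ^- 2)%:E * (c * e ^+ 2)%:E)%E).
    by apply: lee_wpmul2l => //; rewrite lee_fin invr_ge0 ltW.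
  by rewrite -EFinM lee_fin mulrCA mulVf ?mulr1// gt_eqF.
(* Hardy's inequality controls the cells touching the boundary, the weighted
   bound on [v] all the others. *)
have [ysmall|ybig] := leP y.2 (2 * e).
  have hp : (int2R H (fun z => partial l (Ph k i) z ^+ 2) <= E%:E)%E.
    apply: le_trans hE; apply: int2_le => //.
    - by apply: mfun2_sqr; apply: test_fun_mfun2; exact: test_fun_partial.
    - apply: measurable_sum => i'; apply: measurable_sum => j; apply: mfun2_sqr.
      by apply: test_fun_mfun2; exact: test_fun_partial.
    by move=> x _; rewrite sqr_ge0 /=; exact: (sum_sqr_entry (fun i j => partial j (Ph k i) x)).
  have hc := int2_cell_boundary (tPh k i) e0 ysmall hp.
  have := @hcell (16 * E); rewrite mulrAC => /(_ hc) h.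
  rewrite ler_pdivlMr ?exprn_gt0//.
  apply: (@le_trans _ _ ((16 * E + d) * 1)); last by rewrite /M; lra.
  apply: ler_pM => //; first exact: sqr_ge0.
    by rewrite exprn_ge0// ltW.
  by rewrite exprn_ile1 ?(ltW ye)//; lra.
have cK : cell e y `<=` box (r + 1) e.
  move=> z [] /=; rewrite !in_itv /= => /andP[z1 z2] /andP[z3 z4].
  move: y1; rewrite ler_norml => /andP[y11 y12].
  by split; rewrite /= in_itv /=; apply/andP; split; lra.
have bH : box (r + 1) e `<=` H.
  move=> z [_] /=; rewrite in_itv /= => /andP[ez _]; exact: lt_le_trans ez.
have mb : measurable (box (r + 1) e : set (plane R)).
  by apply: measurableX; exact: measurable_itv.
have hKi : (int2R (box (r + 1) e) (fun z => (Ph k i z - component i v z) ^+ 2) <= eta%:E)%E.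
  apply: le_trans hK; apply: int2_le => //.
  - apply: mfun2_sqr; apply: measurable_funB; apply: (mfun2_sub mH bH) => //.
    exact: test_fun_mfun2.
  - apply: mfun2_fsq => i' j; apply: (mfun2_sub mH bH) => //.
    rewrite (ord1 i') (_ : (fun x => _) = (fun x => Ph k j x - component j v x)).
      by apply: measurable_funB; [exact: test_fun_mfun2 | exact: mv].
    by apply/funext => x; rewrite !mxE.
  move=> z _; rewrite sqr_ge0 /= fsq_rV /Ph /component !mxE.
  by case: (ord2_cases i) => ->; rewrite ?lerDl ?lerDr sqr_ge0.
have hc := int2_cell_interior (tPh k i) (mv i) e0 ybig mb bH cK (hvi i) C00 hKi.
have rn : r != 0 by rewrite gt_eqF.
have := @hcell (8 * C0 / y.2 ^+ 2 + (2 * r ^+ 2)^-1).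
have -> : (8 * C0 / y.2 ^+ 2 + (2 * r ^+ 2)^-1) * e ^+ 2 =
   8 * C0 / y.2 ^+ 2 * e ^+ 2 + 2 * eta.
  by rewrite etaE; field; rewrite rn gt_eqF.
move=> /(_ hc) h.
have hr : (r ^+ 2)^-1 <= (y.2 ^+ 2)^-1.
  rewrite lef_pV2 ?posrE ?exprn_gt0// lerXn2r ?nnegrE// ltW//.
(* From y_2 > 2e one gets y_2 + e <= (3/2) y_2, and 9/4 <= 3; this factor 3 turns the 8 C0 of the
   cell estimate into 24 C0. *)
have hy : (y.2 ^+ 2)^-1 <= 3 / (y.2 + e) ^+ 2.
  rewrite ler_pdivlMr ?exprn_gt0// ler_pdivrMl ?exprn_gt0//.
  have h1 : y.2 + e <= 3 / 2 * y.2 by lra.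
  have : (y.2 + e) ^+ 2 <= (3 / 2 * y.2) ^+ 2.
    by rewrite lerXn2r ?nnegrE ?(ltW ye)// mulr_ge0// ltW.
  by rewrite exprMn; have := sqr_ge0 y.2; lra.
have r2 : (2 * r ^+ 2)^-1 = (r ^+ 2)^-1 / 2 by field.
apply: (@le_trans _ _ ((8 * C0 + 1) * (y.2 ^+ 2)^-1)); first by rewrite r2 in h hd; lra.
apply: (@le_trans _ _ ((8 * C0 + 1) * (3 / (y.2 + e) ^+ 2))).
  by rewrite ler_wpM2l// addr_ge0// mulr_ge0.
rewrite mulrA ler_wpM2r ?invr_ge0 ?sqr_ge0//.
by rewrite /M; lra.
Qed.

(** The order of quantifiers is the point: M is fixed before the precision d, although e, lam, k and
    N all depend on d. *)
Lemma bounded_approximation : exists2 M, 0 <= M & forall d, 0 < d ->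
  exists F, [/\ div_free F, forall i x, H x -> `|F i x| <= M / x.2 &
    (int2R H (fun x => fsq (jacobian (field_of F) x - G x)) <= d%:E)%E].
Proof.
have C0nn := C00; have [C C1 hC] := @chi_bounds R.
have [E [K0 [E0 hE]]] := energy_bound.
have C0' : 0 <= C by apply: le_trans C1.
have M10 : 0 <= 24 * C0 + 16 * E + 5 by rewrite !addr_ge0// mulr_ge0.
exists (6 * C * (24 * C0 + 16 * E + 5)); first by rewrite !mulr_ge0.
(* Order of the choices: [k0], then [e], then [lam], then [k] and [N]. *)
move=> d d0.
(* The final error is c1 d1: twice (576 C^2 + 1) d1 for the cut field and twice d1 for phi_k0. Here
   576 is 4 times 144, and 144 collects four entries with error 9 times 4 d1 from the grid means. *)
pose c1 := 1152 * C ^+ 2 + 4.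
have c10 : 0 < c1 by rewrite /c1; have := sqr_ge0 C; lra.
pose d1 := Num.min 1 (d / c1).
have d10 : 0 < d1 by rewrite lt_min ltr01 divr_gt0.
have d11 : d1 <= 1 by rewrite ge_min lexx.
have d1d : c1 * d1 <= d.
  by rewrite mulrC -ler_pdivlMr// ge_min lexx orbT.
have [K1 hK1] := hgrad d10.
pose k0 := maxn K0 K1.
have hk0 k : (k0 <= k)%N -> (K0 <= k)%N /\ (K1 <= k)%N by rewrite geq_max => /andP.
have d40 : 0 < 4 * d1 by rewrite mulr_gt0.
have [e [e0 e3 hmod]] := common_modulus (tPh k0) d40.
have [Q0 Q00 hQ0] := partial_vanish_far (tPh k0 o).
have [Q1 Q10 hQ1] := partial_vanish_far (tPh k0 l).
(* Bound for the energy of the grid mean: twice 144 d1, with d1 <= 1, and twice that of phi_k0. *)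
pose g := 288 + 2 * E.
have g00 : 0 <= g by rewrite /g; lra.
pose c2 := 1280 * C ^+ 2 * g.
have c20 : 0 <= c2.
  by apply: mulr_ge0 g00; apply: mulr_ge0; [exact: ler0n | exact: sqr_ge0].
(* Each summand meets one requirement: exp (-lam) <= e, the gradient of phi_k0 vanishing wherever
   chi may differ from 1, and a cutoff error c2 / lam^2 of at most d1. *)
pose lam := 1 + `|ln e| + Q0 + Q1 + c2 / d1.
have c2d : 0 <= c2 / d1 by rewrite divr_ge0// ltW.
have lne := normr_ge0 (ln e).
have lam1 : 1 <= lam by rewrite /lam; lra.
have lam0 : 0 < lam by lra.
have lame : expR (- lam) <= e.
  rewrite -[leRHS](@lnK _ e) ?posrE// ler_expR.
  by have := ler_norm (- ln e); rewrite normrN /lam; lra.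
have lamQ : 1 + 2 * lam <= expR (2 * lam) by exact: expR_ge1Dx.
have lamc : 1280 * (C / lam) ^+ 2 * g <= d1.
  have -> : 1280 * (C / lam) ^+ 2 * g = c2 / lam ^+ 2.
    by rewrite /c2; field; rewrite gt_eqF.
  rewrite ler_pdivrMr ?exprn_gt0//.
  have h1 : c2 <= d1 * lam by rewrite mulrC -ler_pdivrMr// /lam; lra.
  apply: (le_trans h1); rewrite ler_wpM2l ?(ltW d10)// expr2.
  by rewrite ler_peMr// ltW.
have hfar i j x : H x -> expR (2 * lam) < rho x -> partial j (Ph k0 i) x = 0.
  move=> xH hr; case: (ord2_cases i) => ->; [apply: hQ0 => //|apply: hQ1 => //];
    apply: le_lt_trans hr; apply: le_trans lamQ; rewrite /lam; lra.
pose r := expR (3 * lam).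
have r1 : 1 <= r.
  by apply: le_trans (expR_ge1Dx _); rewrite lerDl mulr_ge0// ltW.
have r0 : 0 < r by apply: lt_le_trans r1.
pose eta := e ^+ 2 * (4 * r ^+ 2)^-1.
have eta0 : 0 < eta by rewrite mulr_gt0 ?invr_gt0 ?mulr_gt0 ?exprn_gt0.
have bH : box (r + 1) e `<=` H.
  move=> z [_] /=; rewrite in_itv /= => /andP[ez _]; exact: lt_le_trans ez.
have [K2 hK2] := hloc (@compact_box _ (r + 1) e) bH eta0.
pose k := maxn k0 K2.
have kk0 : (k0 <= k)%N by rewrite leq_maxl.
have kK2 : (K2 <= k)%N by rewrite leq_maxr.
have [kK0 kK1] := hk0 _ kk0; have [k0K0 k0K1] := hk0 _ (leqnn k0).
pose dd := (2 * r ^+ 2)^-1.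
have dd0 : 0 < dd by rewrite invr_gt0 mulr_gt0 ?exprn_gt0.
have dd1 : dd <= 1.
  rewrite invf_le1 ?mulr_gt0 ?exprn_gt0//.
  by have := exprn_ege1 2 r1; lra.
have [N0 hN0] := grid_mean_sqr_le (tPh k o) e0 dd0.
have [N1 hN1] := grid_mean_sqr_le (tPh k l) e0 dd0.
pose N := (maxn N0 N1).+1.
have NN0 : (N0 < N)%N by rewrite ltnS leq_maxl.
have NN1 : (N1 < N)%N by rewrite ltnS leq_maxr.
have Npos : (0 < N)%N by [].
pose st := e / N%:R.
have st0 : 0 <= st by rewrite divr_ge0// ltW.
have Nst : N%:R * st = e by rewrite /st; field; rewrite pnatr_eq0.
pose F i := grid_mean N st (Ph k i).
have tF i : test_fun (F i) by exact: test_fun_grid_mean.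
have dF : div_free F.
  split=> // x xH; have tp := test_fun_partial.
  rewrite /F !partial_grid_mean// /grid_mean /mean -mulrDr -big_split /=.
  rewrite big1 ?mulr0// => a _; rewrite /translate /= -mulrDr -big_split /=.
  rewrite big1 ?mulr0// => b _.
  set z := (_, _).
  (* A translate samples points that may lie below the boundary; there the derivatives vanish
     because they are test functions. *)
  have [zH|zH] := pselect (H z); first by have [_ dz] := dPh k; exact: dz.
  by rewrite !test_fun_off ?addr0//; exact: test_fun_partial.
have hFb y : H y -> `|y.1| <= r -> y.2 <= r -> forall i, `|F i y| <= (24 * C0 + 16 * E + 5) / (y.2 + e).
  move=> yH y1 y2 i.
  apply: (@mean_field_bound k E e r dd eta N i y e0 e3 r1 dd0 dd1 (hE _ kK0) E0 (lexx _) erefl) => //.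
    exact: hK2.
  by case: (ord2_cases i) => ->; [exact: hN0 | exact: hN1].
have e1 : e <= 1 by lra.
have hD : (int2R H (denergy (Ph k) (Ph k0)) <= (4 * d1)%:E)%E.
  rewrite (@int2_eq _ _ _ (fun x => fsq (jacobian (phi k) x - jacobian (phi k0) x))); last first.
    by move=> x _; rewrite denergyE !jacE.
  have := int2_fsq_triangle mH (@mJ k) (@mJ k0) mG (hK1 _ kK1) (hK1 _ k0K1).
  by rewrite (_ : 2 * d1 + 2 * d1 = 4 * d1)//; ring.
have hDij i j : (int2R H (fun x => (partial j (Ph k i) x - partial j (Ph k0 i) x) ^+ 2) <= (4 * d1)%:E)%E.
  apply: le_trans hD; apply: int2_le => //.
  - apply: mfun2_sqr; apply: measurable_funB; apply: test_fun_mfun2; exact: test_fun_partial.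
  - apply: measurable_sum => i'; apply: measurable_sum => j'; apply: mfun2_sqr.
    by apply: measurable_funB; apply: test_fun_mfun2; exact: test_fun_partial.
  move=> x _; rewrite sqr_ge0 /=.
  exact: (sum_sqr_entry (fun i j => partial j (Ph k i) x - partial j (Ph k0 i) x)).
have hA : (int2R H (denergy F (Ph k0)) <= (144 * d1)%:E)%E.
  have hij i j : (int2R H (fun x => (partial j (F i) x - partial j (Ph k0 i) x) ^+ 2) <= (36 * d1)%:E)%E.
    have := @grid_mean_approx R N st _ _ (4 * d1) Npos st0 (test_fun_partial j (tPh k i))
      (test_fun_partial j (tPh k0 i)) (hDij i j).
    rewrite Nst => /(_ (hmod i j)).
    rewrite (_ : 9 * (4 * d1) = 36 * d1); last by ring.
    by rewrite /F partial_grid_mean.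
  have ms i j : mfun2 H (fun x => (partial j (F i) x - partial j (Ph k0 i) x) ^+ 2).
    by apply: mfun2_sqr; apply: measurable_funB; apply: test_fun_mfun2; exact: test_fun_partial.
  rewrite /denergy int2_sum//; last 2 first.
  - by move=> i; apply: measurable_sum => j; exact: ms.
  - by move=> i x _; apply: sumr_ge0 => j _; exact: sqr_ge0.
  rewrite (_ : (144 * d1)%:E = (\sum_(i < 2) \sum_(j < 2) (36 * d1)%:E)%E); last first.
    by rewrite !sumEFin; congr EFin; rewrite !sum2E; ring.
  apply: lee_sum => i _; rewrite int2_sum//.
    by apply: lee_sum => j _; exact: hij.
  by move=> j x _; exact: sqr_ge0.
have hEF : (int2R H (energy F) <= g%:E)%E.
  rewrite (@int2_eq _ _ _ (fun x => fsq (jacobian (field_of F) x - (fun=> 0) x))); last first.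
    by move=> x _; rewrite energyE subr0.
  have m0 i j : mfun2 H (fun x : R * R => ((fun=> 0 : 'M[R]_2) x) i j).
    by rewrite (_ : (fun x => _) = cst 0); [exact: measurable_cst | apply/funext => x; rewrite mxE].
  have h1 : (int2R H (fun x => fsq (jacobian (field_of F) x - jacobian (phi k0) x)) <= (144 * d1)%:E)%E.
    apply: le_trans hA; rewrite (@int2_eq _ _ _ (denergy F (Ph k0)))// => x _.
    by rewrite denergyE jacE.
  have h2 : (int2R H (fun x => fsq ((fun=> 0 : 'M[R]_2) x - jacobian (phi k0) x)) <= E%:E)%E.
    apply: le_trans (hE _ k0K0); rewrite (@int2_eq _ _ _ (energy (Ph k0)))// => x _.
    rewrite energyE jacE sub0r /fsq.
    by apply: eq_bigr => i _; apply: eq_bigr => j _; rewrite mxE sqrrN.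
  apply: le_trans (int2_fsq_triangle mH (mfun2_jacobian tF) m0 (@mJ k0) h1 h2) _.
  by rewrite lee_fin /g; lra.
pose W i x := if 0 < x.2 then cut lam F i x else 0.
exists W; split.
- exact: cut_divfree.
- move=> i x xH; rewrite /W xH.
  exact: (cut_le lam1 dF C1 hC i xH M10 e0 e1 lame hFb).
have dW : div_free W by exact: cut_divfree.
have hcut := int2_cut_denergy lam1 dF C1 hC (tPh k0) hfar hA hEF.
have hW : (int2R H (fun x => fsq (jacobian (field_of W) x - jacobian (phi k0) x)) <=
    (576 * C ^+ 2 * d1 + d1)%:E)%E.
  apply: (@le_trans _ _ (int2R H (denergy (cut lam F) (Ph k0)))).
    rewrite (@int2_eq _ _ _ (denergy (cut lam F) (Ph k0)))// => x xH.
    rewrite -jacE -denergyE /denergy; apply: eq_bigr => i _; apply: eq_bigr => j _.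
    congr ((_ - _) ^+ 2); apply: near_eq_derive.
    by apply: (near_eq_of_open (@open_halfplane R) xH) => y yH; rewrite /W yH.
  apply: (le_trans hcut); rewrite lee_fin; apply: lerD => //.
  by rewrite le_eqVlt; apply/orP; left; apply/eqP; ring.
have hGk : (int2R H (fun x => fsq (G x - jacobian (phi k0) x)) <= d1%:E)%E.
  apply: le_trans (hK1 _ k0K1); rewrite le_eqVlt; apply/orP; left; apply/eqP.
  apply: int2_eq => x _; rewrite /fsq.
  by apply: eq_bigr => i _; apply: eq_bigr => j _; rewrite !mxE -sqrrN opprB.
have [tW _] := dW.
apply: le_trans (int2_fsq_triangle mH (mfun2_jacobian tW) mG (@mJ k0) hW hGk) _.
rewrite lee_fin; apply: le_trans d1d; rewrite /c1.
by rewrite le_eqVlt; apply/orP; left; apply/eqP; ring.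
Qed.

End Construction.

(** * Convergence of the tensor products *)

Section Multipliers.
Variable R : realType.
Local Notation H := (@halfplane R).

Let mH : measurable (H : set (plane R)). Proof. exact: measurable_halfplane. Qed.

Lemma mfun2_weight (f : R * R -> R) : mfun2 H f -> mfun2 H (fun x => f x / x.2 ^+ 2).
Proof.
move=> mf; apply: measurable_funM => //.
apply: (@Ck_measurable _ _ 0); first exact: open_halfplane.
exact: Ck_heightV.
Qed.

(** The multiplier estimate: [f] stands for the squared length of u or of its approximation error,
    [w] for that of a field bounded by a multiple of 1/x_2. *)
Lemma int2_mult_le (f w : R * R -> R) (c a : R) : mfun2 H f -> mfun2 H w -> 0 <= c ->
  (forall x, H x -> 0 <= f x) -> (forall x, H x -> 0 <= w x) ->
  {ae @lebesgue2 R, forall x, H x -> w x <= c / x.2 ^+ 2} ->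
  (int2R H (fun x => f x / x.2 ^+ 2) <= a%:E)%E ->
  (int2R H (fun x => f x * w x) <= (c * a)%:E)%E.
Proof.
move=> mf mw c0 f0 w0 hw ha.
have mfw := mfun2_weight mf.
have fw0 x : H x -> 0 <= f x / x.2 ^+ 2.
  by move=> xH; rewrite divr_ge0 ?sqr_ge0 ?f0.
apply: (@le_trans _ _ (int2R H (fun x => c * (f x / x.2 ^+ 2)))).
  apply: int2_ae_le => //.
  - exact: measurable_funM.
  - exact: measurable_funM.
  - by move=> x xH; rewrite mulr_ge0 ?f0 ?w0.
  - by move=> x xH; rewrite mulr_ge0 ?fw0.
  have aeF : Filter (almost_everywhere (@lebesgue2 R)) by exact: ae_filter_ringOfSetsType.
  apply: filterS hw => x hx xH.
  by rewrite mulrCA ler_wpM2l ?f0// hx.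
rewrite int2Z// EFinM; apply: lee_wpmul2l => //.
Qed.

Lemma fsq_tensor (u w : R * R -> 'rV[R]_2) x : fsq (tensor u w x) = fsq (u x) * fsq (w x).
Proof. by rewrite fsq_M2 !fsq_rV /tensor !mxE /component; ring. Qed.

Lemma tensorBr (u w w' : R * R -> 'rV[R]_2) x :
  tensor u w x - tensor u w' x = tensor u (fun y => w y - w' y) x.
Proof. by apply/matrixP => i j; rewrite !mxE /component !mxE; ring. Qed.

Lemma hardy_field (F F' : 'I_2 -> R * R -> R) (a : R) :
  (forall i, test_fun (F i)) -> (forall i, test_fun (F' i)) ->
  (int2R H (denergy F F') <= a%:E)%E ->
  (int2R H (fun x => fsq (field_of F x - field_of F' x) / x.2 ^+ 2) <= (8 * a)%:E)%E.
Proof.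
move=> tF tF' ha.
pose D i x := F i x - F' i x.
have tD i : test_fun (D i) by exact: test_fun_sub.
have pD i j x : partial j (D i) x = partial j (F i) x - partial j (F' i) x.
  apply: partialE; apply: is_deriveB; exact: test_fun_derive.
have hi i : (int2R H (fun x => D i x ^+ 2 / x.2 ^+ 2) <= (4 * a)%:E)%E.
  apply: (le_trans (hardy_inequality (tD i))); rewrite EFinM; apply: lee_wpmul2l => //.
  apply: le_trans ha; apply: int2_le => //.
  - by apply: mfun2_sqr; apply: test_fun_mfun2; exact: test_fun_partial.
  - apply: measurable_sum => i'; apply: measurable_sum => j'; apply: mfun2_sqr.
    by apply: measurable_funB; apply: test_fun_mfun2; exact: test_fun_partial.
  move=> x _; rewrite sqr_ge0 pD /=.
  exact: (sum_sqr_entry (fun i j => partial j (F i) x - partial j (F' i) x)).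
have mi i : mfun2 H (fun x => D i x ^+ 2 / x.2 ^+ 2).
  by apply: mfun2_weight; apply: mfun2_sqr; exact: test_fun_mfun2.
have pi i x : H x -> 0 <= D i x ^+ 2 / x.2 ^+ 2 by move=> _; rewrite divr_ge0 ?sqr_ge0.
rewrite (@int2_eq _ _ _ (fun x => D ord0 x ^+ 2 / x.2 ^+ 2 + D ord_max x ^+ 2 / x.2 ^+ 2)).
  rewrite (int2D mH (mi _) (mi _) (@pi _) (@pi _)).
  have -> : 8 * a = 4 * a + 4 * a by ring.
  by rewrite EFinD; apply: leeD; exact: hi.
by move=> x _; rewrite fsq_rV !mxE -mulrDl.
Qed.

Definition exhaust (j : nat) : set (R * R) := box j.+1%:R j.+1%:R^-1.

Lemma exhaust_sub j : exhaust j `<=` H.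
Proof.
move=> x [_] /=; rewrite in_itv /= => /andP[h _]; apply: lt_le_trans h.
by rewrite invr_gt0 ltr0n.
Qed.

Lemma measurable_exhaust j : measurable (exhaust j : set (plane R)).
Proof. by apply: measurableX; exact: measurable_itv. Qed.

Lemma bigcup_exhaust : \bigcup_j exhaust j = H.
Proof.
apply/seteqP; split=> x; first by move=> [j _]; exact: exhaust_sub.
move=> x0; have x2 : 0 < x.2 by [].
pose b := `|x.1| + x.2 + x.2^-1.
have b0 : 0 <= b by rewrite !addr_ge0// ?invr_ge0 ltW.
have i0 : 0 <= x.2^-1 by rewrite invr_ge0 ltW.
have n0 := normr_ge0 x.1.
have bj : b <= (Num.Def.archi_bound b).+1%:R.
  by rewrite -natr1 ler_wpDr// ltW// archi_boundP.
exists (Num.Def.archi_bound b) => //.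
split; rewrite /= in_itv /=; first by rewrite -ler_norml; apply: le_trans bj; rewrite /b; lra.
apply/andP; split; last by apply: le_trans bj; rewrite /b; lra.
rewrite -[leRHS]invrK lef_pV2 ?posrE ?invr_gt0 ?ltr0n//.
by apply: le_trans bj; rewrite /b; lra.
Qed.

Lemma nondecreasing_exhaust : {homo exhaust : n m / (n <= m)%N >-> (n <= m)%O}.
Proof.
move=> n m nm; apply/subsetPset => x [] /=; rewrite !in_itv /= => /andP[h1 h2] /andP[h3 h4].
have nm' : n.+1%:R <= m.+1%:R :> R by rewrite ler_nat.
have nV : m.+1%:R^-1 <= n.+1%:R^-1 :> R by rewrite lef_pV2 ?posrE ?ltr0n.
split; rewrite /= in_itv /=; apply/andP; split.
- by apply: le_trans h1; rewrite lerN2.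
- exact: le_trans nm'.
- exact: le_trans nV h3.
- exact: le_trans nm'.
Qed.

(** * Hardy's inequality for limits of test fields *)

Section HardyLimit.
Variables (u : R * R -> 'rV[R]_2) (uk : nat -> R * R -> 'rV[R]_2) (G : R * R -> 'M[R]_2).
Hypothesis tuk : forall k, test_field_divfree (uk k).
Hypothesis mG : forall i j, mfun2 H (fun x => G x i j).
Hypothesis hgrad : forall e, 0 < e -> exists N, forall k, (N <= k)%N ->
  (int2R H (fun x => fsq (jacobian (uk k) x - G x)) <= e%:E)%E.
Hypothesis hloc : forall K, compact K -> K `<=` H -> forall e, 0 < e ->
  exists N, forall k, (N <= k)%N ->
  (int2R K (fun x => fsq (uk k x - u x)) <= e%:E)%E.
Hypothesis mu : forall i, mfun2 H (component i u).

Let tc k i : test_fun (component i (uk k)). Proof. by case: (tuk k). Qed.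

Let mdiff k : mfun2 H (fun x => fsq (uk k x - u x)).
Proof.
apply: mfun2_fsq => i j.
rewrite (ord1 i) (_ : (fun x => _) = (fun x => component j (uk k) x - component j u x)).
  by apply: measurable_funB; [exact: test_fun_mfun2 | exact: mu].
by apply/funext => x; rewrite !mxE.
Qed.

Lemma cauchy_grad e : 0 < e -> exists N, forall k m, (N <= k)%N -> (N <= m)%N ->
  (int2R H (denergy (fun i => component i (uk k)) (fun i => component i (uk m))) <= e%:E)%E.
Proof.
move=> e0; have e4 : 0 < e / 4 by rewrite divr_gt0.
have [N hN] := hgrad e4; exists N => k m /hN hk /hN hm.
have mJ j i i' : mfun2 H (fun x => jacobian (uk j) x i i').
  by rewrite -[uk j]field_of_component; exact: mfun2_jacobian.
have := int2_fsq_triangle mH (@mJ k) (@mJ m) mG hk hm.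
rewrite (_ : 2 * (e / 4) + 2 * (e / 4) = e); last by field.
apply: le_trans; rewrite le_eqVlt; apply/orP; left; apply/eqP; apply: int2_eq => x _.
by rewrite denergyE !field_of_component.
Qed.

(** A Fatou-type argument. Hardy's inequality controls [uk k - uk m] for all m >= N. On a fixed set
    of the exhaustion [uk m] can be replaced by [u] for a suitable m, and since the resulting bound
    does not depend on the set, monotone convergence gives the half-plane. *)
Lemma hardy_limit e : 0 < e -> exists N, forall k, (N <= k)%N ->
  (int2R H (fun x => fsq (uk k x - u x) / x.2 ^+ 2) <= e%:E)%E.
Proof.
move=> e0; have e1 : 0 < e / 32 by rewrite divr_gt0.
have [N hN] := cauchy_grad e1; exists N => k Nk.
have mW j : mfun2 (exhaust j) (fun x => fsq (uk k x - u x) / x.2 ^+ 2).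
  by apply: (mfun2_sub mH (@exhaust_sub j)); exact: mfun2_weight.
have W0 j x : exhaust j x -> 0 <= fsq (uk k x - u x) / x.2 ^+ 2.
  by move=> _; rewrite divr_ge0 ?fsq_ge0 ?sqr_ge0.
rewrite -bigcup_exhaust; apply: int2_bigcup_le => //.
- exact: nondecreasing_exhaust.
- exact: measurable_exhaust.
move=> j; set c := j.+1%:R : R; have c0 : 0 < c by rewrite ltr0n.
(* On [exhaust j] the weight 1 / x_2^2 is at most c^2, so 2 c^2 times this error is e / 2; the other
   half is 2 times 8 times e / 32. *)
have e2 : 0 < e / (4 * c ^+ 2) by rewrite divr_gt0// mulr_gt0// exprn_gt0.
have [N' hN'] := hloc (@compact_box _ c c^-1) (@exhaust_sub j) e2.
pose m := maxn N N'.
have hm := hN' m (leq_maxr _ _); have hkm := hN k m Nk (leq_maxl _ _).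
have hH := hardy_field (tc k) (tc m) hkm.
rewrite !field_of_component in hH.
have mE := measurable_exhaust j.
have mkm : mfun2 H (fun x => fsq (uk k x - uk m x)).
  apply: mfun2_fsq => i i'.
  rewrite (ord1 i) (_ : (fun x => _) = (fun x => component i' (uk k) x - component i' (uk m) x)).
    by apply: measurable_funB; exact: test_fun_mfun2.
  by apply/funext => x; rewrite !mxE.
have m1 : mfun2 (exhaust j) (fun x => 2 * (fsq (uk k x - uk m x) / x.2 ^+ 2)).
  apply: measurable_funM => //; apply: (mfun2_sub mH (@exhaust_sub j)).
  exact: mfun2_weight.
have m2 : mfun2 (exhaust j) (fun x => (2 * c ^+ 2) * fsq (uk m x - u x)).
  by apply: measurable_funM => //; exact: (mfun2_sub mH (@exhaust_sub j)).
have c2 : 0 <= 2 * c ^+ 2 by rewrite mulr_ge0// sqr_ge0.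
have p1 x : exhaust j x -> 0 <= 2 * (fsq (uk k x - uk m x) / x.2 ^+ 2).
  by move=> _; rewrite mulr_ge0// divr_ge0 ?fsq_ge0 ?sqr_ge0.
have p2 x : exhaust j x -> 0 <= (2 * c ^+ 2) * fsq (uk m x - u x).
  by move=> _; rewrite mulr_ge0 ?fsq_ge0.
apply: (@le_trans _ _ (int2R (exhaust j) (fun x => 2 * (fsq (uk k x - uk m x) / x.2 ^+ 2) +
   (2 * c ^+ 2) * fsq (uk m x - u x)))).
  apply: int2_le => //; first exact: measurable_funD.
  move=> x xj; rewrite divr_ge0 ?fsq_ge0 ?sqr_ge0//=.
  have xH : 0 < x.2 by exact: exhaust_sub xj.
  have x2 : 0 < x.2 ^+ 2 by rewrite exprn_gt0.
  have xc : 1 / x.2 ^+ 2 <= c ^+ 2.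
    case: xj => _ /=; rewrite in_itv /= => /andP[h _].
    have xi : x.2^-1 <= c by rewrite -[c]invrK lef_pV2 ?posrE ?invr_gt0.
    by rewrite div1r -exprVn lerXn2r ?nnegrE ?invr_ge0 ?(ltW xH) ?(ltW c0).
  apply: (@le_trans _ _ (2 * (fsq (uk k x - uk m x) / x.2 ^+ 2) +
     2 * (fsq (uk m x - u x) * (1 / x.2 ^+ 2)))).
    rewrite div1r !mulrA -mulrDl ler_wpM2r ?invr_ge0 ?sqr_ge0//.
    rewrite !fsq_rV !mxE.
    have tri (p q : R) : (p + q) ^+ 2 <= 2 * p ^+ 2 + 2 * q ^+ 2.
      by have := sqr_ge0 (p - q); lra.
    have t1 := tri (uk k x ord0 ord0 - uk m x ord0 ord0) (uk m x ord0 ord0 - u x ord0 ord0).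
    have t2 := tri (uk k x ord0 ord_max - uk m x ord0 ord_max) (uk m x ord0 ord_max - u x ord0 ord_max).
    have q1 (p q s : R) : p - q + (q - s) = p - s by ring.
    by rewrite !q1 in t1 t2; lra.
  rewrite lerD2l -[leRHS]mulrA ler_wpM2l// [leRHS]mulrC.
  by rewrite ler_wpM2l ?fsq_ge0.
rewrite (int2D mE m1 m2 p1 p2).
rewrite (_ : e = 2 * (8 * (e / 32)) + 2 * c ^+ 2 * (e / (4 * c ^+ 2))); last first.
  by field; rewrite gt_eqF.
rewrite EFinD; apply: leeD.
  rewrite int2Z //; last 2 first.
  - by apply: (mfun2_sub mH (@exhaust_sub j)); exact: mfun2_weight.
  - by move=> x _; rewrite divr_ge0 ?fsq_ge0 ?sqr_ge0.
  rewrite [leRHS]EFinM; apply: lee_wpmul2l => //; apply: le_trans hH.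
  apply: int2_sub => //; first exact: mfun2_weight.
    exact: exhaust_sub.
  by move=> x _; rewrite divr_ge0 ?fsq_ge0 ?sqr_ge0.
rewrite int2Z //.
- by rewrite [leRHS]EFinM; apply: lee_wpmul2l.
- exact: (mfun2_sub mH (@exhaust_sub j)).
- by move=> x _; exact: fsq_ge0.
Qed.

End HardyLimit.

Lemma L2loc_measurable (uk : nat -> R * R -> 'rV[R]_2) (u : R * R -> 'rV[R]_2) :
  L2loc_cvg uk u -> forall i, mfun2 H (component i u).
Proof.
move=> hu i; rewrite -bigcup_exhaust; apply/measurable_fun_bigcup; first exact: measurable_exhaust.
move=> j; have [_ [mu _] _] := hu (exhaust j) (@compact_box _ _ _) (@exhaust_sub j).
exact: mu.
Qed.

Lemma Hdot1_0sigma_data (u : R * R -> 'rV[R]_2) : Hdot1_0sigma u ->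
  exists (uk : nat -> R * R -> 'rV[R]_2) (G : R * R -> 'M[R]_2),
  [/\ forall k, test_field_divfree (uk k), Hdot1_grad u G,
      forall e, 0 < e -> exists N, forall k, (N <= k)%N ->
        (int2R H (fun x => fsq (jacobian (uk k) x - G x)) <= e%:E)%E,
      forall K, compact K -> K `<=` H -> forall e, 0 < e ->
        exists N, forall k, (N <= k)%N ->
        (int2R K (fun x => fsq (uk k x - u x)) <= e%:E)%E &
      forall i, mfun2 H (component i u)].
Proof.
case=> uk [tuk [G gG [_ _ cG]] loc]; exists uk, G; split=> //.
- exact: (L2norm_cvg0P _ _).1 cG.
- move=> K cK KH; have [_ _ cK'] := loc K cK KH.
  exact: (L2norm_cvg0P _ _).1 cK'.
- exact: L2loc_measurable loc.
Qed.

Lemma test_field_bounded (w : R * R -> 'rV[R]_2) : test_field_divfree w ->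
  exists B P a, [/\ 0 < B, 0 < P, 0 < a, forall x, fsq (w x) <= B &
                    forall x, outside P a x -> fsq (w x) = 0].
Proof.
case=> tw _.
have [B0 B00 h0] := test_fun_bounded (tw ord0).
have [B1 B10 h1] := test_fun_bounded (tw ord_max).
have [P0 [a0 [P00 a00 s0]]] := test_fun_supp (tw ord0).
have [P1 [a1 [P10 a10 s1]]] := test_fun_supp (tw ord_max).
exists (B0 ^+ 2 + B1 ^+ 2), (P0 + P1), (Num.min a0 a1); split.
- by rewrite addr_gt0// exprn_gt0.
- exact: addr_gt0.
- by rewrite lt_min a00.
- move=> x; rewrite fsq_rV -/(component ord0 w x) -/(component ord_max w x).
  by apply: lerD; rewrite -real_normK ?num_real// lerXn2r ?nnegrE ?normr_ge0// ltW.
move=> x ox; rewrite fsq_rV -/(component ord0 w x) -/(component ord_max w x).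
rewrite s0 ?s1 ?expr0n ?addr0//; apply: outside_sub ox.
- by rewrite lerDr ltW.
- by rewrite ge_min lexx orbT.
- by rewrite lerDl ltW.
- by rewrite ge_min lexx.
Qed.

End Multipliers.

(** * Local convergence and convergence of the products *)

Section Assembly.
Variable R : realType.
Local Notation H := (@halfplane R).

Let mH : measurable (H : set (plane R)). Proof. exact: measurable_halfplane. Qed.

Lemma in_L2_jacobian (F : 'I_2 -> R * R -> R) (G : R * R -> 'M[R]_2) (a : R) :
  (forall i, test_fun (F i)) -> in_L2 H G ->
  (int2R H (fun x => fsq (jacobian (field_of F) x - G x)) <= a%:E)%E ->
  in_L2 H (jacobian (field_of F)).
Proof.
move=> tF [mG fG] ha; split; first exact: mfun2_jacobian.
rewrite L2norm_lty in fG; rewrite L2norm_lty.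
have Gfin : int2 H (fun x => fsq (G x)) \is a fin_num.
  rewrite ge0_fin_numE//; apply: int2_ge0 => x _; exact: fsq_ge0.
have m0 i j : mfun2 H (fun x : R * R => ((fun=> 0 : 'M[R]_2) x) i j).
  by rewrite (_ : (fun x => _) = cst 0); [exact: measurable_cst | apply/funext => x; rewrite mxE].
have h2 : (int2R H (fun x => fsq ((fun=> 0 : 'M[R]_2) x - G x)) <=
    (fine (int2 H (fun x => fsq (G x))))%:E)%E.
  rewrite fineK// (@int2_eq _ _ _ (fun x => fsq (G x)))// => x _.
  by rewrite sub0r /fsq; apply: eq_bigr => i _; apply: eq_bigr => j _; rewrite mxE sqrrN.
have := int2_fsq_triangle mH (mfun2_jacobian tF) m0 mG ha h2.
rewrite (@int2_eq _ _ _ (fun x => fsq (jacobian (field_of F) x))); last first.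
  by move=> x _; rewrite subr0.
by move=> /le_lt_trans; apply; exact: ltry.
Qed.

Lemma field_le_fsq (w : R * R -> 'rV[R]_2) (M : R) x : H x -> 0 <= M ->
  (forall i, `|component i w x| <= M / x.2) -> fsq (w x) <= 2 * M ^+ 2 / x.2 ^+ 2.
Proof.
move=> xH M0 hw; have x0 : 0 < x.2 by [].
have h i : component i w x ^+ 2 <= M ^+ 2 / x.2 ^+ 2.
  rewrite -expr_div_n -real_normK ?num_real// lerXn2r ?nnegrE ?normr_ge0//.
  by rewrite divr_ge0// ltW.
by have := h ord0; have := h ord_max; rewrite fsq_rV /component; lra.
Qed.

Lemma measurable_component_diff (w w' : R * R -> 'rV[R]_2) :
  (forall i, mfun2 H (component i w)) -> (forall i, mfun2 H (component i w')) ->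
  forall i, mfun2 H (component i (fun y => w y - w' y)).
Proof.
move=> mw mw' i.
rewrite (_ : component i _ = (fun x => component i w x - component i w' x)).
  by apply: measurable_funB; [exact: mw | exact: mw'].
by apply/funext => x; rewrite /component !mxE.
Qed.

Lemma mfun2_fsq_component (w : R * R -> 'rV[R]_2) :
  (forall i, mfun2 H (component i w)) -> mfun2 H (fun x => fsq (w x)).
Proof. by move=> mw; apply: mfun2_fsq => i j; rewrite (ord1 i); exact: mw. Qed.

Lemma fsqB_le (m n : nat) (A B : 'M[R]_(m, n)) : fsq (A - B) <= 2 * fsq A + 2 * fsq B.
Proof.
rewrite /fsq !mulr_sumr -big_split /=; apply: ler_sum => i _.
rewrite !mulr_sumr -big_split /=; apply: ler_sum => j _; rewrite !mxE.
have := sqr_ge0 (A i j + B i j); lra.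
Qed.

Section TensorConvergence.
Variables (v : R * R -> 'rV[R]_2) (vn : nat -> R * R -> 'rV[R]_2) (C : R).
Hypothesis C0 : 0 <= C.
Hypothesis mv : forall i, mfun2 H (component i v).
Hypothesis mvn : forall n i, mfun2 H (component i (vn n)).
Hypothesis hv : {ae @lebesgue2 R, forall x, H x -> fsq (v x) <= C / x.2 ^+ 2}.
Hypothesis hvn : forall n x, H x -> fsq (vn n x) <= C / x.2 ^+ 2.
Hypothesis hloc : forall P a e, 0 < a -> 0 < e -> exists N, forall n, (N <= n)%N ->
  (int2R (box P a) (fun x => fsq (vn n x - v x)) <= e%:E)%E.

Lemma in_L2_tensor (u w : R * R -> 'rV[R]_2) (a : R) :
  (forall i, mfun2 H (component i u)) -> (forall i, mfun2 H (component i w)) ->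
  {ae @lebesgue2 R, forall x, H x -> fsq (w x) <= C / x.2 ^+ 2} ->
  (int2R H (fun x => fsq (u x) / x.2 ^+ 2) <= a%:E)%E -> in_L2 H (tensor u w).
Proof.
move=> mu mw hw ha; split.
  move=> i j; rewrite (_ : (fun x => _) = (fun x => component i u x * component j w x)).
    by apply: measurable_funM; [exact: mu | exact: mw].
  by apply/funext => x; rewrite mxE.
rewrite L2norm_lty (@int2_eq _ _ _ (fun x => fsq (u x) * fsq (w x))); last first.
  by move=> x _; exact: fsq_tensor.
apply: le_lt_trans (ltry (C * a)); apply: int2_mult_le => //.
- exact: mfun2_fsq_component.
- exact: mfun2_fsq_component.
- by move=> x _; exact: fsq_ge0.
- by move=> x _; exact: fsq_ge0.
Qed.

Lemma tensor_cvg (u : R * R -> 'rV[R]_2) : Hdot1_0sigma u ->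
  L2_cvg H (fun n => tensor u (vn n)) (tensor u v).
Proof.
move=> /Hdot1_0sigma_data [uk [G [tuk [_ [mG _] _] hgrad uloc mu]]].
have lim := hardy_limit tuk mG hgrad uloc mu.
have muk k i : mfun2 H (component i (uk k)).
  by apply: test_fun_mfun2; case: (tuk k).
have mdu k := measurable_component_diff (muk k) mu.
have aeF : Filter (almost_everywhere (@lebesgue2 R)) by exact: ae_filter_ringOfSetsType.
(* The Hardy integral of [u] is finite: [u] is at finite weighted distance from a test field, which
   is bounded and supported away from the boundary. *)
have [a ha] : exists a, (int2R H (fun x => fsq (u x) / x.2 ^+ 2) <= a%:E)%E.
  have [N /(_ N (leqnn N)) h] := lim 1 ltr01.
  have [B [P [b [B0 P0 b0 hB sB]]]] := test_field_bounded (tuk N).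
  have m1 : mfun2 H (fun x => 2 * (fsq (uk N x - u x) / x.2 ^+ 2)).
    apply: measurable_funM => //; apply: mfun2_weight.
    exact: (mfun2_fsq_component (mdu N)).
  have m2 : mfun2 H (fun x => 2 * (fsq (uk N x) / x.2 ^+ 2)).
    by apply: measurable_funM => //; apply: mfun2_weight; exact: mfun2_fsq_component.
  have p1 x : H x -> 0 <= 2 * (fsq (uk N x - u x) / x.2 ^+ 2).
    by move=> _; rewrite mulr_ge0// divr_ge0 ?fsq_ge0 ?sqr_ge0.
  have p2 x : H x -> 0 <= 2 * (fsq (uk N x) / x.2 ^+ 2).
    by move=> _; rewrite mulr_ge0// divr_ge0 ?fsq_ge0 ?sqr_ge0.
  exists (2 * 1 + 2 * B / b ^+ 2 * (2 * P * P)).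
  apply: (@le_trans _ _ (int2R H (fun x => 2 * (fsq (uk N x - u x) / x.2 ^+ 2) +
     2 * (fsq (uk N x) / x.2 ^+ 2)))).
    apply: int2_le => //.
    - by apply: mfun2_weight; exact: mfun2_fsq_component.
    - exact: measurable_funD.
    move=> x xH; rewrite divr_ge0 ?fsq_ge0 ?sqr_ge0//= !mulrA -mulrDl.
    rewrite ler_wpM2r ?invr_ge0 ?sqr_ge0//.
    have := fsqB_le (uk N x) (uk N x - u x).
    by rewrite opprB addrC subrK addrC.
  rewrite (int2D mH m1 m2 p1 p2) EFinD; apply: leeD.
    rewrite int2Z //.
    - by rewrite EFinM; apply: lee_wpmul2l.
    - by apply: mfun2_weight; exact: (mfun2_fsq_component (mdu N)).
    - by move=> x _; rewrite divr_ge0 ?fsq_ge0 ?sqr_ge0.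
  have k0 : 0 <= 2 * B / b ^+ 2 by rewrite divr_ge0 ?sqr_ge0// mulr_ge0// ltW.
  apply: int2_supp_le => //.
    move=> x xH; rewrite p2//=.
    have [xb|xb] := ltP x.2 b.
      by rewrite sB ?mul0r ?mulr0//; left.
    rewrite -mulrA ler_wpM2l// ler_pM ?fsq_ge0 ?invr_ge0 ?sqr_ge0//.
    rewrite lef_pV2 ?posrE ?exprn_gt0// lerXn2r ?nnegrE ?(ltW b0)//.
    exact: ltW.
  move=> x ox; have [xb|xb] := ltP x.2 b; first by rewrite sB ?mul0r ?mulr0//; left.
  rewrite sB ?mul0r ?mulr0//; case: ox => [x0|]; last by right.
  by left; exact: lt_trans x0 b0.
split.
- move=> n; apply: in_L2_tensor ha => //.
  by apply: aeW => x xH; exact: hvn.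
- exact: in_L2_tensor ha.
apply/L2norm_cvg0P => e e0.
have cD : 0 < 8 * C + 1 by rewrite ltr_wpDl// mulr_ge0.
(* The squared length of vn - v is at most 4 C / x_2^2, and splitting [u] costs a factor 2; the
   added 1 covers the case C = 0. *)
have e1 : 0 < e / 2 / (8 * C + 1) by rewrite !divr_gt0.
have [k /(_ k (leqnn k)) hk] := lim _ e1.
have [B [P [b [B0 P0 b0 hB sB]]]] := test_field_bounded (tuk k).
have e2 : 0 < e / 2 / (2 * B) by rewrite !divr_gt0// mulr_gt0.
have [N hN] := @hloc P b _ b0 e2.
exists N => n /hN hn.
have mdv := measurable_component_diff (mvn n) mv.
pose d x := fsq (vn n x - v x).
have d0 x : 0 <= d x by exact: fsq_ge0.
have md : mfun2 H d by exact: (mfun2_fsq_component mdv).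
pose f x := fsq (uk k x - u x).
have f0 x : 0 <= f x by exact: fsq_ge0.
have mf : mfun2 H f by exact: (mfun2_fsq_component (mdu k)).
have mg : mfun2 H (fun x => fsq (uk k x)) by exact: mfun2_fsq_component.
have m1 : mfun2 H (fun x => 2 * (f x * d x)) by do 2 apply: measurable_funM => //.
have m2 : mfun2 H (fun x => 2 * (fsq (uk k x) * d x)) by do 2 apply: measurable_funM => //.
have p1 x : H x -> 0 <= 2 * (f x * d x) by move=> _; rewrite !mulr_ge0.
have p2 x : H x -> 0 <= 2 * (fsq (uk k x) * d x) by move=> _; rewrite !mulr_ge0 ?fsq_ge0.
rewrite (@int2_eq _ _ _ (fun x => fsq (u x) * d x)); last first.
  by move=> x _; rewrite tensorBr fsq_tensor.
apply: (@le_trans _ _ (int2R H (fun x => 2 * (f x * d x) + 2 * (fsq (uk k x) * d x)))).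
  apply: int2_le => //.
  - by apply: measurable_funM => //; exact: mfun2_fsq_component.
  - exact: measurable_funD.
  move=> x _; rewrite mulr_ge0 ?fsq_ge0//= !mulrA -mulrDl ler_wpM2r//.
  have := fsqB_le (uk k x) (uk k x - u x).
  by rewrite opprB addrC subrK addrC.
rewrite (int2D mH m1 m2 p1 p2) (_ : e = e / 2 + e / 2); last by field.
rewrite EFinD; apply: leeD.
  rewrite int2Z //; last 2 first.
  - exact: measurable_funM.
  - by move=> x _; rewrite mulr_ge0.
  apply: (@le_trans _ _ (2%:E * (4 * C * (e / 2 / (8 * C + 1)))%:E)%E).
    apply: lee_wpmul2l => //; apply: int2_mult_le => //; first by rewrite mulr_ge0.
    apply: filterS hv => x hx xH; apply: (le_trans (fsqB_le _ _)).
    have := hx xH; have := hvn n xH; lra.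
  rewrite -EFinM lee_fin.
  rewrite (_ : 2 * (4 * C * (e / 2 / (8 * C + 1))) = e / 2 * (8 * C) / (8 * C + 1)); last first.
    by field; rewrite gt_eqF.
  by rewrite ler_pdivrMr// ler_wpM2l ?lerDl// divr_ge0// ltW.
rewrite (@int2_eq _ _ _ (fun x => 2 * (((fun x => fsq (uk k x) * d x) \_ (box P b)) x))); last first.
  move=> x _; rewrite patchE; case: ifPn => //; rewrite notin_setE => nb.
  rewrite sB ?mul0r//; apply: contrapT => no; apply: nb; exact: not_outside.
have bH : box P b `<=` H.
  move=> z [_] /=; rewrite in_itv /= => /andP[bz _]; exact: lt_le_trans bz.
have mb : measurable (box P b : set (plane R)).
  by apply: measurableX; exact: measurable_itv.
apply: (@le_trans _ _ (int2R (box P b) (fun x => 2 * B * d x))).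
  rewrite /int2 [leLHS]integral_mkcond [leRHS]integral_mkcond.
  apply: ge0_le_integral => //.
  - move=> x _; rewrite patchE; case: ifPn => // _; rewrite lee_fin patchE.
    by case: ifPn => _; rewrite ?mulr0// !mulr_ge0 ?fsq_ge0.
  - apply/(measurable_restrictT (fun x => (2 * (((fun x => fsq (uk k x) * d x) \_ (box P b)) x))%:E) mH).
    apply/measurable_EFinP; apply: measurable_funM => //.
    apply/(measurable_restrict _ mb mH); rewrite setIidr//.
    by apply: (mfun2_sub mH bH); exact: measurable_funM.
  - apply/(measurable_restrictT (fun x => (2 * B * d x)%:E) mb).
    apply/measurable_EFinP; apply: measurable_funM => //.
    exact: (mfun2_sub mH bH).
  move=> x _; rewrite !patchE; case: ifPn => xH; case: ifPn => xb //.
  - by rewrite lee_fin -mulrA ler_wpM2l// ler_wpM2r.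
  - by rewrite mulr0.
  - by rewrite lee_fin !mulr_ge0// ltW.
rewrite int2Z //.
- apply: (@le_trans _ _ ((2 * B)%:E * (e / 2 / (2 * B))%:E)%E).
    by apply: lee_wpmul2l => //; rewrite lee_fin mulr_ge0// ltW.
  by rewrite -EFinM lee_fin mulrCA mulfV ?mulr1// gt_eqF// mulr_gt0.
- exact: (mfun2_sub mH bH).
- by rewrite mulr_ge0// ltW.
Qed.

End TensorConvergence.

(** The construction controls gradients only. Convergence to v itself is recovered through some
    phi_m: by Hardy's inequality its distance to W_n on a box is governed by the gradients, and
    phi_m is close to v on the box. *)
Lemma local_convergence (v : R * R -> 'rV[R]_2) (phi : nat -> R * R -> 'rV[R]_2)
    (G : R * R -> 'M[R]_2) (W : nat -> 'I_2 -> R * R -> R) :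
  (forall k, test_field_divfree (phi k)) ->
  (forall i j, mfun2 H (fun x => G x i j)) ->
  (forall e, 0 < e -> exists N, forall k, (N <= k)%N ->
     (int2R H (fun x => fsq (jacobian (phi k) x - G x)) <= e%:E)%E) ->
  (forall K, compact K -> K `<=` H -> forall e, 0 < e ->
     exists N, forall k, (N <= k)%N ->
     (int2R K (fun x => fsq (phi k x - v x)) <= e%:E)%E) ->
  (forall i, mfun2 H (component i v)) ->
  (forall n i, test_fun (W n i)) ->
  (forall e, 0 < e -> exists N, forall n, (N <= n)%N ->
     (int2R H (fun x => fsq (jacobian (field_of (W n)) x - G x)) <= e%:E)%E) ->
  forall P a e, 0 < a -> 0 < e -> exists N, forall n, (N <= n)%N ->
  (int2R (box P a) (fun x => fsq (field_of (W n) x - v x)) <= e%:E)%E.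
Proof.
move=> tphi mG hgrad hloc mv tW hW P a e a0 e0.
have bH : box P a `<=` H.
  move=> z [_] /=; rewrite in_itv /= => /andP[az _]; exact: lt_le_trans az.
have mb : measurable (box P a : set (plane R)).
  by apply: measurableX; exact: measurable_itv.
pose Q := `|P| + 1; have Q0 : 0 < Q by rewrite ltr_wpDl.
have Q2 : 0 < Q ^+ 2 by rewrite exprn_gt0.
(* On the box x_2 <= Q, and Q^2 times 8 times 4 d equals e / 4. *)
pose d := e / (128 * Q ^+ 2); have d0 : 0 < d by rewrite divr_gt0// mulr_gt0.
have e4 : 0 < e / 4 by rewrite divr_gt0.
have [N1 h1] := hgrad _ d0.
have [N2 h2] := hloc _ (@compact_box _ P a) bH _ e4.
have [N3 h3] := hW _ d0.
pose m := maxn N1 N2; exists N3 => n /h3 hn.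
have hm1 := h1 m (leq_maxl _ _); have hm2 := h2 m (leq_maxr _ _).
have tm i : test_fun (component i (phi m)) by case: (tphi m).
have mJ i j : mfun2 H (fun x => jacobian (phi m) x i j).
  by rewrite -[phi m]field_of_component; exact: mfun2_jacobian.
have hD : (int2R H (denergy (W n) (fun i => component i (phi m))) <= (2 * d + 2 * d)%:E)%E.
  have := int2_fsq_triangle mH (mfun2_jacobian (tW n)) mJ mG hn hm1.
  apply: le_trans; rewrite le_eqVlt; apply/orP; left; apply/eqP; apply: int2_eq => x _.
  by rewrite denergyE field_of_component.
have hH := hardy_field (tW n) tm hD.
rewrite field_of_component in hH.
have mWn i : mfun2 H (component i (field_of (W n))).
  by rewrite component_field_of; exact: test_fun_mfun2.
have mphi i : mfun2 H (component i (phi m)) by exact: test_fun_mfun2.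
have mdiff := mfun2_fsq_component (measurable_component_diff mWn mphi).
have mwd := mfun2_weight mdiff.
have hB : (int2R (box P a) (fun x => fsq (field_of (W n) x - phi m x)) <= (e / 4)%:E)%E.
  have wd0 x : 0 <= fsq (field_of (W n) x - phi m x) / x.2 ^+ 2.
    by rewrite divr_ge0 ?fsq_ge0 ?sqr_ge0.
  apply: (@le_trans _ _ (int2R (box P a) (fun x => Q ^+ 2 * (fsq (field_of (W n) x - phi m x) / x.2 ^+ 2)))).
    apply: int2_le => //.
    - exact: (mfun2_sub mH bH).
    - by apply: measurable_funM => //; exact: (mfun2_sub mH bH).
    move=> x xb; rewrite fsq_ge0 /= mulrCA ler_peMr ?fsq_ge0//.
    have xH := bH x xb; have x0 : 0 < x.2 by [].
    rewrite ler_pdivlMr ?exprn_gt0// mul1r lerXn2r ?nnegrE ?(ltW x0) ?(ltW Q0)//.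
    case: xb => _ /=; rewrite in_itv /= => /andP[_ xP]; apply: (le_trans xP).
    by apply: (le_trans (ler_norm _)); rewrite /Q lerDl.
  rewrite int2Z //; [|exact: (mfun2_sub mH bH)|exact: ltW].
  apply: (@le_trans _ _ ((Q ^+ 2)%:E * (8 * (2 * d + 2 * d))%:E)%E).
    apply: lee_wpmul2l; first by rewrite lee_fin ltW.
    apply: le_trans hH; apply: int2_sub => //.
  rewrite -EFinM lee_fin /d le_eqVlt; apply/orP; left; apply/eqP.
  by field; rewrite gt_eqF.
have msub (w : R * R -> 'rV[R]_2) : (forall i, mfun2 H (component i w)) ->
    forall i j, mfun2 (box P a) (fun x => w x i j).
  by move=> mw i j; rewrite (ord1 i); exact: (mfun2_sub mH bH (mw j)).
have hv' : (int2R (box P a) (fun x => fsq (v x - phi m x)) <= (e / 4)%:E)%E.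
  apply: le_trans hm2; rewrite le_eqVlt; apply/orP; left; apply/eqP; apply: int2_eq => x _.
  by rewrite /fsq; apply: eq_bigr => i _; apply: eq_bigr => j _; rewrite !mxE -sqrrN opprB.
have := int2_fsq_triangle mb (msub _ mWn) (msub _ mv) (msub _ mphi) hB hv'.
by rewrite (_ : 2 * (e / 4) + 2 * (e / 4) = e)//; field.
Qed.

End Assembly.

Theorem lemma2p7 (R : realType) (omega : R * R -> R)
    (homega : omega = @omega0 R \/ omega = @omega1 R \/ omega = @omega2 R)
    (v : R * R -> 'rV[R]_2)
    (hv : Hdot1_0sigma v)
    (hvw : in_Linfty_weighted (fun x => Num.sqrt (omega x)) v) :
  exists vn : nat -> R * R -> 'rV[R]_2,
    [/\ forall n, test_field_divfree (vn n),
        Hdot1_cvg vn v &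
        forall u : R * R -> 'rV[R]_2, Hdot1_0sigma u ->
          L2_cvg (@halfplane R) (fun n => tensor u (vn n)) (tensor u v)].
Proof.
have [phi [G [tphi gG hgrad hloc mv]]] := Hdot1_0sigma_data hv.
have [_ iG _] := gG; have [mG fG] := iG.
have [C0 C00 hC0] := weighted_bound homega hvw.
have mH := @measurable_halfplane R.
have Gfin : int2 (@halfplane R) (fun x => fsq (G x)) \is a fin_num.
  rewrite L2norm_lty in fG; rewrite ge0_fin_numE//.
  by apply: int2_ge0 => x _; exact: fsq_ge0.
have hG : (int2R (@halfplane R) (fun x => fsq (G x)) <=
    (fine (int2 (@halfplane R) (fun x => fsq (G x))))%:E)%E by rewrite fineK.
have [M M0 hM] := bounded_approximation tphi mG hG hgrad hloc mv C00 hC0.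
have /choice [W hW] : forall n : nat, exists F, [/\ div_free F,
    forall i x, halfplane x -> `|F i x| <= M / x.2 &
    (int2R (@halfplane R) (fun x => fsq (jacobian (field_of F) x - G x)) <= (n.+1%:R^-1)%:E)%E].
  by move=> n; apply: hM; rewrite invr_gt0 ltr0n.
have tW n i : test_fun (W n i) by have [[]] := hW n.
have cW e : 0 < e -> exists N, forall n, (N <= n)%N ->
    (int2R (@halfplane R) (fun x => fsq (jacobian (field_of (W n)) x - G x)) <= e%:E)%E.
  move=> e0; exists (Num.Def.archi_bound e^-1) => n hn.
  have [_ _ h] := hW n; apply: (le_trans h); rewrite lee_fin.
  rewrite -[e]invrK lef_pV2 ?posrE ?invr_gt0 ?ltr0n//.
  apply: (le_trans (ltW (archi_boundP _))); first by rewrite invr_ge0 ltW.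
  by rewrite ler_nat (leq_trans hn).
(* A common constant for v and for all the approximations, since the multiplier estimate is applied
   to their difference. *)
pose K := 2 * M ^+ 2 + C0.
have K0 : 0 <= K by rewrite addr_ge0// mulr_ge0// sqr_ge0.
have hWK n x : halfplane x -> fsq (field_of (W n) x) <= K / x.2 ^+ 2.
  move=> xH; apply: (@le_trans _ _ (2 * M ^+ 2 / x.2 ^+ 2)).
    by apply: field_le_fsq => // i; rewrite component_field_of; have [_ h _] := hW n; exact: h.
  by rewrite ler_wpM2r ?invr_ge0 ?sqr_ge0// /K lerDl.
have hvK : {ae @lebesgue2 R, forall x, halfplane x -> fsq (v x) <= K / x.2 ^+ 2}.
  have aeF : Filter (almost_everywhere (@lebesgue2 R)) by exact: ae_filter_ringOfSetsType.
  apply: filterS hC0 => x hx /hx h; apply: (le_trans h).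
  by rewrite ler_wpM2r ?invr_ge0 ?sqr_ge0// /K lerDr mulr_ge0// sqr_ge0.
exists (fun n => field_of (W n)); split.
- by move=> n; apply: field_of_divfree; have [] := hW n.
- exists G => //; split=> //.
  + by move=> n; have [_ _ h] := hW n; exact: (in_L2_jacobian (tW n) iG h).
  + exact/L2norm_cvg0P.
- move=> u hu; apply: (tensor_cvg K0 mv _ hvK hWK _ hu).
    by move=> n i; rewrite component_field_of; exact: test_fun_mfun2.
  exact: (local_convergence tphi mG hgrad hloc mv tW cW).
Qed.
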